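(* Let $d\ge3$, $b=d-1$, and let $\mathbb T_d$ be the infinite $d$-regular tree (so $p_c(\mathbb T_d)=1/b$). For every $p\in(1/b,1]$, every $\mu>0$ and every initial bond configuration $\eta_0$, the speed of the random walk on dynamical percolation on $\mathbb T_d$ satisfies $$v_p(\mu)\ge\frac{p^3\,(p\tilde\theta_p)^9}{48\,e^2\,d^3\log d}.$$ In particular, there exists a constant $c=c(d)>0$ such that $v_p(\mu)\ge c\,(p-p_c)^9$ for all $\mu>0$ as $p\downarrow p_c$.
   Context: $\tilde\theta_p$ is the probability that the root of the infinite $b$-ary tree (root of degree $b$, all other vertices of degree $d=b+1$) lies in an infinite open cluster under Bernoulli-$p$ bond percolation. Random walk on dynamical percolation: $G=(V,E)$ connected, locally finite, with distinguished vertex $o$ and graph distance $\mathrm{dist}$. Given $p\in(0,1]$ and $\mu>0$, each edge refreshes at the times of an independent rate-$\mu$ Poisson process, its state being resampled (independently of everything) to open with probability $p$ and closed with probability $1-p$; $\eta_t\in\{0,1\}^E$ is the environment at time $t$. The walker $X_t$, $X_0=o$, attempts jumps at the times of an independent rate-$1$ Poisson process, choosing a uniform neighbor and jumping iff the connecting edge is open at that time. Speed: for transitive $G$ there is a deterministic $v_p(\mu)\in[0,1]$, independent of the initial configuration, such that $\mathrm{dist}(X_0,X_t)/t\to v_p(\mu)$ almost surely and in $L^1$ for every initial configuration. *)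

(* Defs.v *)
From HB Require Import structures.
From mathcomp Require Import all_boot all_order all_algebra.
From mathcomp Require Import all_classical all_reals all_analysis.
Set Implicit Arguments. Unset Strict Implicit. Unset Printing Implicit Defensive.
Import Order.TTheory GRing.Theory Num.Theory.
Local Open Scope ring_scope.
Local Open Scope classical_set_scope.

Definition iid_uniform (R : realType) (dO : measure_display)
  (O : measurableType dO) (I : eqType) (P : probability O R)
  (U : I -> O -> R) : Prop :=
  (forall i, measurable_fun setT (U i)) /\
  (forall (s : seq I) (a : I -> R), uniq s ->
     (forall i, 0 <= a i <= 1) ->
     P [set w | forall i, i \in s -> U i w <= a i] =
       ((\prod_(i <- s) a i)%:E)%E).

(* The d-regular tree T_d.  Vertices are words v : seq nat; the root o is    *)
(* [::]; the children of the root are [:: j] (j < d), and the children of a  *)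
(* non-root vertex v are rcons v j (j < d-1).  Hence the root has degree d   *)
(* and every other vertex has degree (d-1)+1 = d.  The graph distance from   *)
(* the root o to v is the length (size v) of the word v.                     *)
(* Each edge is identified with its endpoint farther from the root (a        *)
(* non-root vertex).                                                         *)
Definition valid_Td (d : nat) (v : seq nat) : bool :=
  match v with
  | [::] => true
  | a :: s => (a < d)%N && all (fun j => (j < d.-1)%N) s
  end.

Definition dist_root (v : seq nat) : nat := size v.

(* The j-th neighbour (0 <= j < d) of v in T_d: for the root, the child j;  *)
(* for a non-root vertex, neighbour 0 is the parent and neighbour j >= 1 is *)
(* the child j-1.  (For j >= d we return v itself: "no move".)              *)
Definition nbr (d : nat) (v : seq nat) (j : nat) : seq nat :=
  if (d <= j)%N then v else
  match v with
  | [::] => [:: j]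
  | _ :: _ => if j == 0%N then take (size v).-1 v else rcons v j.-1
  end.

Definition edge_of (v w : seq nat) : seq nat :=
  if (size v < size w)%N then w else v.

(* Graphical construction of random walk on dynamical percolation on T_d.    *)
(* Randomness: an i.i.d. Uniform[0,1] family indexed by dyn_index:           *)
(*   inl (e, k, false) : k-th inter-refresh time of edge e, Exp(mu) via      *)
(*                       -ln(U)/mu                                            *)
(*   inl (e, k, true)  : k-th refresh of edge e: open iff U < p              *)
(*                       (i.e. open with prob. p, closed with prob. 1-p)     *)
(*   inr (k, false)    : k-th inter-attempt time of the walker, Exp(1)       *)
(*   inr (k, true)     : k-th uniformly chosen neighbour, floor(d U)         *)
Definition dyn_index : eqType := ((seq nat * nat * bool) + (nat * bool))%type.

Section Dynamics.
Variables (R : realType) (d : nat) (p mu : R) (eta0 : seq nat -> bool).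
Variables (dO : measure_display) (O : measurableType dO).
Variable (U : dyn_index -> O -> R).

(* time of the (n+1)-th refresh of edge e: points of a rate-mu Poisson process *)
Definition refresh_time (e : seq nat) (n : nat) (w : O) : R :=
  \sum_(k < n.+1) (- ln (U (inl (e, nat_of_ord k, false)) w) / mu).

Definition refresh_open (e : seq nat) (k : nat) (w : O) : bool :=
  U (inl (e, k, true)) w < p.

(* environment eta_t(e): state resampled at the last refresh time <= t,    *)
(* or the initial state eta0 e if e has not been refreshed by time t.      *)
Definition env (t : R) (e : seq nat) (w : O) : bool :=
  match pselect (exists n, t < refresh_time e n w) with
  | left h =>
      match @ex_minn (fun n => t < refresh_time e n w) h with
      | 0%N => eta0 e
      | k.+1 => refresh_open e k w
      end
  | right _ => eta0 e
  end.

(* time of the (k+1)-th jump attempt of the walker: rate-1 Poisson process *)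
Definition walk_time (k : nat) (w : O) : R :=
  \sum_(i < k.+1) (- ln (U (inr (nat_of_ord i, false)) w)).

Definition walk_choice (k : nat) (w : O) : nat :=
  Num.truncn (d%:R * U (inr (k, true)) w).

Fixpoint jump_chain (k : nat) (w : O) : seq nat :=
  match k with
  | 0%N => [::]
  | k'.+1 =>
      let v := jump_chain k' w in
      let u := nbr d v (walk_choice k' w) in
      if env (walk_time k' w) (edge_of v u) w then u else v
  end.

Definition position (t : R) (w : O) : seq nat :=
  match pselect (exists n, t < walk_time n w) with
  | left h => jump_chain (@ex_minn (fun n => t < walk_time n w) h) w
  | right _ => [::]
  end.

End Dynamics.

(* "v_p(mu) >= v" for the walk on dynamical percolation on T_d started from *)
(* o with initial configuration eta0: for every probability space carrying  *)
(* the driving randomness, almost surely                                    *)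
(*      liminf_{t -> oo} dist(X_0, X_t) / t >= v.                           *)
Definition speed_at_least (R : realType) (d : nat) (p mu : R)
  (eta0 : seq nat -> bool) (v : R) : Prop :=
  forall (dO : measure_display) (O : measurableType dO)
    (P : probability O R) (U : dyn_index -> O -> R),
    iid_uniform P U ->
    {ae P, forall w, forall eps : R, 0 < eps ->
       exists T : R, forall t : R, T <= t ->
         v - eps <= (dist_root (position d p mu eta0 U t w))%:R / t}.

(* Bernoulli-p bond percolation on the b-ary tree (root degree b, others    *)
(* degree b+1).  Vertices: words over {0..b-1}; the edge to v (from its     *)
(* parent) is labelled by v and is open iff W v < p.  The open cluster of   *)
(* the root consists of the vertices whose path from the root is open.      *)
Definition root_cluster (R : realType) (b : nat) (p : R)
  (dO : measure_display) (O : measurableType dO)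
  (W : seq nat -> O -> R) (w : O) : set (seq nat) :=
  [set v | all (fun j => (j < b)%N) v /\
           forall k, (0 < k <= size v)%N -> W (take k v) w < p].

Definition theta_tilde (R : realType) (b : nat) (p : R)
  (dO : measure_display) (O : measurableType dO) (P : probability O R)
  (W : seq nat -> O -> R) : R :=
  fine (P [set w | ~ finite_set (root_cluster b p W w)]).

(* Main.v *)
Require Import Defs.
From HB Require Import structures.
From mathcomp Require Import all_boot all_order all_algebra.
From mathcomp Require Import all_classical all_reals all_analysis.
From mathcomp Require Import measurable_realfun zify ring lra.
Import Order.TTheory GRing.Theory Num.Theory.
Local Open Scope ring_scope.
Local Open Scope classical_set_scope.
Set Implicit Arguments. Unset Strict Implicit. Unset Printing Implicit Defensive.
Import numFieldNormedType.Exports.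

(** Between two attempts of the walker every edge is either kept, with
    probability [r = exp (- mu * gap)], or resampled, and given the gap this
    happens independently over the edges.  Hence the law of the walk observed at
    its attempts is an iteration of finite-dimensional operators [resample].

    Given a configuration, let [h x] be the product of [1 / (1 + sg)] over those
    vertices of the path from the root to [x] from which an open path of length
    [k + 1] goes downwards.  One step of the walk in a frozen configuration
    satisfies the Hardy inequality [P h <= exp (- F) h], where [F] is a local
    function of the environment seen from the walker.  Steps along a given letter
    are involutions, so [P] is symmetric and a Schur test gives
    [E (exp (sum of F along the walk); X_n = y) <= 1], whatever the environment
    does between the attempts; no dependence on [mu] enters.

    Bernoulli percolation is stationary for the environment seen from the walker,
    and local observables forget the initial configuration because each gap
    resamples everything with positive probability.  A corrector built from this
    gives an exponential bound on the probability that the sum of [F] is below half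
    its mean.  The mean of [F] is at least [(p theta)^5 / (8 d^2)] for a
    suitable [sg] and large [k]: three disjoint surviving branches at the walker
    contribute [(p theta)^3], and the corrections are made small by the choice of [sg]
    and by the convergence of the survival probabilities.  So
    [P (X_n = y)] is exponentially small uniformly in [y], while balls of radius
    [r] have at most [2 d^r] vertices. *)

(** * Independent uniform families under a finite measure *)

(** Successive steps are far from independent: an edge that has been crossed remembers its state,
    all the more so for small [mu], and there is no renewal to exploit. So the decisive estimate is
    made for a frozen configuration. It says that the tilted one-step operator is an l2 contraction
    on the vertices, a property that survives averaging over configurations. The tilt of a step is
    the mean of [F] at its two ends, which keeps the kernel symmetric. Among three surviving
    branches at most one leads to the parent; the two others contribute about [2 sg] against a loss
    [sg] from the step to the parent. Errors of order [sg ^+ 2] force [sg] of order [y ^+ 2 / d],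
    with [y] a lower bound of [p theta]; with the cube from the three branches this gives the fifth
    power. Survival is cut at a finite depth so that [F] is local, and the price is that [F] must
    also pay for branches that die at the last level. The outcome is the bound
    [y ^+ 5 / (128 d ^+ 2 ln d)], from which the stated one follows by [e ^+ 2 >= 4], [d >= 3] and
    [p, y <= 1]. *)

Section iid.
Variables (R : realType) (dO : measure_display) (O : measurableType dO) (I : eqType).
Implicit Types (Q : {measure set O -> \bar R}) (U : I -> O -> R).

Definition box U (s : seq I) (a : I -> R) : set O :=
  [set w | forall i, i \in s -> U i w <= a i].

(** The mass of [Q] is left free: restricting a probability to an outcome of the first step gives a
    finite measure under which the shifted family is again of this kind, and the induction over
    steps runs on this. *)
Definition iid_measure Q U : Prop := Q setT \is a fin_num /\
  (forall i, measurable_fun setT (U i)) /\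
  (forall (s : seq I) (a : I -> R), uniq s -> (forall i, 0 <= a i <= 1) ->
    Q (box U s a) = (Q setT * (\prod_(i <- s) a i)%:E)%E).

Definition clamp (x : R) : R := Num.max 0 (Num.min x 1).

Lemma clamp01 x : 0 <= clamp x <= 1.
Proof. by rewrite /clamp le_max lexx ge_max ler01 ge_min lexx orbT. Qed.

Lemma clamp_id x : 0 <= x <= 1 -> clamp x = x.
Proof. by move=> /andP[? ?]; rewrite /clamp (min_idPl _)// (max_idPr _). Qed.

Lemma box_nil U a : box U [::] a = setT.
Proof. by apply/seteqP; split => // w _ i; rewrite in_nil. Qed.

Lemma box_cons U i s a : box U (i :: s) a = [set w | U i w <= a i] `&` box U s a.
Proof.
apply/seteqP; split => w /=.
  move=> h; split; first by apply: h; rewrite mem_head.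
  by move=> j js; apply: h; rewrite in_cons js orbT.
by move=> [h1 h2] j; rewrite in_cons => /orP[/eqP->//|/h2].
Qed.

Lemma measurable_le_cst d (T : measurableType d) (f : T -> R) (a : R) :
  measurable_fun setT f -> measurable [set w | f w <= a].
Proof.
move=> mf; rewrite -[X in measurable X]setTI.
rewrite (_ : [set w | _] = f @^-1` `]-oo, a]%classic); first exact: mf.
by apply/seteqP; split => w; rewrite /= in_itv.
Qed.

Lemma measurable_box d (T : measurableType d) (V : I -> T -> R) (s : seq I) a :
  (forall i, i \in s -> measurable_fun setT (V i)) ->
  measurable [set w | forall i, i \in s -> V i w <= a i].
Proof.
elim: s => [|i s IH] mV.
  rewrite (_ : [set w | _] = setT) //.
  by apply/seteqP; split => // w _ j; rewrite in_nil.
rewrite (_ : [set w | _] =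
   [set w | V i w <= a i] `&` [set w | forall j, j \in s -> V j w <= a j]).
  apply: measurableI; first by apply: measurable_le_cst; apply: mV; rewrite mem_head.
  by apply: IH => j js; apply: mV; rewrite in_cons js orbT.
apply/seteqP; split => w /=.
  move=> h; split; first by apply: h; rewrite mem_head.
  by move=> j js; apply: h; rewrite in_cons js orbT.
by move=> [h1 h2] j; rewrite in_cons => /orP[/eqP->//|/h2].
Qed.

Lemma iid_measure_fin Q U S : iid_measure Q U -> measurable S -> Q S \is a fin_num.
Proof.
move=> [h _] mS; rewrite ge0_fin_numE//; apply: (@le_lt_trans _ _ (Q setT)).
  by apply: le_measure; rewrite ?inE.
by rewrite -ge0_fin_numE.
Qed.

Lemma iid_measure_le Q U i a : iid_measure Q U -> 0 <= a <= 1 ->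
  Q [set w | U i w <= a] = (Q setT * a%:E)%E.
Proof.
move=> [_ [_ h]] a01; have := h [:: i] (fun _ => a) isT (fun _ => a01).
rewrite box_cons box_nil setIT big_seq1 => <- //.
Qed.

Lemma iid_measure_gt1 Q U i : iid_measure Q U -> Q [set w | 1 < U i w] = 0%E.
Proof.
move=> iU; have mU := iU.2.1 i.
have mS : measurable [set w | U i w <= 1] by exact: measurable_le_cst.
have -> : [set w | 1 < U i w] = setT `\` [set w | U i w <= 1].
  by apply/seteqP; split => w /=; [move=> h; split => //; apply/negP; rewrite -ltNge|
    move=> [_ /negP]; rewrite -ltNge].
rewrite measureD//; last by rewrite ltey_eq iU.1.
rewrite setTI [X in (_ - X)%E](_ : _ = Q setT).
  by rewrite subee// iU.1.
by rewrite -[RHS]mule1; apply: (iid_measure_le i iU); rewrite ler01 lexx.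
Qed.

(** A negative threshold forces the null event [U i <= 0]; thresholds above 1 change the box only on
    the null set where some coordinate exceeds 1. [clamp] is the distribution function of the
    uniform law. *)
Lemma iid_measure_clamp Q U : iid_measure Q U -> forall s a, uniq s ->
  Q (box U s a) = (Q setT * (\prod_(i <- s) clamp (a i))%:E)%E.
Proof.
move=> iU s a us.
have mU i : measurable_fun setT (U i) by exact: iU.2.1.
have mB b t : measurable (box U t b) by apply: measurable_box => i _; exact: mU.
have [/hasP[i is_ ai0]|/hasPn h0] := boolP (has (fun i => a i < 0) s).
  have -> : \prod_(i <- s) clamp (a i) = 0.
    by rewrite (big_rem i)//= /clamp (max_idPl _) ?mul0r// ge_min (ltW ai0).
  rewrite mule0; apply/eqP; rewrite eq_le measure_ge0 andbT.
  have <- : Q [set w | U i w <= 0] = 0%E by rewrite (iid_measure_le i iU) ?lexx ?ler01// mule0.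
  apply: le_measure; rewrite ?inE//; first exact: measurable_le_cst.
  by move=> w /(_ _ is_) /= h; apply: le_trans h _; exact: ltW.
rewrite -(iU.2.2 s (fun i => clamp (a i)) us (fun i => clamp01 _)).
have h0' i : i \in s -> 0 <= a i by move=> /h0; rewrite -leNgt.
pose N := \big[setU/set0]_(i <- s) [set w | 1 < U i w].
have mg i : measurable [set w | 1 < U i w].
  rewrite (_ : [set w | 1 < U i w] = ~` [set w | U i w <= 1]).
    by apply: measurableC; exact: measurable_le_cst.
  by apply/seteqP; split => w /=; [move=> h; apply/negP; rewrite -ltNge|move=> /negP; rewrite -ltNge].
have N0 : Q N = 0%E.
  rewrite /N; elim: (s) => [|i t IH]; first by rewrite big_nil measure0.
  rewrite big_cons; apply/eqP; rewrite eq_le measure_ge0 andbT.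
  rewrite measureU0//; first by rewrite (iid_measure_gt1 i iU).
  by apply: bigsetU_measurable.
have mN : measurable N by apply: bigsetU_measurable.
apply/eqP; rewrite eq_le; apply/andP; split.
  rewrite -(measureU0 (mu:=Q) (mB (fun i => clamp (a i)) s) mN N0).
  apply: le_measure; rewrite ?inE//; first by apply: measurableU.
  move=> w h /=; have [?|nw] := pselect (N w); [by right|left => i is_].
  move: (h i is_) => hi; rewrite /clamp le_max le_min hi /=; apply/orP; right.
  rewrite leNgt; apply/negP => u1; apply: nw; rewrite /N.
  elim: (s) is_ => // j t IH; rewrite in_cons big_cons => /orP[/eqP<-|/IH h']; by [left|right].
apply: le_measure; rewrite ?inE//.
move=> w h i is_; apply: le_trans (h i is_) _.
by rewrite /clamp ge_max h0'// ge_min lexx.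
Qed.

(** A pi-system generating the events of the coordinates in [J]. It contains the whole space, so
    finite measures that agree on it agree on the generated sigma-algebra. *)
Definition genU U (J : I -> Prop) : set (set O) :=
  [set S | exists s a, [/\ uniq s, (forall i, i \in s -> J i) & S = box U s a]].

Lemma genU_sub U J : (forall i, measurable_fun setT (U i)) ->
  genU U J `<=` measurable.
Proof. by move=> mU _ [s [a [_ _ ->]]]; apply: measurable_box => i _; exact: mU. Qed.

Lemma setI_closed_genU U J : setI_closed (genU U J).
Proof.
move=> _ _ [s [a [us sJ ->]]] [t [b [ut tJ ->]]].
exists (undup (s ++ t)), (fun i => if i \in s then if i \in t then Num.min (a i) (b i) else a i else b i).
split; first exact: undup_uniq.
  by move=> i; rewrite mem_undup mem_cat => /orP[/sJ|/tJ].
rewrite /box; apply/seteqP; split => w /=.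
  move=> [h1 h2] i; rewrite mem_undup mem_cat.
  have := h1 i; have := h2 i.
  have [is_|nis] := boolP (i \in s); have [it_|nit] := boolP (i \in t) => //= h h' hh.
  by rewrite le_min h// h'.
move=> h; split=> i iS; have := h i; rewrite mem_undup mem_cat iS ?orbT.
  by move=> /(_ isT); case: ifP => // _; rewrite le_min => /andP[].
by move=> /(_ isT); case: ifP => // _; rewrite le_min => /andP[].
Qed.

Lemma genU_setT U J : genU U J setT.
Proof. by exists [::], (fun=> 0); split => //; rewrite box_nil. Qed.

Lemma genU_uniq (m1 m2 : {measure set O -> \bar R}) U J :
  (forall i, measurable_fun setT (U i)) -> (m1 setT < +oo)%E ->
  (forall S, genU U J S -> m1 S = m2 S) ->
  forall S, <<s genU U J >> S -> m1 S = m2 S.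
Proof.
move=> mU m1oo h; apply: (g_sigma_algebra_measure_unique (genU U J) (genU_sub mU)
  (fun _ : nat => setT)) => //.
- by move=> _; exact: genU_setT.
- by apply/seteqP; split => // w _; exists 0%N.
- exact: setI_closed_genU.
Qed.

Lemma sigma_sub U J : (forall i, measurable_fun setT (U i)) ->
  <<s genU U J >> `<=` measurable.
Proof.
by move=> mU; apply: smallest_sub; [exact: sigma_algebra_measurable|exact: genU_sub].
Qed.

(** The sample space with only the events of the coordinates in [J]. Measurability on this type says
    that a function reads those coordinates alone; independence of the others is expressed in this
    way from here on. *)
Definition subsigma U J := g_sigma_algebraType (genU U J).

Lemma measurable_toOJ U J : (forall i, measurable_fun setT (U i)) ->
  measurable_fun setT (idfun : O -> subsigma U J).
Proof. by move=> mU _ Y mY; rewrite setTI preimage_id; exact: (sigma_sub mU mY). Qed.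

Lemma measurable_from_subsigma U J d (T : measurableType d) (f : O -> T) :
  (forall i, measurable_fun setT (U i)) ->
  measurable_fun (setT : set (subsigma U J)) (f : subsigma U J -> T) -> measurable_fun setT f.
Proof. by move=> mU mf _ Y mY; exact: (sigma_sub mU (mf measurableT Y mY)). Qed.

Lemma measurable_coord U (J : I -> Prop) i : J i ->
  measurable_fun (setT : set (subsigma U J)) (U i : subsigma U J -> R).
Proof.
move=> Ji; apply: (measurability _ (RGenOInfty.measurableE R)) => // _ [_ [x ->] <-].
rewrite setTI (_ : _ @^-1` _ = ~` [set w | U i w <= x]).
  apply: measurableC; apply: sub_sigma_algebra; exists [:: i], (fun=> x); split => //.
    by move=> j; rewrite inE => /eqP->.
  by rewrite box_cons box_nil setIT.
by apply/seteqP; split => w /=; rewrite in_itv/= andbT; [move=> h; apply/negP; rewrite -ltNge|move=> /negP; rewrite -ltNge].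
Qed.

Lemma sigma_mono U (J K : I -> Prop) : (forall i, J i -> K i) ->
  <<s genU U J >> `<=` <<s genU U K >>.
Proof.
move=> JK; apply: smallest_sub; first exact: smallest_sigma_algebra.
by move=> _ [s [a [us sJ ->]]]; apply: sub_sigma_algebra; exists s, a; split => // i /sJ/JK.
Qed.

(** For a fixed box both sides are finite measures in [S], and on boxes over [J] they agree because
    the two lists of coordinates are disjoint. *)
Lemma indep_box Q U J s a : iid_measure Q U -> uniq s -> (forall i, i \in s -> ~ J i) ->
  forall S, <<s genU U J >> S ->
  Q (S `&` box U s a) = ((\prod_(i <- s) clamp (a i))%:E * Q S)%E.
Proof.
move=> iU us sJ.
have mU := iU.2.1.
have mV : measurable (box U s a) by apply: measurable_box => i _; exact: mU.
have p0 : 0 <= \prod_(i <- s) clamp (a i).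
  by apply: prodr_ge0 => i _; have /andP[] := clamp01 (a i).
move=> S mS.
have := @genU_uniq (mrestr Q mV) (mscale (NngNum p0) Q) U J mU _ _ S mS.
apply.
  by rewrite /= /mrestr setTI ltey_eq (iid_measure_fin iU).
move=> _ [t [b [ut tJ ->]]]; rewrite /= /mrestr /mscale /=.
rewrite (iid_measure_clamp iU _ ut).
have -> : box U t b `&` box U s a = box U (t ++ s) (fun i => if i \in s then a i else b i).
  rewrite /box; apply/seteqP; split => w /=.
    move=> [h1 h2] i; rewrite mem_cat; case: ifPn => [is_ _|ns]; first exact: h2.
    by rewrite orbF; apply: h1.
  move=> h; split => i it_; have := h i; rewrite mem_cat it_ ?orbT => /(_ isT) //.
  by case: ifPn => // is_; have := sJ _ is_ (tJ _ it_).
rewrite (iid_measure_clamp iU); last first.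
  rewrite cat_uniq ut us andbT /=; apply/hasPn => i is_; apply/negP => it_.
  exact: (sJ _ is_ (tJ _ it_)).
rewrite big_cat EFinM muleA muleC; congr (_ * _)%E.
  congr EFin; rewrite !big_seq; apply: eq_bigr => i is_; by rewrite is_.
congr (_ * _)%E; congr EFin; rewrite !big_seq; apply: eq_bigr => i is_.
by case: ifPn => // /sJ; have := tJ _ is_.
Qed.

End iid.

(** * The uniform law on the unit interval and independence of one coordinate *)

Section pushm.
Context d1 d2 (T1 : measurableType d1) (T2 : measurableType d2) (R : realType).
Variables (m : {measure set T1 -> \bar R}) (f : T1 -> T2) (mf : measurable_fun setT f).
Definition pushm : {measure set T2 -> \bar R}.
Proof. refine (pushforward m f : {measure set T2 -> \bar R}); exact mf. Defined.
Lemma pushmE A : pushm A = m (f @^-1` A). Proof. by []. Qed.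
End pushm.

Section unif.
Variable R : realType.
Lemma measurable_idR : measurable_fun setT (idfun : measurableTypeR R -> R).
Proof. move=> _ Y mY; rewrite setTI preimage_id. exact: mY. Qed.
(** Pushing along the identity moves the uniform probability to the measurable structure that [R]
    carries in the rest of the development. *)
Definition unif01 : set R -> \bar R := pushm (uniform_prob (@ltr01 R)) measurable_idR.
HB.instance Definition _ := Measure.on unif01.
Let lamT : unif01 setT = 1%E.
Proof. exact: probability_setT. Qed.
HB.instance Definition _ := Measure_isProbability.Build _ _ _ unif01 lamT.

Lemma unif01_le (b : R) : unif01 [set x | x <= b] = (clamp b)%:E.
Proof.
transitivity (\int[lebesgue_measure]_(x in [set x : R | (x <= b)%R]) (uniform_pdf 0 1 x)%:E)%E.
  by [].
rewrite integral_uniform_pdf.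
rewrite (eq_integral (fun=> 1%:E)); last first.
  by move=> x; rewrite inE/= in_itv/= /uniform_pdf => -[_ ->]; rewrite subr0 invr1.
have E : [set x | x <= b] `&` `[0, 1]%classic = `[0, Num.min b 1]%classic.
  apply/seteqP; split => x /=; rewrite !in_itv /= le_min.
    by move=> [-> /andP[-> ->]].
  by move=> /andP[-> /andP[-> ->]].
rewrite E integral_cst//= mul1e lebesgue_measure_itv/= lte_fin /clamp.
by case: ltP => // h; rewrite -EFinB subr0.
Qed.

End unif.
Arguments unif01 R : clear implicits.

Section meas_uniq_R.
Variable R : realType.

Lemma finite_measure_unique_R (m1 m2 : {measure set R -> \bar R}) :
  m1 setT \is a fin_num -> m1 setT = m2 setT ->
  (forall b, m1 [set x | x <= b] = m2 [set x | x <= b]) ->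
  forall B, measurable B -> m1 B = m2 B.
Proof.
move=> f1 e h B mB.
have ms b : measurable [set x : R | x <= b] by exact: measurable_le_cst.
have gE b : `]b, +oo[%classic = setT `\` [set x : R | x <= b].
  by apply/seteqP; split => x /=; rewrite in_itv/= andbT ltNge;
    [move=> /negP|move=> [_ /negP]].
have f2 : m2 setT \is a fin_num by rewrite -e.
have fl (m : {measure set R -> \bar R}) S : m setT \is a fin_num -> measurable S -> (m S < +oo)%E.
  move=> fm mS; apply: (@le_lt_trans _ _ (m setT)); first by apply: le_measure; rewrite ?inE.
  by rewrite ltey_eq fm.
pose g (n : nat) : set R := `](- n%:R), +oo[%classic.
have key : forall k : nat, (m1 (g k) < +oo)%E by move=> k; apply: fl => //; exact: measurable_itv.
apply: (@measure_unique _ R R (@RGenOInfty.G R) g _ _ _ _ m1 m2 _ key B mB) => //.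
- exact: RGenOInfty.measurableE.
- move=> _ _ [a ->] [b ->]; exists (Num.max a b).
  by apply/seteqP; split => x /=; rewrite !in_itv/= !andbT gt_max;
    [move=> [-> ->]|move=> /andP[]].
- by move=> i; exists (- i%:R).
- apply/seteqP; split => // x _; exists (Num.truncn `|x|).+1 => //=.
  rewrite /g /= in_itv/= andbT ltrNl; apply: le_lt_trans (truncnS_gt _).
  by rewrite -normrN ler_norm.
- move=> _ [b ->]; rewrite gE measureD//; [|exact: fl]; rewrite measureD//; [|exact: fl].
  rewrite setTI. congr (_ - _)%E; [exact: e|exact: h].
Qed.

End meas_uniq_R.


Section indep.
Variables (R : realType) (dO : measure_display) (O : measurableType dO) (I : eqType).
Variables (Q : {measure set O -> \bar R}) (U : I -> O -> R) (J : I -> Prop).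
Hypothesis iU : iid_measure Q U.
Let mU : forall i, measurable_fun setT (U i) := iU.2.1.

Lemma indep_law i S (B : set R) : ~ J i -> <<s genU U J >> S -> measurable B ->
  Q (S `&` (U i @^-1` B)) = (Q S * unif01 R B)%E.
Proof.
move=> nJ sS mB.
have mS : measurable S by exact: (sigma_sub mU sS).
have finS : Q S \is a fin_num by exact: iid_measure_fin iU _.
have QS0 : 0 <= fine (Q S) by rewrite fine_ge0.
have h := @finite_measure_unique_R R (pushm (mrestr Q mS) (mU i)) (mscale (NngNum QS0) (unif01 R)).
have -> : (Q S * unif01 R B)%E = mscale (NngNum QS0) (unif01 R) B by rewrite /mscale/= fineK.
have -> : Q (S `&` U i @^-1` B) = pushm (mrestr Q mS) (mU i) B.
  by rewrite pushmE /= /mrestr setIC.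
apply: h => //.
- by rewrite pushmE /= /mrestr preimage_setT setTI.
- have e1 : unif01 R setT = 1%E by exact: probability_setT.
  by rewrite pushmE /= /mrestr/mscale preimage_setT setTI/= e1 fineK// mule1.
- move=> b; rewrite pushmE /= /mrestr/mscale /= unif01_le fineK//.
  have := @indep_box R dO O I Q U J [:: i] (fun=> b) iU isT _ S sS.
  rewrite box_cons box_nil setIT big_seq1 => hh.
  have nJ' : forall j, j \in [:: i] -> ~ J j by move=> j; rewrite inE => /eqP ->.
  rewrite setIC muleC; exact: (hh nJ').
Qed.

Let mto : measurable_fun setT (idfun : O -> subsigma U J) := measurable_toOJ mU.
Definition nuJ : set (subsigma U J) -> \bar R := pushm Q mto.
HB.instance Definition _ := Measure.on nuJ.
Lemma nuJ_fin : fin_num_fun nuJ.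
Proof. by move=> S mS; apply: (iid_measure_fin iU); exact: (sigma_sub mU mS). Qed.
HB.instance Definition _ := Measure_isFinite.Build _ _ _ nuJ nuJ_fin.

Lemma integral_nuJ (f : subsigma U J -> \bar R) : measurable_fun setT f -> (forall x, 0 <= f x)%E ->
  (\int[Q]_x f x = \int[nuJ]_x f x)%E.
Proof.
by move=> mf f0; rewrite /nuJ (ge0_integral_pushforward (phi := idfun : O -> subsigma U J)).
Qed.

(** The joint law of the coordinates in [J] and of [U i] is the product of [nuJ] and the uniform
    law, by uniqueness on rectangles; Tonelli then integrates [U i] out with the others frozen. *)
Lemma indep_fubini i (f : subsigma U J * R -> \bar R) : ~ J i ->
  measurable_fun setT f -> (forall x, 0 <= f x)%E ->
  (\int[Q]_w f (w, U i w) = \int[Q]_w \int[unif01 R]_u f (w, u))%E.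
Proof.
move=> nJ mf f0.
have mp : measurable_fun setT (fun w : O => (w : subsigma U J, U i w)).
  by apply: measurable_fun_pair => //; exact: mto.
transitivity (\int[pushm Q mp]_z f z)%E.
  transitivity (\int[Q]_w (f \o (fun w : O => (w : subsigma U J, U i w))) w)%E => //.
  exact: (esym (ge0_integral_pushforward mp Q measurableT mf (fun y _ => f0 y))).
rewrite (eq_measure_integral (nuJ \x unif01 R)%E); last first.
  move=> X mX _; apply/esym/product_measure_unique => // A B mA mB.
  by rewrite pushmE -(indep_law nJ mA mB).
rewrite fubini_tonelli1// integral_nuJ//.
  exact: (@measurable_fun_fubini_tonelli_F _ _ _ _ _ (unif01 R) f mf f0).
by move=> x; apply: integral_ge0.
Qed.

End indep.

Section helpers.
Variable R : realType.

Lemma measurable_nR d (T : measurableType d) (b : T -> bool) :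
  measurable_fun setT b -> measurable_fun setT (fun w => (b w)%:R : R).
Proof.
move=> mb; rewrite (_ : (fun w => _) = (fun w => if b w then 1 else 0)).
  by apply: measurable_fun_if => //; exact: measurable_cst.
by apply/funext => w; case: (b w).
Qed.

Lemma measurable_all d (T : measurableType d) (I : eqType) (P : I -> T -> bool) (s : seq I) :
  (forall i, i \in s -> measurable_fun setT (P i)) ->
  measurable_fun setT (fun w => all (fun i => P i w) s).
Proof.
elim: s => [|i s IH] h /=; first exact: measurable_cst.
apply: measurable_and; first by apply: h; rewrite mem_head.
by apply: IH => j js; apply: h; rewrite in_cons js orbT.
Qed.

Lemma unif01_lt (b : R) : unif01 R [set x | x < b] = (clamp b)%:E.
Proof.
have e0 : unif01 R [set b] = 0%E.
  transitivity (\int[lebesgue_measure]_(x in [set b]) (uniform_pdf 0 1 x)%:E)%E => //.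
  by rewrite integral_set1.
rewrite -unif01_le.
have -> : [set x | x <= b] = [set x | x < b] `|` [set b].
  apply/seteqP; split => x /=; rewrite le_eqVlt.
    by move=> /orP[/eqP->|->]; [right|left].
  by move=> [->|->]; rewrite ?orbT ?eqxx.
rewrite measureU0//.
rewrite (_ : [set x | x < b] = `]-oo, b[%classic).
  exact: measurable_itv.
by apply/seteqP; split => x; rewrite /= in_itv.
Qed.

Lemma unif01_ge (b : R) : unif01 R [set x | b <= x] = (1 - clamp b)%:E.
Proof.
have -> : [set x | b <= x] = setT `\` [set x | x < b].
  by apply/seteqP; split => x /=; rewrite ltNge; [move=> h; split => //; apply/negP; rewrite negbK|
    move=> [_ /negP]; rewrite negbK].
have mb : measurable [set x : R | x < b].
  rewrite (_ : [set x | x < b] = `]-oo, b[%classic); first exact: measurable_itv.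
  by apply/seteqP; split => x; rewrite /= in_itv.
have e1 : unif01 R setT = 1%E by exact: probability_setT.
rewrite measureD//; last by rewrite [X in (X < _)%E]e1 ltry.
rewrite setTI EFinB; congr (_ - _)%E => //; exact: unif01_lt.
Qed.

End helpers.

(** * Expectations in which one coordinate is integrated out *)

Section integrals.
Variables (R : realType) (dO : measure_display) (O : measurableType dO) (I : eqType).
Variables (Q : {measure set O -> \bar R}) (U : I -> O -> R).
Hypothesis iU : iid_measure Q U.
Let mU : forall i, measurable_fun setT (U i) := iU.2.1.

Definition expect (f : O -> R) : \bar R := (\int[Q]_w (f w)%:E)%E.

Implicit Types (f g : O -> R) (c : R).

Lemma eq_expect f g : f =1 g -> expect f = expect g.
Proof. by move=> /funext ->. Qed.

Lemma expect_ge0 f : (forall w, 0 <= f w) -> (0 <= expect f)%E.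
Proof. by move=> f0; apply: integral_ge0 => w _; rewrite lee_fin. Qed.

Lemma expectZ f c : 0 <= c -> measurable_fun setT f -> (forall w, 0 <= f w) ->
  expect (fun w => c * f w) = (c%:E * expect f)%E.
Proof.
move=> c0 mf f0; rewrite /expect -ge0_integralZl_EFin//.
- by move=> w _; rewrite lee_fin.
- exact/measurable_EFinP.
Qed.

Lemma expectD f g : measurable_fun setT f -> (forall w, 0 <= f w) ->
  measurable_fun setT g -> (forall w, 0 <= g w) ->
  expect (fun w => f w + g w) = (expect f + expect g)%E.
Proof.
move=> mf f0 mg g0; rewrite /expect -ge0_integralD//.
- by move=> w _; rewrite lee_fin.
- exact/measurable_EFinP.
- by move=> w _; rewrite lee_fin.
- exact/measurable_EFinP.
Qed.

Lemma expect_fubini J i (f : O -> R -> R) : ~ J i ->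
  measurable_fun (setT : set (subsigma U J * R)) (fun z => f z.1 z.2) ->
  (forall w u, 0 <= f w u) -> 
  forall g : O -> R, (forall w, (\int[unif01 R]_u (f w u)%:E)%E = (g w)%:E) ->
  expect (fun w => f w (U i w)) = expect g.
Proof.
move=> nJ mf f0 g gE.
have := @indep_fubini R dO O I Q U J iU i (fun z => (f z.1 z.2)%:E) nJ _ _.
rewrite /expect /= => ->.
- by apply: eq_integral => w _.
- exact/measurable_EFinP.
- by move=> z; rewrite lee_fin.
Qed.

Lemma unif01_int_ind (B : set R) (c : R) : measurable B ->
  (\int[unif01 R]_u (c * \1_B u)%:E)%E = (c%:E * unif01 R B)%E.
Proof.
move=> mB; under eq_integral do rewrite EFinM.
rewrite integralZl//.
  by rewrite integral_indic// setIT.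
exact: integrable_indic.
Qed.

Lemma expect_set J i (B : set R) (c : R) (Z : O -> R) : ~ J i -> measurable B ->
  unif01 R B = c%:E ->
  measurable_fun (setT : set (subsigma U J)) Z -> (forall w, 0 <= Z w) ->
  expect (fun w => Z w * \1_B (U i w)) = expect (fun w => Z w * c).
Proof.
move=> nJ mB lB mZ Z0.
apply: (@expect_fubini J i (fun w u => Z w * \1_B u)) => //.
- apply: measurable_funM; first by apply: measurableT_comp => //; exact: measurable_fst.
  by apply: (@measurableT_comp _ _ _ _ _ _ (\1_B : R -> R)) => //; exact: measurable_snd.
- by move=> w u; rewrite mulr_ge0.
- by move=> w; rewrite unif01_int_ind// lB.
Qed.

(* [P] may differ from the half-line test [u < y w] at the end point, which has measure 0. *)
Lemma expect_cut J i (Z y : O -> R) (P : O -> R -> bool) : ~ J i ->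
  measurable_fun (setT : set (subsigma U J)) Z -> (forall w, 0 <= Z w) ->
  (forall w, 0 <= y w <= 1) ->
  measurable_fun (setT : set (subsigma U J * R)) (fun z => P z.1 z.2) ->
  (forall w u, u < y w -> P w u) -> (forall w u, P w u -> u <= y w) ->
  expect (fun w => Z w * (P w (U i w))%:R) = expect (fun w => Z w * y w).
Proof.
move=> nJ mZ Z0 y01 mP h1 h2.
apply: (@expect_fubini J i (fun w u => Z w * (P w u)%:R)) => //.
- apply: measurable_funM; first by apply: measurableT_comp => //; exact: measurable_fst.
  exact: measurable_nR.
- by move=> w u; rewrite mulr_ge0.
move=> w.
have mPw : measurable [set u | P w u].
  have mw : measurable_fun setT (fun u : R => (w : subsigma U J, u)).
    by apply: measurable_fun_pair => //; exact: measurable_cst.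
  have := measurableT_comp mP mw measurableT (Y := [set true]).
  rewrite setTI (_ : _ @^-1` _ = [set u | P w u]); first by apply.
  by apply/seteqP; split => u.
have -> : (fun u => (Z w * (P w u)%:R)%:E) = (fun u => (Z w * \1_[set u | P w u] u)%:E).
  by apply/funext => u; rewrite indicE; congr (_ * _%:R)%:E; case: (boolP (P w u)) => h;
   [rewrite mem_set|rewrite memNset//=; exact/negP].
rewrite unif01_int_ind// EFinM; congr (_ * _)%E.
have c1 : clamp (y w) = y w by rewrite clamp_id.
apply/eqP; rewrite eq_le; apply/andP; split.
  rewrite -[X in (_ <= X%:E)%E]c1 -unif01_le; apply: le_measure; rewrite ?inE//.
    exact: measurable_le_cst.
  by move=> u; exact: h2.
rewrite -[X in (X%:E <= _)%E]c1 -unif01_lt; apply: le_measure; rewrite ?inE//.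
  rewrite (_ : [set x | x < y w] = `]-oo, y w[%classic); first exact: measurable_itv.
  by apply/seteqP; split => x; rewrite /= in_itv.
by move=> u; exact: h1.
Qed.

(** Coordinates are removed one at a time, [J] being enlarged by those still present. The map [sh]
    is there because the conditions come from a re-indexed family. *)
Lemma expect_list (J : I -> Prop) (K : eqType) (sh : K -> I) (s : seq K) (a : K -> R) (Z : O -> R) :
  uniq (map sh s) -> (forall k, k \in s -> ~ J (sh k)) -> (forall k, 0 <= a k <= 1) ->
  measurable_fun (setT : set (subsigma U J)) Z -> (forall w, 0 <= Z w) ->
  expect (fun w => Z w * (all (fun k => U (sh k) w <= a k) s)%:R) =
  ((\prod_(k <- s) a k)%:E * expect Z)%E.
Proof.
move=> us nJ a01 mZ Z0.
have mZO : measurable_fun setT Z by exact: measurable_from_subsigma mZ.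
elim: s us nJ => [|k s IH].
  by rewrite big_nil mul1e => _ _; apply: eq_expect => w /=; rewrite mulr1.
rewrite map_cons cons_uniq => /andP[nk us] nJ.
have mall : measurable_fun setT (fun w : O => all (fun k0 : K => U (sh k0) w <= a k0) s).
  by apply: measurable_all => i _; apply: measurable_fun_ler => //; exact: mU.
transitivity (expect (fun w => Z w * (all (fun k0 : K => U (sh k0) w <= a k0) s)%:R * (U (sh k) w <= a k)%R%:R)).
  by apply: eq_expect => w /=; rewrite -mulrA -natrM mulnb andbC.
pose J' i := J i \/ exists2 k', k' \in s & i = sh k'.
rewrite (@expect_cut J' (sh k) _ (fun=> a k) (fun _ u => u <= a k)) => //.
- rewrite (@eq_expect _ (fun w => a k * (Z w * (all (fun k0 : K => U (sh k0) w <= a k0) s)%:R))); last by move=> w; rewrite mulrC.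
  rewrite expectZ.
  + rewrite IH// ?big_cons ?EFinM ?muleA// => k' k's; apply: nJ; by rewrite in_cons k's orbT.
  + by have /andP[] := a01 k.
  + by apply: measurable_funM => //; exact: measurable_nR.
  + by move=> w; rewrite mulr_ge0.
- move=> [|[k' k's e]]; first by apply: nJ; rewrite mem_head.
  by move/negP: nk; apply; rewrite e; apply: map_f.
- apply: measurable_funM.
    by move=> mT Y mY; apply: (@sigma_mono _ _ _ _ U J J'); [left|exact: mZ].
  apply: measurable_nR; apply: measurable_all => k' k's; apply: measurable_fun_ler => //.
  by apply: measurable_coord; right; exists k'.
- by move=> w; rewrite mulr_ge0.
- by apply: measurable_fun_ler => //; exact: measurable_snd.
- by move=> _ u; exact: ltW.
Qed.

End integrals.

(** * Resampling a configuration *)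

Section resample.
Variables (R : realFieldType) (E : eqType) (p : R).
Hypothesis p01 : 0 <= p <= 1.
Notation config := (E -> bool).
Implicit Types (f g : config -> R) (eta : config) (rho : E -> R) (S T : seq E) (D : pred E).

Definition upd eta e b : config := fun e' => if e' == e then b else eta e'.

Lemma updC eta e e' b b' : e != e' -> upd (upd eta e b) e' b' = upd (upd eta e' b') e b.
Proof.
by move=> ne; apply/funext => x; rewrite /upd; case: eqP => // ->; rewrite eq_sym (negbTE ne).
Qed.

Lemma upd2 eta e b b' : upd (upd eta e b) e b' = upd eta e b'.
Proof. by apply/funext => x; rewrite /upd; case: eqP. Qed.

Lemma upd_id eta e : upd eta e (eta e) = eta.
Proof. by apply/funext => x; rewrite /upd; case: eqP => // ->. Qed.

Definition resample1 (r : R) e f eta : R :=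
  r * f eta + (1 - r) * (p * f (upd eta e true) + (1 - p) * f (upd eta e false)).

(** Edges outside [S] are frozen. The keep probability may vary with the edge because the ergodic
    estimate compares different families. With [rho] equal to 0 on [S] this is the expectation over
    Bernoulli percolation on [S]. *)
Fixpoint resample rho S f : config -> R :=
  if S is e :: S' then resample1 (rho e) e (resample rho S' f) else f.

(** Transition probability of one edge from state [b0] to state [b]. *)
Definition qb (r : R) (b0 b : bool) : R :=
  r * (b == b0)%:R + (1 - r) * (if b then p else 1 - p).

Lemma resample1_qb r e f eta : resample1 r e f eta =
  qb r (eta e) true * f (upd eta e true) + qb r (eta e) false * f (upd eta e false).
Proof.
rewrite /resample1 /qb; rewrite -{1}(upd_id eta e).
by case: (eta e); rewrite /= ?eqxx /=; ring.
Qed.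

Definition supp D f := forall eta eta', (forall e, D e -> eta e = eta' e) -> f eta = f eta'.

Lemma supp_upd D f eta e b : supp D f -> ~~ D e -> f (upd eta e b) = f eta.
Proof.
by move=> sf nD; apply: sf => x Dx; rewrite /upd; case: eqP => // xe; rewrite -xe Dx in nD.
Qed.

Lemma resample1_comm r r' e e' f : e != e' -> resample1 r e (resample1 r' e' f) = resample1 r' e' (resample1 r e f).
Proof. by move=> ne; apply/funext => eta; rewrite /resample1 !(updC _ _ _ ne); ring. Qed.

Lemma resample_cat rho S T f : resample rho (S ++ T) f = resample rho S (resample rho T f).
Proof. by elim: S => //= e S ->. Qed.

Lemma resample_resample1 rho r e S f : e \notin S -> resample rho S (resample1 r e f) = resample1 r e (resample rho S f).
Proof.
elim: S => //= e' S IH; rewrite in_cons negb_or => /andP[ne nS].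
by rewrite IH// resample1_comm// eq_sym.
Qed.

Lemma resample_updl rho S f eta e b : e \notin S ->
  resample rho S f (upd eta e b) = resample rho S (fun z => f (upd z e b)) eta.
Proof.
elim: S eta => //= e' S IH eta; rewrite in_cons negb_or => /andP[ne nS].
by rewrite /resample1 !(updC _ _ _ ne) !IH.
Qed.

Lemma resample_rem rho S f e : uniq S -> e \in S -> resample rho S f = resample rho (e :: rem e S) f.
Proof.
elim: S => //= e' S IH /andP[nS uS]; rewrite in_cons eq_sym; case: eqP => [->//|/eqP ne eS].
by rewrite IH//= resample1_comm.
Qed.

Lemma resample_perm rho S T f : uniq S -> perm_eq S T -> resample rho S f = resample rho T f.
Proof.
elim: S T => [|e S IH] T.
  by move=> _; rewrite perm_sym => /perm_nilP ->.
move=> /andP[nS uS] pe.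
have eT : e \in T by rewrite -(perm_mem pe) mem_head.
have uT : uniq T by rewrite -(perm_uniq pe) /= nS.
rewrite (resample_rem _ _ uT eT) /= (IH (rem e T))//.
by rewrite -(perm_cons e) (perm_trans pe)// perm_to_rem.
Qed.

Lemma resample_rho rho rho' S f : (forall e, e \in S -> rho e = rho' e) -> resample rho S f = resample rho' S f.
Proof.
elim: S => //= e S IH h; rewrite IH ?h ?mem_head// => x xS.
by apply: h; rewrite in_cons xS orbT.
Qed.

Lemma resample_one rho S f : (forall e, e \in S -> rho e = 1) -> resample rho S f = f.
Proof.
move=> h; rewrite (@resample_rho rho (fun=> 1))//.
by elim: S {h} => //= e S ->; apply/funext => eta; rewrite /resample1; ring.
Qed.

Lemma supp_resample1 D r e f : supp D f -> supp D (resample1 r e f).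
Proof.
move=> sf eta eta' h; rewrite /resample1 (sf _ _ h) (sf (upd eta e true) (upd eta' e true)).
  rewrite (sf (upd eta e false) (upd eta' e false))// => x Dx.
  by rewrite /upd; case: eqP => // _; exact: h.
by move=> x Dx; rewrite /upd; case: eqP => // _; exact: h.
Qed.

Lemma supp_resample D rho S f : supp D f -> supp D (resample rho S f).
Proof. by elim: S => //= e S IH /IH; exact: supp_resample1. Qed.

Lemma resample1_drop D r e f : supp D f -> ~~ D e -> resample1 r e f = f.
Proof.
move=> sf nD; apply/funext => eta; rewrite /resample1 !(supp_upd _ _ sf nD); ring.
Qed.

Lemma resample_drop D rho S f : supp D f -> (forall e, e \in S -> ~~ D e) -> resample rho S f = f.
Proof.
move=> sf; elim: S => //= e S IH h; rewrite (IH _); last first.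
  by move=> x xS; apply: h; rewrite in_cons xS orbT.
by apply: (resample1_drop _ sf); apply: h; rewrite mem_head.
Qed.

Lemma resample_sub rho S T f : uniq S -> uniq T -> supp (mem T) f -> {subset T <= S} ->
  resample rho S f = resample rho T f.
Proof.
move=> uS uT sf TS.
have pe : perm_eq S (T ++ [seq x <- S | x \notin T]).
  apply: uniq_perm => //.
    rewrite cat_uniq uT filter_uniq// andbT /=; apply/hasPn => x.
    by rewrite mem_filter => /andP[].
  move=> x; rewrite mem_cat mem_filter; have [/TS->//|] := boolP (x \in T).
  by rewrite /=.
rewrite (resample_perm _ _ uS pe) resample_cat (resample_drop _ sf)// => x.
by rewrite mem_filter => /andP[].
Qed.

(** An edge is kept through both rounds with the product probability and is otherwise a fresh
    Bernoulli state. *)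
Lemma resample_comp rho rho' S f : uniq S ->
  resample rho S (resample rho' S f) = resample (fun e => rho e * rho' e) S f.
Proof.
elim: S f => //= e S IH f /andP[nS uS].
rewrite resample_resample1// IH//; apply/funext => eta; rewrite /resample1 !upd2; ring.
Qed.

Lemma resample_lin rho S f g (a b : R) eta :
  resample rho S (fun z => a * f z + b * g z) eta = a * resample rho S f eta + b * resample rho S g eta.
Proof.
elim: S eta => //= e S IH eta.
rewrite (_ : resample rho S _ = (fun z => a * resample rho S f z + b * resample rho S g z)); last exact/funext.
by rewrite /resample1; ring.
Qed.

Lemma resample_cst rho S (c : R) : resample rho S (fun=> c) = (fun=> c).
Proof. by elim: S => //= e S ->; apply/funext => eta; rewrite /resample1; ring. Qed.

Lemma resampleZ rho S f (a : R) eta : resample rho S (fun z => a * f z) eta = a * resample rho S f eta.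
Proof.
have := resample_lin rho S f f a 0 eta.
rewrite mul0r addr0 => <-; congr (resample _ _ _ _).
by apply/funext => z; rewrite mul0r addr0.
Qed.

Lemma resampleD rho S f g eta : resample rho S (fun z => f z + g z) eta = resample rho S f eta + resample rho S g eta.
Proof.
have := resample_lin rho S f g 1 1 eta; rewrite !mul1r => <-; congr (resample _ _ _ _).
by apply/funext => z; rewrite !mul1r.
Qed.

Lemma resampleB rho S f g eta : resample rho S (fun z => f z - g z) eta = resample rho S f eta - resample rho S g eta.
Proof.
have := resample_lin rho S f g 1 (-1) eta; rewrite mul1r mulN1r => <-; congr (resample _ _ _ _).
by apply/funext => z; rewrite mul1r mulN1r.
Qed.

Lemma resample_sum rho S (I : Type) (s : seq I) (F : I -> config -> R) eta :
  resample rho S (fun z => \sum_(i <- s) F i z) eta = \sum_(i <- s) resample rho S (F i) eta.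
Proof.
elim: s => [|i s IH].
  rewrite big_nil (_ : (fun z => _) = fun=> 0) ?resample_cst//.
  by apply/funext => z; rewrite big_nil.
rewrite big_cons -IH -resampleD; congr (resample _ _ _ _).
by apply/funext => z; rewrite big_cons.
Qed.

Definition rho_ok rho S := forall e, e \in S -> 0 <= rho e <= 1.

Lemma rho_ok_cons rho e S : rho_ok rho (e :: S) -> 0 <= rho e <= 1 /\ rho_ok rho S.
Proof.
move=> h; split; first by apply: h; rewrite mem_head.
by move=> x xS; apply: h; rewrite in_cons xS orbT.
Qed.

Lemma resample_le rho S f g : rho_ok rho S -> (forall z, f z <= g z) ->
  forall eta, resample rho S f eta <= resample rho S g eta.
Proof.
move: p01 => /andP[p0 p1].
elim: S => //= e S IH /rho_ok_cons[/andP[r0 r1] ok] fg eta; rewrite /resample1.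
have h := IH ok fg; have q0 : 0 <= 1 - p by lra. have s0 : 0 <= 1 - rho e by lra.
apply: lerD; apply: ler_wpM2l => //; apply: lerD; exact: ler_wpM2l.
Qed.

Lemma resample_ge_cst rho S f c : rho_ok rho S -> (forall z, c <= f z) ->
  forall eta, c <= resample rho S f eta.
Proof. by move=> ok h eta; rewrite -[leLHS](congr1 (fun g => g eta) (resample_cst rho S c)); apply: resample_le. Qed.

Lemma resample_le_cst rho S f c : rho_ok rho S -> (forall z, f z <= c) ->
  forall eta, resample rho S f eta <= c.
Proof. by move=> ok h eta; rewrite -[leRHS](congr1 (fun g => g eta) (resample_cst rho S c)); apply: resample_le. Qed.

Lemma resample_norm_le rho S f c : rho_ok rho S -> (forall z, `|f z| <= c) ->
  forall eta, `|resample rho S f eta| <= c.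
Proof.
move=> ok h eta; rewrite ler_norml; apply/andP; split.
  by apply: resample_ge_cst => // z; have := h z; rewrite ler_norml => /andP[].
by apply: resample_le_cst => // z; have := h z; rewrite ler_norml => /andP[].
Qed.

Lemma resample_jensen rho S f eta : rho_ok rho S ->
  (resample rho S f eta) ^+ 2 <= resample rho S (fun z => f z ^+ 2) eta.
Proof.
move=> ok; set c := resample rho S f eta.
have : 0 <= resample rho S (fun z => (f z - c) ^+ 2) eta.
  by apply: resample_ge_cst => // z; exact: sqr_ge0.
rewrite (_ : (fun z => (f z - c) ^+ 2) =
    (fun z => 1 * (f z ^+ 2) + 1 * ((- (2 * c)) * f z + c ^+ 2 * 1))); last first.
  by apply/funext => z; ring.
rewrite resample_lin (resample_lin rho S f (fun=> 1)) resample_cst -/c; lra.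
Qed.

(** Resampling an edge with keep probability 0 removes it from the support, so nothing is read any
    more once all of [S] has been treated. *)
Lemma resample_suppC D rho S f eta eta' : supp D f -> (forall e, D e -> e \in S) ->
  (forall e, e \in S -> rho e = 0) -> resample rho S f eta = resample rho S f eta'.
Proof.
move=> sf DS h; rewrite (@resample_rho rho (fun=> 0))//.
suff H : forall D' , (forall e, D' e -> e \in S) -> supp D' f -> forall z z', resample (fun=> 0) S f z = resample (fun=> 0) S f z'.
  exact: (H D).
move=> D' D'S sf'.
have : supp (fun e => D' e && (e \notin S)) (resample (fun=> 0) S f).
  elim: S {h DS D'S} => [|e S IH] /=.
    by move=> z z' hz; apply: sf' => e De; apply: hz; rewrite De.
  move=> z z' hz; rewrite /resample1 !mul0r !add0r subr0 !mul1r.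
  have hb b : resample (fun=> 0) S f (upd z e b) = resample (fun=> 0) S f (upd z' e b).
    apply: IH => x /andP[Dx nx]; rewrite /upd; case: eqP => // /eqP xe.
    by apply: hz; rewrite Dx in_cons negb_or xe.
  by rewrite !hb.
by move=> H z z'; apply: H => e /andP[/D'S ->].
Qed.

(** Edges are resampled independently given the initial configuration, so functions of disjoint sets
    of edges stay independent for every [rho] and [eta]. *)
Lemma resample_prod D rho S f g eta : supp D f -> supp (predC D) g ->
  resample rho S (fun z => f z * g z) eta = resample rho S f eta * resample rho S g eta.
Proof.
elim: S eta => //= e S IH eta sf sg.
rewrite (_ : resample rho S (fun z => f z * g z) = (fun z => resample rho S f z * resample rho S g z)); last first.
  by apply/funext => z; exact: IH.
have sf' := supp_resample rho S sf; have sg' := supp_resample rho S sg.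
have [De|nDe] := boolP (D e).
  rewrite [in RHS](resample1_drop _ sg') /=; last by rewrite De.
  rewrite /resample1 !(supp_upd _ _ sg') /= ?De//; ring.
rewrite [in RHS](resample1_drop _ sf')// /resample1 !(supp_upd _ _ sf')//; ring.
Qed.

End resample.

Section relabel.
Variables (R : realFieldType) (E E' : eqType) (p : R) (k : E' -> E).

(** Passes between absolute edges and edges labelled from the walker. Injectivity of [k] is asked
    only between resampled labels and labels that [f] reads. *)
Lemma resample_relabel (D : pred E') rho S (f : (E' -> bool) -> R) (eta : E -> bool) : supp D f ->
  (forall e e', e \in S -> D e' -> k e' = k e -> e' = e) ->
  resample p rho (map k S) (fun z => f (fun x => z (k x))) eta =
  resample p (fun x => rho (k x)) S f (fun x => eta (k x)).
Proof.
move=> sf; elim: S eta => //= e S IH eta inj.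
have inj' e1 e' : e1 \in S -> D e' -> k e' = k e1 -> e' = e1.
  by move=> eS; apply: inj; rewrite in_cons eS orbT.
rewrite /resample1 !IH//; congr (_ + _ * (_ * _ + _ * _));
  apply: (@supp_resample _ _ p D) => // x Dx; rewrite /upd;
  by (case: eqP => [h|h]; [rewrite (inj e x (mem_head _ _) Dx h) eqxx |
    case: eqP => // xe; case: h; rewrite xe]).
Qed.

End relabel.

(** * The environment at the first attempt *)

Lemma ln_lt_expR (R : realType) (u x : R) : 0 < u -> (ln u < x) = (u < expR x).
Proof. by move=> u0; rewrite -{2}(lnK u0) ltr_expR. Qed.

Section edge.
Variables (R : realType) (dO : measure_display) (O : measurableType dO).
Variables (p mu : R).
Hypothesis p01 : 0 <= p <= 1.
Hypothesis mu0 : 0 < mu.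
Variables (Q : {measure set O -> \bar R}) (U : dyn_index -> O -> R).
Hypothesis iU : iid_measure Q U.
Hypothesis U01 : forall i w, 0 < U i w <= 1.
Let mU : forall i, measurable_fun setT (U i) := iU.2.1.
Notation EQ := (expect Q).

Definition tau w := walk_time U 0 w.
Lemma tauE w : tau w = - ln (U (inr (0%N, false)) w).
Proof. by rewrite /tau /walk_time big_ord_recl big_ord0 addr0. Qed.

Definition gapf e k w := - ln (U (inl (e, k, false)) w) / mu.
Definition refresh_sum e m w := \sum_(k < m) gapf e k w.
Lemma refreshE e n w : refresh_time mu U e n w = refresh_sum e n.+1 w.
Proof. by []. Qed.
Lemma refresh_sum0 e w : refresh_sum e 0 w = 0. Proof. by rewrite /refresh_sum big_ord0. Qed.
Lemma refresh_sumS e m w : refresh_sum e m.+1 w = refresh_sum e m w + gapf e m w.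
Proof. by rewrite /refresh_sum big_ord_recr. Qed.
Lemma gapf_ge0 e k w : 0 <= gapf e k w.
Proof.
apply: divr_ge0; last exact: ltW.
rewrite oppr_ge0; apply: ln_le0.
by have /andP[_] := U01 (inl (e, k, false)) w.
Qed.
Lemma tau_ge0 w : 0 <= tau w.
Proof. by rewrite tauE oppr_ge0; apply: ln_le0; have /andP[_] := U01 (inr (0%N, false)) w. Qed.
Lemma refresh_sum_le e m n w : (m <= n)%N -> refresh_sum e m w <= refresh_sum e n w.
Proof.
move=> /subnK<-; elim: (n - m)%N => // k IH.
by rewrite addSn refresh_sumS; apply: le_trans IH _; rewrite lerDl gapf_ge0.
Qed.

(** Gap number [m] of [e] overshoots the time left until the attempt exactly when its uniform
    variable is below this threshold. *)
Definition Yv e m w := expR (- mu * (tau w - refresh_sum e m w)).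
Definition Ev e m w := (refresh_sum e m w <= tau w) && (tau w < refresh_sum e m.+1 w).
Definition keep_prob w := expR (- mu * tau w).

Lemma rr01 w : 0 <= keep_prob w <= 1.
Proof.
rewrite expR_ge0 /=; rewrite -(expR0 R) ler_expR mulNr oppr_le0 mulr_ge0// ?tau_ge0//.
exact: ltW.
Qed.

Lemma Ev_cross e m w : Ev e m w = (refresh_sum e m w <= tau w) && (U (inl (e, m, false)) w < Yv e m w).
Proof.
rewrite /Ev; congr (_ && _); rewrite /Yv -ln_lt_expR; last by have /andP[] := U01 (inl (e, m, false)) w.
have -> : (tau w < refresh_sum e m.+1 w) = (tau w - refresh_sum e m w < - ln (U (inl (e, m, false)) w) / mu).
  by rewrite refresh_sumS ltrBlDl.
by rewrite ltr_pdivlMr// mulNr ltrNr mulrC.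
Qed.

Lemma Ev_uniq e m n w : Ev e m w -> Ev e n w -> m = n.
Proof.
move=> /andP[a1 a2] /andP[b1 b2].
have [h|h|//] := ltngtP m n.
  by exfalso; move: (refresh_sum_le e w h) => {h} h; lra.
by exfalso; move: (refresh_sum_le e w h) => {h} h; lra.
Qed.

Definition hasN e w := exists n, tau w < refresh_time mu U e n w.

Lemma Ev_ex e w : hasN e w -> exists m, Ev e m w.
Proof.
move=> ex; exists (ex_minn ex); case: ex_minnP => m; rewrite /Ev refreshE => -> h; rewrite andbT.
case: m h => [|m] h; first by rewrite refresh_sum0 tau_ge0.
by rewrite leNgt; apply/negP => hh; have := h m hh; rewrite ltnn.
Qed.

Lemma Ev_min e m w (h : exists n, tau w < refresh_time mu U e n w) : Ev e m w -> ex_minn h = m.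
Proof.
move=> Em; case: ex_minnP => k hk kmin; apply: (@Ev_uniq e _ _ w _ Em).
rewrite /Ev -refreshE hk andbT; case: k hk kmin => [|k] hk kmin; first by rewrite refresh_sum0 tau_ge0.
by rewrite leNgt; apply/negP => hh; have := kmin k hh; rewrite ltnn.
Qed.

Lemma env_Ev eta0 e m w : Ev e m w ->
  env p mu eta0 U (tau w) e w = if m is k.+1 then refresh_open p U e k w else eta0 e.
Proof.
move=> Em; rewrite /env; case: pselect => [h|nh]; last first.
  by case: nh; exists m; have /andP[_] := Em.
by rewrite (Ev_min _ Em); case: (m).
Qed.

(** The default 0 matches that of [env], which returns the initial state on the same null event, so
    that identities about [env] hold everywhere. *)
Definition refresh_count e w : nat := match pselect (hasN e w) with left h => ex_minn h | right _ => 0%N end.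

Lemma refresh_count_Ev e m w : Ev e m w -> refresh_count e w = m.
Proof.
move=> Em; rewrite /refresh_count; case: pselect => [h|nh]; first exact: Ev_min.
by case: nh; exists m; have /andP[_] := Em.
Qed.

(* The driving family of the walk restarted at its first attempt; by memorylessness it is
   again independent and uniform. *)
Definition shifted (i : dyn_index) (w : O) : R :=
  match i with
  | inl (e, 0%N, false) => Num.min 1 (expR (- mu * (refresh_sum e (refresh_count e w).+1 w - tau w)))
  | inl (e, k, fl) => U (inl (e, (refresh_count e w + k)%N, fl)) w
  | inr (k, fl) => U (inr (k.+1, fl)) w
  end.

Lemma shU01 i w : 0 < shifted i w <= 1.
Proof.
case: i => [[[e [|k]] [|]]|[k fl]] /=; try exact: U01.
by rewrite lt_min ltr01 expR_gt0 ge_min lexx.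
Qed.

Definition shidx m (i : dyn_index) : dyn_index :=
  match i with inl (e, k, fl) => inl (e, (m + k)%N, fl) | inr k => inr k end.

(** Capped so as to be a probability also where fewer than [m] refreshes have occurred. *)
Definition Y1 e m w := Num.min 1 (Yv e m w).

Lemma Y101 e m w : 0 <= Y1 e m w <= 1.
Proof. by rewrite le_min ler01 expR_ge0 ge_min lexx. Qed.

Lemma Y1E e m w : refresh_sum e m w <= tau w -> Y1 e m w = Yv e m w.
Proof.
move=> h; apply/min_idPr; rewrite -(expR0 R) ler_expR mulNr oppr_le0 mulr_ge0//.
  exact: ltW.
by rewrite subr_ge0.
Qed.

(** Memorylessness in uniform coordinates: given [U < Y] the ratio [U / Y] is again uniform, and it
    encodes the part of the gap that lies beyond the attempt. *)
Lemma shifted_Ev0 e m w a : Ev e m w ->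
  (shifted (inl (e, 0%N, false)) w <= a) = (Num.min 1 (U (inl (e, m, false)) w / Y1 e m w) <= a).
Proof.
move=> Em; rewrite /= (refresh_count_Ev Em); congr (Num.min _ _ <= _).
have /andP[h _] := Em; rewrite Y1E// /Yv refresh_sumS /gapf.
have u0 : 0 < U (inl (e, m, false)) w by have /andP[] := U01 (inl (e, m, false)) w.
rewrite -{2}(lnK u0) -expRN -expRD; congr expR.
by field; rewrite gt_eqF.
Qed.

Lemma Y1_gt0 e m w : 0 < Y1 e m w.
Proof. by rewrite lt_min ltr01 expR_gt0. Qed.

Section measJ.
Variable J : dyn_index -> Prop.
Notation mJ f := (measurable_fun (setT : set (subsigma U J)) f).

Lemma mJ_tau : J (inr (0%N, false)) -> mJ tau.
Proof.
move=> h; rewrite (_ : tau = (fun w => - ln (U (inr (0%N, false)) w))); last first.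
  by apply/funext => w; rewrite tauE.
apply: measurable_funN; apply: (measurableT_comp (@measurable_ln R)).
exact: measurable_coord.
Qed.

Lemma mJ_Tm e m : (forall k, (k < m)%N -> J (inl (e, k, false))) -> mJ (refresh_sum e m).
Proof.
elim: m => [|m IH] h.
  rewrite (_ : refresh_sum e 0 = fun=> 0); first exact: measurable_cst.
  by apply/funext => w; rewrite refresh_sum0.
rewrite (_ : refresh_sum e m.+1 = fun w => refresh_sum e m w + gapf e m w); last by apply/funext => w; rewrite refresh_sumS.
apply: measurable_funD; first by apply: IH => k km; apply: h; exact: ltnW.
rewrite /gapf; apply: measurable_funM; last exact: measurable_cst.
apply: measurable_funN; apply: (measurableT_comp (@measurable_ln R)).
by apply: measurable_coord; exact: h.
Qed.

Lemma mJ_Yv e m : J (inr (0%N, false)) -> (forall k, (k < m)%N -> J (inl (e, k, false))) -> mJ (Y1 e m).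
Proof.
move=> h1 h2; apply: measurable_minr; first exact: measurable_cst.
apply: (measurableT_comp (@measurable_expR R)).
apply: measurable_funM; first exact: measurable_cst.
by apply: measurable_funB; [exact: mJ_tau|exact: mJ_Tm].
Qed.

Lemma mJ_rr : J (inr (0%N, false)) -> mJ keep_prob.
Proof.
move=> h1; apply: (measurableT_comp (@measurable_expR R)).
by apply: measurable_funM; [exact: measurable_cst|exact: mJ_tau].
Qed.

Lemma mJ_Ev e m : J (inr (0%N, false)) -> (forall k, (k <= m)%N -> J (inl (e, k, false))) -> mJ (Ev e m).
Proof.
move=> h1 h2; apply: measurable_and.
  by apply: measurable_fun_ler; [apply: mJ_Tm => k km; apply: h2; exact: ltnW|exact: mJ_tau].
by apply: measurable_fun_ltr; [exact: mJ_tau|apply: mJ_Tm => k km; apply: h2].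
Qed.

(** The index is random, so the space is cut into the events [Ev e m] and their complement, where
    the index is 0. *)
Lemma mJ_nat e d (T : measurableType d) (F : nat -> O -> T) :
  J (inr (0%N, false)) -> (forall k, J (inl (e, k, false))) ->
  (forall m, mJ (F m)) -> mJ (fun w => F (refresh_count e w) w).
Proof.
move=> h1 h2 mF _ Y mY; rewrite setTI.
have mE m : measurable [set w : subsigma U J | Ev e m w].
  have := @mJ_Ev e m h1 (fun k _ => h2 k) measurableT [set true] Logic.I.
  by rewrite setTI.
rewrite (_ : _ @^-1` _ = (\bigcup_m ([set w : subsigma U J | Ev e m w] `&` F m @^-1` Y)) `|`
   (F 0%N @^-1` Y `\` \bigcup_m [set w : subsigma U J | Ev e m w])).
  apply: measurableU.
    apply: bigcupT_measurable => m; apply: measurableI => //.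
    by have := mF m measurableT Y mY; rewrite setTI.
  apply: measurableD; last exact: bigcupT_measurable.
  by have := mF 0%N measurableT Y mY; rewrite setTI.
apply/seteqP; split => w /=.
  have [h|nh] := pselect (hasN e w).
    have [m Em] := Ev_ex h; rewrite (refresh_count_Ev Em) => Fw; left; exists m => //.
  rewrite (_ : refresh_count e w = 0%N); last by rewrite /refresh_count; case: pselect.
  move=> Fw; right; split => // -[m _] /= /andP[_ h]; apply: nh; by exists m.
move=> [[m _ [/= Em Fw]]|[Fw nE]]; first by rewrite (refresh_count_Ev Em).
rewrite (_ : refresh_count e w = 0%N)//; rewrite /refresh_count; case: pselect => // h.
by case: nE; have [m Em] := Ev_ex h; exists m.
Qed.

Lemma mJ_env eta0 e : J (inr (0%N, false)) -> (forall k fl, J (inl (e, k, fl))) ->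
  mJ (fun w => env p mu eta0 U (tau w) e w).
Proof.
move=> h1 h2.
rewrite (_ : (fun w => _) = (fun w => (fun m w => if m is k.+1 then refresh_open p U e k w else eta0 e) (refresh_count e w) w)).
  apply: (@mJ_nat e _ _ (fun m w => if m is k.+1 then refresh_open p U e k w else eta0 e)) => // -[|m]; first exact: measurable_cst.
  by apply: measurable_fun_ltr => //; apply: measurable_coord.
apply/funext => w; have [h|nh] := pselect (hasN e w).
  by have [m Em] := Ev_ex h; rewrite (env_Ev _ Em) (refresh_count_Ev Em).
by rewrite /refresh_count; case: pselect => // _; rewrite /env; case: pselect.
Qed.

Lemma mJ_shU_e e k fl : J (inr (0%N, false)) -> (forall k fl, J (inl (e, k, fl))) ->
  mJ (shifted (inl (e, k, fl))).
Proof.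
move=> h1 h2; case: k => [|k] /=; last first.
  by apply: (@mJ_nat e _ _ (fun m w => U (inl (e, (m + k.+1)%N, fl)) w)) => // m; exact: measurable_coord.
case: fl.
  by apply: (@mJ_nat e _ _ (fun m w => U (inl (e, (m + 0)%N, true)) w)) => // m; exact: measurable_coord.
apply: (@mJ_nat e _ _ (fun m w => Num.min 1 (expR (- mu * (refresh_sum e m.+1 w - tau w))))) => // m.
apply: measurable_minr; first exact: measurable_cst.
apply: (measurableT_comp (@measurable_expR R)).
apply: measurable_funM; first exact: measurable_cst.
by apply: measurable_funB; [exact: mJ_Tm|exact: mJ_tau].
Qed.

End measJ.
End edge.

(** * Divergence of sums of exponential gaps *)

Section unbounded.
Variables (R : realType) (dO : measure_display) (O : measurableType dO) (I : eqType).
Variables (Q : {measure set O -> \bar R}) (U : I -> O -> R).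
Hypothesis iU : iid_measure Q U.
Let mU : forall i, measurable_fun setT (U i) := iU.2.1.

Lemma measurable_gt d (T : measurableType d) (f : T -> R) c :
  measurable_fun setT f -> measurable [set w | c < f w].
Proof.
move=> mf; rewrite (_ : [set w | c < f w] = ~` [set w | f w <= c]).
  by apply: measurableC; exact: measurable_le_cst.
by apply/seteqP; split => w /=; rewrite ltNge => /negP.
Qed.

Lemma measurable_all_gt d (T : measurableType d) (V : nat -> T -> R) c K :
  (forall k, (k < K)%N -> measurable_fun setT (V k)) ->
  measurable [set w | forall k, (k < K)%N -> c < V k w].
Proof.
elim: K => [|K IH] h.
  rewrite (_ : [set w | _] = setT)//.
  by apply/seteqP; split => // w _ k; rewrite ltn0.
rewrite (_ : [set w | _] = [set w | forall k, (k < K)%N -> c < V k w] `&` [set w | c < V K w]).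
  apply: measurableI; last by apply: measurable_gt; exact: h.
  by apply: IH => k kK; apply: h; exact: ltnW.
apply/seteqP; split => w /=.
  by move=> hh; split; [move=> k kK; apply: hh; exact: ltnW|exact: hh].
by move=> [h1 h2] k; rewrite ltnS leq_eqVlt => /orP[/eqP->|/h1].
Qed.

Lemma all_gt_measure (idx : nat -> I) (c : R) K : injective idx -> 0 <= c <= 1 ->
  Q [set w | forall k, (k < K)%N -> c < U (idx k) w] = (((1 - c) ^+ K)%:E * Q setT)%E.
Proof.
move=> inj c01; elim: K => [|K IH].
  rewrite expr0 mul1e; congr (Q _); apply/seteqP; split => // w _ k; by rewrite ltn0.
pose J := fun i => exists2 k, (k < K)%N & i = idx k.
pose S := [set w | forall k, (k < K)%N -> c < U (idx k) w].
have -> : [set w | forall k, (k < K.+1)%N -> c < U (idx k) w] =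
   S `&` U (idx K) @^-1` [set u | c < u].
  apply/seteqP; split => w /=.
    move=> h; split; last exact: h.
    by move=> k kK; apply: h; exact: ltnW.
  by move=> [h1 h2] k; rewrite ltnS leq_eqVlt => /orP[/eqP->|/h1].
have mc : measurable [set u : R | c < u] by exact: measurable_gt.
rewrite (@indep_law R dO O I Q U J iU) //.
- rewrite IH exprS EFinM (_ : unif01 R [set u | c < u] = (1 - c)%:E).
    by rewrite muleAC [((1 - c)%:E * _)%E]muleC.
  have -> : [set u : R | c < u] = setT `\` [set u | u <= c].
    by apply/seteqP; split => u /=; rewrite ltNge; [move=> /negP|move=> [_ /negP]].
  have e1 : unif01 R setT = 1%E by exact: probability_setT.
  have mcc : measurable [set u : R | u <= c] by exact: measurable_le_cst.
  rewrite measureD//; last by rewrite [X in (X < _)%E]e1 ltry.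
  by rewrite setTI EFinB; congr (_ - _)%E => //; rewrite -[in RHS](clamp_id c01); exact: unif01_le.
- by move=> [k kK /inj e]; rewrite -e ltnn in kK.
- apply: (@measurable_all_gt _ (subsigma U J) (fun k => U (idx k))) => k kK.
  by apply: measurable_coord; exists k.
Qed.

Lemma all_gt_null (idx : nat -> I) (c : R) : injective idx -> 0 < c <= 1 ->
  measurable [set w | forall k, c < U (idx k) w] /\ Q [set w | forall k, c < U (idx k) w] = 0%E.
Proof.
move=> inj /andP[c0 c1].
have mS : measurable [set w | forall k, c < U (idx k) w].
  rewrite (_ : [set w | _] = \bigcap_k [set w | c < U (idx k) w]).
    by apply: bigcapT_measurable => k; exact: measurable_gt.
  by apply/seteqP; split => w h k; [move=> _; apply: h|apply: h].
split => //.
have c01 : 0 <= c <= 1 by rewrite (ltW c0).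
have h K : fine (Q [set w | forall k, c < U (idx k) w]) <= (1 - c) ^+ K * fine (Q setT).
  rewrite -lee_fin EFinM !fineK ?iU.1 ?(iid_measure_fin iU mS)// -(all_gt_measure K inj c01).
  apply: le_measure; rewrite ?inE//.
    exact: measurable_all_gt.
  by move=> w hh k _; exact: hh.
have lim0 : (fun K => (1 - c) ^+ K * fine (Q setT)) @ \oo --> (0 : R).
  rewrite -[X in _ --> X](mul0r (fine (Q setT))); apply: cvgMl.
  apply: cvg_expr; rewrite ger0_norm ?subr_ge0//; lra.
apply/eqP; rewrite eq_le measure_ge0 andbT -[leLHS]fineK ?(iid_measure_fin iU mS)// lee_fin.
rewrite -(cvg_lim _ lim0)//; apply: limr_ge; first by apply/cvg_ex; exists 0.
by apply: nearW => K; exact: h.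
Qed.

Hypothesis U01 : forall i w, 0 < U i w <= 1.

(** If the partial sums of the nonnegative terms [- ln U] stay bounded, every [U] stays above a
    fixed level [c > 0]; this event has measure at most [(1 - c) ^+ K] times the total mass for
    every [K]. *)
Lemma sum_unbounded (idx : nat -> I) : injective idx ->
  exists N, [/\ measurable N, Q N = 0%E &
    forall w, ~ N w -> forall L : R, exists n, L < \sum_(k < n.+1) - ln (U (idx k) w)].
Proof.
move=> inj.
pose S (L : nat) := [set w | forall k, expR (- (L.+1%:R)) < U (idx k) w].
pose N := \bigcup_(L : nat) S L.
have hL (L : nat) : 0 < (expR (- (L.+1%:R)) : R) <= 1.
  by rewrite expR_gt0 /= -(expR0 R) ler_expR oppr_le0.
exists N; split.
- by apply: bigcupT_measurable => L; have [] := all_gt_null inj (hL L).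
- apply/eqP; rewrite eq_le measure_ge0 andbT.
  apply: (@le_trans _ _ (\sum_(L <oo) Q (S L))%E).
    apply: measure_sigma_subadditive => //.
    - by move=> L; have [] := all_gt_null inj (hL L).
    - by apply: bigcupT_measurable => L; have [] := all_gt_null inj (hL L).
  by rewrite eseries0// => L _ _; have [] := all_gt_null inj (hL L).
move=> w nN L; apply: contrapT => /forallNP h; apply: nN.
exists (Num.truncn `|L|).+1 => //= k.
have u0 : 0 < U (idx k) w by have /andP[] := U01 (idx k) w.
rewrite -[X in _ < X](lnK u0) ltr_expR ltrNl.
have /negP := h k; rewrite -leNgt => hk.
have lnn i : 0 <= - ln (U (idx i) w).
  by rewrite oppr_ge0; apply: ln_le0; have /andP[] := U01 (idx i) w.
rewrite big_ord_recr /= in hk.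
have h0 : 0 <= \sum_(i < k) - ln (U (idx i) w) by apply: sumr_ge0 => i _; exact: lnn.
have h1 : L <= `|L| by exact: ler_norm.
have h2 : `|L| < (Num.truncn `|L|).+1%:R by exact: truncnS_gt.
have h3 : (Num.truncn `|L|).+1%:R < (Num.truncn `|L|).+2%:R :> R by rewrite ltr_nat.
by move: (lnn k) => h4; lra.
Qed.

End unbounded.

(** * The state and the residual clock of one edge at the first attempt *)

Section EL.
Variables (R : realType) (dO : measure_display) (O : measurableType dO).
Variables (p mu : R).
Hypothesis p01 : 0 <= p <= 1.
Hypothesis mu0 : 0 < mu.
Variables (Q : {measure set O -> \bar R}) (U : dyn_index -> O -> R).
Hypothesis iU : iid_measure Q U.
Hypothesis U01 : forall i w, 0 < U i w <= 1.
Let mU : forall i, measurable_fun setT (U i) := iU.2.1.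
Notation EQ := (expect Q).
Notation Ev := (Ev mu U).

Lemma hasN_ae e : exists N, [/\ measurable N, Q N = 0%E & forall w, ~ N w -> hasN mu U e w].
Proof.
have inj : injective (fun k : nat => inl (e, k, false) : dyn_index) by move=> k k' [].
have [N [mN N0 h]] := sum_unbounded iU U01 inj.
exists N; split => // w /h /(_ (mu * tau U w))[n hn]; exists n.
by rewrite /refresh_time -mulr_suml ltr_pdivlMr// mulrC.
Qed.

Lemma mEvO e m : measurable_fun setT (Ev e m).
Proof.
apply: (@measurable_from_subsigma R dO O dyn_index U (fun=> True)) => //.
exact: mJ_Ev.
Qed.

(** Up to the null event that no refresh time exceeds [tau], the events [Ev e m] partition the
    space. *)
Lemma expect_split e (f : O -> R) : measurable_fun setT f -> (forall w, 0 <= f w) ->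
  EQ f = (\sum_(m <oo) EQ (fun w => (f w * (Ev e m w)%:R)%R))%E.
Proof.
move=> mf f0; have [N [mN N0 hN]] := hasN_ae e.
pose D m := [set w | Ev e m w].
have mD m : measurable (D m).
  by have := mEvO e m measurableT (Y := [set true]) Logic.I; rewrite setTI.
have mUD : measurable (\bigcup_m D m) by exact: bigcupT_measurable.
have mfE : measurable_fun setT (fun w => (f w)%:E) by exact/measurable_EFinP.
rewrite {1}/expect (@ge0_negligible_integral _ _ _ _ _ (~` \bigcup_m D m)) //.
- rewrite setTD setCK ge0_integral_bigcup//.
  + apply: eq_eseriesr => m _; rewrite /expect [LHS]integral_mkcond; apply: eq_integral => w _.
    rewrite /patch; case: ifPn => h; move: h; rewrite ?inE ?notin_setE /D /=; first by move=> ->; rewrite mulr1.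
    by move=> /negP/negbTE ->; rewrite mulr0.
  + exact: measurable_funTS.
  + by move=> w _; rewrite lee_fin.
  + apply/trivIsetP => m n _ _ mn; apply/seteqP; split => // w [h1 h2].
    by move/eqP: mn; apply; exact: (Ev_uniq mu0 U01 h1 h2).
- exact: measurableC.
- by move=> w _; rewrite lee_fin.
- apply/eqP; rewrite eq_le measure_ge0 andbT -N0; apply: le_measure; rewrite ?inE//.
    exact: measurableC.
  move=> w /= nD; apply: contrapT => /hN /(Ev_ex U01) [m Em].
  by apply: nD; exists m.
Qed.

End EL.

Lemma mJ_mono (R : realType) dO (O : measurableType dO) (I : eqType) (U : I -> O -> R)
  (J K : I -> Prop) d (T : measurableType d) (f : O -> T) : (forall i, J i -> K i) ->
  measurable_fun (setT : set (subsigma U J)) f -> measurable_fun (setT : set (subsigma U K)) f.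
Proof. by move=> JK mf mT Y mY; apply: (sigma_mono JK); exact: mf. Qed.

Section EL2.
Variables (R : realType) (dO : measure_display) (O : measurableType dO).
Variables (p mu : R).
Hypothesis p01 : 0 <= p <= 1.
Hypothesis mu0 : 0 < mu.
Variables (Q : {measure set O -> \bar R}) (U : dyn_index -> O -> R).
Hypothesis iU : iid_measure Q U.
Hypothesis U01 : forall i w, 0 < U i w <= 1.
Let mU : forall i, measurable_fun setT (U i) := iU.2.1.
Notation EQ := (expect Q).
Notation Ev := (Ev mu U).
Notation refresh_sum := (refresh_sum mu U).
Notation tau := (tau U).
Notation Y1 := (Y1 mu U).
Notation shifted := (shifted mu U).

Definition Je (e : seq nat) (i : dyn_index) : Prop :=
  match i with inl (e', _, _) => e' <> e | inr _ => True end.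

Variables (e : seq nat) (eta0 : seq nat -> bool) (b : bool).
Variables (se : seq dyn_index) (a : dyn_index -> R) (Z : O -> R).
Hypothesis use : uniq se.
Hypothesis see : forall i, i \in se -> exists k fl, i = inl (e, k, fl).
Hypothesis a01 : forall i, 0 <= a i <= 1.
Hypothesis mZ : measurable_fun (setT : set (subsigma U (Je e))) Z.
Hypothesis Z0 : forall w, 0 <= Z w.

Let g0 : dyn_index := inl (e, 0%N, false).
(** Probability of finding [e] in state [b] given [m] refreshes: for [m = 0] the initial state
    decides, otherwise the coin of the last refresh. *)
Definition wgt (m : nat) : R := if m is _.+1 then (if b then p else 1 - p) else (b == eta0 e)%:R.

Let st m (w : O) : bool := if m is k.+1 then (U (inl (e, k, true)) w < p) == b else b == eta0 e.
(** Both conditions on the variable of gap [m]: it overshoots the attempt and, if the box constrains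
    the residual gap, its rescaled value meets that constraint. *)
Let Pc m (w : O) (u : R) : bool := (u < Y1 e m w) && ((g0 \in se) ==> (u <= a g0 * Y1 e m w)).
Let se' := [seq i <- se | i != g0].
Let post m (w : O) := all (fun i => U (shidx m i) w <= a i) se'.

Lemma box_Ev m w : Ev e m w ->
  all (fun i => shifted i w <= a i) se = ((g0 \in se) ==> (U (inl (e, m, false)) w <= a g0 * Y1 e m w)) && post m w.
Proof.
move=> Em; have y0 := Y1_gt0 mu U e m w.
have Eg : (shifted g0 w <= a g0) = (U (inl (e, m, false)) w <= a g0 * Y1 e m w).
  rewrite (shifted_Ev0 mu0 U01 _ Em) -ler_pdivrMr//; congr (_ <= _); apply/min_idPr.
  rewrite ler_pdivrMr// mul1r; apply: ltW.
  by move: (Em); rewrite (Ev_cross mu0 U01) => /andP[h]; rewrite -(Y1E mu0 h).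
have Ei i : i \in se -> i != g0 -> shifted i w = U (shidx m i) w.
  move=> /see[k [fl ->]]; rewrite /g0; case: k fl => [|k] [|]//=; rewrite ?(refresh_count_Ev mu0 U01 Em)//.
  by rewrite eqxx.
apply/allP/andP.
  move=> h; split; first by apply/implyP => gs; rewrite -Eg; exact: h.
  by apply/allP => i; rewrite mem_filter => /andP[ig is_]; rewrite -Ei//; exact: h.
move=> [/implyP h1 /allP h2] i is_; have [ig|ig] := eqVneq i g0.
  by rewrite ig Eg; apply: h1; rewrite -ig.
by rewrite Ei//; apply: h2; rewrite mem_filter ig.
Qed.

Lemma EL_point m w :
  Z w * (env p mu eta0 U (tau w) e w == b)%:R * (all (fun i => shifted i w <= a i) se)%:R * (Ev e m w)%:R
  = Z w * (refresh_sum e m w <= tau w)%R%:R * (Pc m w (U (inl (e, m, false)) w))%:R * (st m w)%:R * (post m w)%:R.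
Proof.
have [Em|nE] := boolP (Ev e m w); last first.
  rewrite mulr0; have [h|nh] := boolP (refresh_sum e m w <= tau w); last by rewrite !(mul0r, mulr0).
  have -> : Pc m w (U (inl (e, m, false)) w) = false.
    apply/negP => /andP[h2 _]; move/negP: nE; apply.
    by rewrite (Ev_cross mu0 U01) h -(Y1E mu0 h).
  by rewrite !(mul0r, mulr0).
have hT : refresh_sum e m w <= tau w by have /andP[] := Em.
rewrite (box_Ev Em) mulr1 hT mulr1.
have -> : (env p mu eta0 U (tau w) e w == b) = st m w.
  by rewrite (env_Ev p mu0 U01 eta0 Em) /st; case: (m) => [|k]; rewrite ?[eta0 e == b]eq_sym.
have -> : Pc m w (U (inl (e, m, false)) w) = ((g0 \in se) ==> (U (inl (e, m, false)) w <= a g0 * Y1 e m w)).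
  rewrite /Pc; have -> // : U (inl (e, m, false)) w < Y1 e m w.
  by move: (Em); rewrite (Ev_cross mu0 U01) => /andP[_]; rewrite -(Y1E mu0 hT).
by rewrite -mulnb natrM; ring.
Qed.

(** Three nested index sets for peeling off the variables of [e]: [J1] leaves out those posterior to
    the attempt, [J2] also all coins, [J3] also gap [m]. Variables not attached to [e] belong to all
    three. *)
Let J3 m (i : dyn_index) : Prop :=
  match i with inl (e', k, fl) => e' <> e \/ (fl = false /\ (k < m)%N) | inr _ => True end.
Let J2 m (i : dyn_index) : Prop :=
  match i with inl (e', k, fl) => e' <> e \/ (fl = false /\ (k <= m)%N) | inr _ => True end.
Let J1 m (i : dyn_index) : Prop :=
  match i with inl (e', k, fl) => e' <> e \/ (if fl then (k < m)%N else (k <= m)%N) | inr _ => True end.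

Let J32 m i : J3 m i -> J2 m i.
Proof. by case: i => [[[e' k] fl]|]//= [?|[? ?]]; [left|right; split => //; exact: ltnW]. Qed.
Let J21 m i : J2 m i -> J1 m i.
Proof. by case: i => [[[e' k] fl]|]//= [?|[-> ?]]; [left|right]. Qed.
Let JeJ3 m i : Je e i -> J3 m i.
Proof. by case: i => [[[e' k] fl]|]//= ?; left. Qed.

Let mZT3 m : measurable_fun (setT : set (subsigma U (J3 m))) (fun w => Z w * (refresh_sum e m w <= tau w)%R%:R).
Proof.
apply: measurable_funM; first by apply: (mJ_mono (@JeJ3 m)); exact: mZ.
apply: measurable_nR; apply: measurable_fun_ler.
  by apply: mJ_Tm => // k km; right.
exact: mJ_tau.
Qed.

Let mY3 m : measurable_fun (setT : set (subsigma U (J3 m))) (Y1 e m).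
Proof. by apply: mJ_Yv => // k km; right. Qed.

Let mPc m (J : dyn_index -> Prop) : (forall i, J3 m i -> J i) -> J (inl (e, m, false)) ->
  measurable_fun (setT : set (subsigma U J)) (fun w => Pc m w (U (inl (e, m, false)) w)).
Proof.
move=> JJ Jm; have mY : measurable_fun (setT : set (subsigma U J)) (Y1 e m) by apply: (mJ_mono JJ).
apply: measurable_and; first by apply: measurable_fun_ltr => //; exact: measurable_coord.
case: (g0 \in se) => /=; last exact: measurable_cst.
apply: measurable_fun_ler; first exact: measurable_coord.
by apply: measurable_funM => //; exact: measurable_cst.
Qed.

Let a0 : R := if g0 \in se then a g0 else 1.
Let a001 : 0 <= a0 <= 1. Proof. by rewrite /a0; case: ifP => // _; rewrite ler01 lexx. Qed.

Let cut m : EQ (fun w => Z w * (refresh_sum e m w <= tau w)%R%:R * (Pc m w (U (inl (e, m, false)) w))%:R) =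
  (a0%:E * EQ (fun w => (Z w * (refresh_sum e m w <= tau w)%R%:R * Y1 e m w)%R))%E.
Proof.
have y01 w := Y101 mu U e m w.
rewrite (@expect_cut R dO O dyn_index Q U iU (J3 m) (inl (e, m, false)) _ (fun w => a0 * Y1 e m w) (Pc m)) //.
- rewrite -(expectZ Q (c := a0)).
  + by apply: eq_expect => w; rewrite mulrCA.
  + by have /andP[] := a001.
  + apply: (@measurable_from_subsigma R dO O dyn_index U (J3 m)) => //.
    by apply: measurable_funM => //; exact: mZT3.
  + by move=> w; rewrite mulr_ge0// ?mulr_ge0//; have /andP[] := y01 w.
- by move=> [//|[_]]; rewrite ltnn.
- by move=> w; rewrite mulr_ge0.
- move=> w; have /andP[? ?] := y01 w; have /andP[? ?] := a001.
  by rewrite mulr_ge0//= mulr_ile1.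
- have mY : measurable_fun (setT : set (subsigma U (J3 m) * R)) (fun z => Y1 e m z.1).
    by apply: (measurableT_comp (@mY3 m)); exact: measurable_fst.
  apply: measurable_and; first by apply: measurable_fun_ltr => //; exact: measurable_snd.
  case: (g0 \in se) => /=; last exact: measurable_cst.
  apply: measurable_fun_ler; first exact: measurable_snd.
  by apply: measurable_funM => //; exact: measurable_cst.
- move=> w u; have /andP[? ?] := y01 w; rewrite /a0 /Pc; case: ifP => _ /= h.
    rewrite (ltW h) andbT; apply: lt_le_trans h _; rewrite ler_piMl//.
    by have /andP[] := a01 g0.
  by rewrite andbT; rewrite mul1r in h.
- by move=> w u; rewrite /Pc /a0; case: ifP => _ /= /andP[h1 h2] //; rewrite mul1r ltW.
Qed.

Let mB : measurable [set u : R | (u < p) == b].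
Proof.
have : measurable_fun setT (fun u : R => u < p) by exact: measurable_fun_ltr.
by move=> /(_ measurableT [set b] Logic.I); rewrite setTI (_ : _ @^-1` _ = [set u : R | (u < p) == b])//;
  apply/seteqP; split => u /= /eqP.
Qed.

Let lamB : unif01 R [set u | (u < p) == b] = (if b then p else 1 - p)%:E.
Proof.
case: b.
  by rewrite (_ : [set u | _] = [set u | u < p]); [rewrite unif01_lt clamp_id|apply/seteqP; split => u /= /eqP].
rewrite (_ : [set u | _] = [set u | p <= u]); first by rewrite unif01_ge clamp_id.
by apply/seteqP; split => u /=; rewrite leNgt; [move=> /eqP->|move=> /negbTE->].
Qed.

Let peel_st m : EQ (fun w => Z w * (refresh_sum e m w <= tau w)%R%:R * (Pc m w (U (inl (e, m, false)) w))%:R * (st m w)%:R) =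
  ((wgt m)%:E * EQ (fun w => (Z w * (refresh_sum e m w <= tau w)%R%:R * (Pc m w (U (inl (e, m, false)) w))%:R)%R))%E.
Proof.
have mF : measurable_fun (setT : set (subsigma U (J2 m))) (fun w => Z w * (refresh_sum e m w <= tau w)%R%:R * (Pc m w (U (inl (e, m, false)) w))%:R).
  apply: measurable_funM; first exact: (mJ_mono (@J32 m)).
  by apply: measurable_nR; apply: mPc => //; [exact: J32|right].
have mFO := measurable_from_subsigma mU mF.
rewrite -expectZ//; first last.
- by move=> w; rewrite mulr_ge0// mulr_ge0.
- by rewrite /wgt; case: (m) => // _; case: b; move/andP: p01 => [? ?]; rewrite ?subr_ge0.
case: m mF mFO => [|k] mF mFO; first by apply: eq_expect => w; rewrite mulrC.
rewrite -[RHS](@eq_expect _ _ _ Q (fun w => Z w * (refresh_sum e k.+1 w <= tau w)%R%:R * (Pc k.+1 w (U (inl (e, k.+1, false)) w))%:R * (if b then p else 1 - p))); last first.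
  by move=> w; rewrite mulrC.
rewrite -(@expect_set R dO O dyn_index Q U iU (J2 k.+1) (inl (e, k, true)) [set u | (u < p) == b]) //.
- apply: eq_expect => w; congr (_ * _); rewrite indicE /st.
  by case: (boolP (_ == b)) => h; [rewrite mem_set|rewrite memNset//=; exact/negP].
- by move=> [//|[]].
- by move=> w; rewrite mulr_ge0// mulr_ge0.
Qed.

(** With [m] refreshes, the later variables, the last coin and the rescaled gap are integrated out
    in this order. They leave the volume of the box, the weight of [b], and a factor that depends
    neither on the box nor on [b]. *)
Lemma EL_m m :
  EQ (fun w => Z w * (env p mu eta0 U (tau w) e w == b)%:R * (all (fun i => shifted i w <= a i) se)%:R * (Ev e m w)%:R)
  = ((\prod_(i <- se) a i * wgt m)%:E * EQ (fun w => (Z w * (refresh_sum e m w <= tau w)%R%:R * Y1 e m w)%R))%E.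
Proof.
rewrite (eq_expect _ (EL_point m)).
have prodE : \prod_(i <- se) a i = \prod_(i <- se') a i * a0.
  rewrite /se' /a0 big_filter; case: ifPn => gs.
    by rewrite (bigD1_seq g0)//= mulrC.
  rewrite mulr1 big_seq [RHS]big_seq_cond; apply: eq_bigl => i.
  by case: eqVneq => [->|]; rewrite ?andbT// (negbTE gs).
rewrite prodE (expect_list iU (J := J1 m) (sh := shidx m) (s := se') (a := a)) //.
- by rewrite peel_st cut !muleA -!EFinM; congr (_%:E * _)%E; ring.
- rewrite map_inj_in_uniq ?filter_uniq// => i j.
  rewrite !mem_filter => /andP[_ /see[k [fl ->]]] /andP[_ /see[k' [fl' ->]]] [] h ->.
  by move/addnI: h => ->.
- move=> i; rewrite mem_filter => /andP[ig /see[k [fl ei]]]; rewrite {}ei in ig *.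
  move=> /= [//|]; case: fl ig => /= ig; first by rewrite ltnNge leq_addr.
  case: k ig => [|k]; first by rewrite eqxx.
  by rewrite addnS ltnNge leq_addr.
- apply: measurable_funM; last first.
    apply: measurable_nR; rewrite /st; case: (m) => [|k]; first exact: measurable_cst.
    rewrite (_ : (fun w => _) = (fun w => if b then U (inl (e, k, true)) w < p else ~~ (U (inl (e, k, true)) w < p))); last first.
      by apply/funext => w; case: b; case: (_ < _).
    have mc : measurable_fun (setT : set (subsigma U (J1 k.+1))) (fun w => U (inl (e, k, true)) w < p).
      by apply: measurable_fun_ltr => //; apply: measurable_coord; right.
    by case: b => //; exact: measurable_neg.
  apply: measurable_funM; first by apply: (mJ_mono (@J21 m)); exact: (mJ_mono (@J32 m)).
  apply: measurable_nR; apply: mPc; last by right.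
  by move=> i /J32 /J21.
- by move=> w; rewrite !mulr_ge0.
Qed.

End EL2.

Section EL3.
Variables (R : realType) (dO : measure_display) (O : measurableType dO).
Variables (p mu : R).
Hypothesis p01 : 0 <= p <= 1.
Hypothesis mu0 : 0 < mu.
Variables (Q : {measure set O -> \bar R}) (U : dyn_index -> O -> R).
Hypothesis iU : iid_measure Q U.
Hypothesis U01 : forall i w, 0 < U i w <= 1.
Let mU : forall i, measurable_fun setT (U i) := iU.2.1.
Notation EQ := (expect Q).
Notation Ev := (Ev mu U).
Notation tau := (tau U).
Notation shifted := (shifted mu U).
Notation rr := (keep_prob mu U).

Section one_edge.
Variables (e : seq nat) (eta0 : seq nat -> bool).
Variables (Z : O -> R).
Hypothesis mZ : measurable_fun (setT : set (subsigma U (Je e))) Z.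
Hypothesis Z0 : forall w, 0 <= Z w.
Let mZO : measurable_fun setT Z := measurable_from_subsigma mU mZ.

Let menv : measurable_fun setT (fun w => env p mu eta0 U (tau w) e w).
Proof.
apply: (@measurable_from_subsigma R dO O dyn_index U (fun=> True)) => //.
exact: mJ_env.
Qed.

Let menvb b : measurable_fun setT (fun w => env p mu eta0 U (tau w) e w == b).
Proof.
case: b.
  by rewrite (_ : (fun w => _) = (fun w => env p mu eta0 U (tau w) e w))//; apply/funext => w; case: env.
rewrite (_ : (fun w => _) = (fun w => ~~ env p mu eta0 U (tau w) e w)); first exact: measurable_neg.
by apply/funext => w; case: env.
Qed.

Let mshU i : measurable_fun setT (shifted i).
Proof.
apply: (@measurable_from_subsigma R dO O dyn_index U (fun=> True)) => //.
case: i => [[[e' k] fl]|[k fl]]; first exact: mJ_shU_e.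
exact: measurable_coord.
Qed.

(** The volume of the box factors out for every number [m] of refreshes, hence from the sum over
    [m]: the shifted variables of [e] are uniform and independent of its state at the attempt and of
    [Z]. *)
Lemma EL_box b se a : uniq se -> (forall i, i \in se -> exists k fl, i = inl (e, k, fl)) ->
  (forall i, 0 <= a i <= 1) ->
  EQ (fun w => Z w * (env p mu eta0 U (tau w) e w == b)%:R * (all (fun i => shifted i w <= a i) se)%:R)
  = ((\prod_(i <- se) a i)%:E * EQ (fun w => (Z w * (env p mu eta0 U (tau w) e w == b)%:R)%R))%E.
Proof.
move=> us sse a01.
have m1 : measurable_fun setT (fun w => Z w * (env p mu eta0 U (tau w) e w == b)%:R).
  by apply: measurable_funM => //; exact: measurable_nR.
have pr0 : 0 <= \prod_(i <- se) a i by apply: prodr_ge0 => i _; have /andP[] := a01 i.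
rewrite (expect_split mu0 iU U01 e); last 2 first.
- apply: measurable_funM => //; apply: measurable_nR; apply: measurable_all => i _.
  exact: measurable_fun_ler.
- by move=> w; rewrite !mulr_ge0.
rewrite (expect_split mu0 iU U01 e m1); last by move=> w; rewrite mulr_ge0.
rewrite -nneseriesZl//; last by move=> m _; apply: expect_ge0 => w; rewrite !mulr_ge0.
apply: eq_eseriesr => m _.
rewrite (EL_m p01 mu0 iU U01 eta0 b us sse a01 mZ Z0).
have := @EL_m R dO O p mu p01 mu0 Q U iU U01 e eta0 b [::] a Z isT _ a01 mZ Z0 m.
rewrite big_nil mul1r => h; rewrite EFinM -muleA -h//; congr (_ * _)%E.
by apply: eq_expect => w /=; rewrite mulr1.
Qed.

Lemma EQ_Ev m : EQ (fun w => Z w * (Ev e m w)%:R) =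
  EQ (fun w => (Z w * (refresh_sum mu U e m w <= tau w)%R%:R * Y1 mu U e m w)%R).
Proof.
pose a := fun _ : dyn_index => 1 : R.
have a01 i : 0 <= a i <= 1 by rewrite ler01 lexx.
have h b := @EL_m R dO O p mu p01 mu0 Q U iU U01 e eta0 b [::] a Z isT
  (fun i (h : i \in [::]) => match (notF h) with end) a01 mZ Z0 m.
have mE : measurable_fun setT (fun w => (Ev e m w)%:R : R) by apply: measurable_nR; exact: (mEvO _ iU).
have -> : EQ (fun w => Z w * (Ev e m w)%:R) =
   EQ (fun w => (Z w * (env p mu eta0 U (tau w) e w == true)%:R * (all (fun i => shifted i w <= a i) [::])%:R * (Ev e m w)%:R)
     + (Z w * (env p mu eta0 U (tau w) e w == false)%:R * (all (fun i => shifted i w <= a i) [::])%:R * (Ev e m w)%:R)).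
  by apply: eq_expect => w /=; case: env; rewrite !(mulr1, mulr0, mul0r, addr0, add0r).
rewrite expectD.
- have w0 b : 0 <= wgt p e eta0 b m.
    by have /andP[? ?] := p01; rewrite /wgt; case: (m) => // _; case: b; rewrite ?subr_ge0.
  rewrite !h !big_nil !mul1r -ge0_muleDl ?lee_fin ?w0//.
  by rewrite -EFinD [X in X%:E](_ : _ = 1) ?mul1e// /wgt; case: (m) => [|k]; [case: (eta0 e); rewrite ?addr0 ?add0r|rewrite addrC subrK].
- by apply: measurable_funM => //; apply: measurable_funM => //; apply: measurable_funM => //; exact: measurable_nR.
- by move=> w; rewrite !mulr_ge0.
- by apply: measurable_funM => //; apply: measurable_funM => //; apply: measurable_funM => //; exact: measurable_nR.
- by move=> w; rewrite !mulr_ge0.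
Qed.

Lemma Ev0E w : Ev e 0 w = (U (inl (e, 0%N, false)) w < rr w).
Proof. by rewrite (Ev_cross mu0 U01) refresh_sum0 (tau_ge0 U01) /Yv refresh_sum0 subr0. Qed.

(** Given the time of the attempt, [e] is unrefreshed with probability [keep_prob]; once refreshed,
    its state is a fresh coin whatever the number of refreshes. *)
Lemma EL_env b :
  EQ (fun w => Z w * (env p mu eta0 U (tau w) e w == b)%:R) =
  EQ (fun w => Z w * qb p (rr w) (eta0 e) b).
Proof.
have [p0 p1] := andP p01.
set pb : R := if b then p else 1 - p.
have pb0 : 0 <= pb by rewrite /pb; case: ifP => _; lra.
set c : R := (b == eta0 e)%:R.
have c0 : 0 <= c by rewrite /c.
transitivity (EQ (fun w => Z w * (if U (inl (e, 0%N, false)) w < rr w then c else pb))).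
  have mI : measurable_fun setT (fun w => if U (inl (e, 0%N, false)) w < rr w then c else pb).
    apply: measurable_fun_if => //; apply: measurable_fun_ltr => //.
    by apply: (@measurable_from_subsigma R dO O dyn_index U (fun=> True)) => //; exact: mJ_rr.
  rewrite (expect_split mu0 iU U01 e); last 2 first.
  - by apply: measurable_funM => //; exact: measurable_nR.
  - by move=> w; rewrite mulr_ge0.
  rewrite [RHS](expect_split mu0 iU U01 e); last 2 first.
  - exact: measurable_funM.
  - by move=> w; rewrite mulr_ge0//; case: ifP.
  apply: eq_eseriesr => m _.
  have := @EL_m R dO O p mu p01 mu0 Q U iU U01 e eta0 b [::] (fun=> 1) Z isT
    (fun i (h : i \in [::]) => match (notF h) with end) (fun _ => introT andP (conj ler01 (lexx 1))) mZ Z0 m.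
  rewrite big_nil mul1r -EQ_Ev => h.
  transitivity ((wgt p e eta0 b m)%:E * EQ (fun w => (Z w * (Ev e m w)%:R)%R))%E.
    by rewrite -h; apply: eq_expect => w /=; rewrite mulr1.
  rewrite -expectZ.
  - apply: eq_expect => w; rewrite mulrCA -[in RHS]mulrA; congr (_ * _).
    rewrite -Ev0E; have [Em|_] := boolP (Ev e m w); last by rewrite !mulr0.
    rewrite !mulr1 /wgt; case: m Em {h} => [|k] Em; first by rewrite Em.
    have -> // : Ev e 0 w = false.
    by apply/negP => E0; have := Ev_uniq mu0 U01 E0 Em.
  - by rewrite /wgt; case: (m).
  - by apply: measurable_funM => //; apply: measurable_nR; exact: (mEvO _ iU).
  - by move=> w; rewrite mulr_ge0.
have mrr : measurable_fun (setT : set (subsigma U (Je e))) rr by exact: mJ_rr.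
apply: (@expect_fubini R dO O dyn_index Q U iU (Je e) (inl (e, 0%N, false)) (fun w u => Z w * (if u < rr w then c else pb))).
- by move=> /=.
- apply: measurable_funM; first by apply: (measurableT_comp mZ); exact: measurable_fst.
  apply: measurable_fun_if => //; apply: measurable_fun_ltr; first exact: measurable_snd.
  by apply: (measurableT_comp mrr); exact: measurable_fst.
- by move=> w u; rewrite mulr_ge0//; case: ifP.
move=> w; have r01 := rr01 mu0 U01 w.
have mlt : @measurable default_measure_display R [set u : R | u < rr w].
  rewrite (_ : [set u | _] = `]-oo, rr w[%classic); first exact: measurable_itv.
  by apply/seteqP; split => u; rewrite /= in_itv.
have mge : @measurable default_measure_display R [set u : R | rr w <= u].
  rewrite (_ : [set u | _] = `[rr w, +oo[%classic); first exact: measurable_itv.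
  by apply/seteqP; split => u; rewrite /= in_itv/= andbT.
rewrite (eq_integral (fun u => ((Z w * c * \1_[set u | u < rr w] u)%:E + (Z w * pb * \1_[set u | rr w <= u] u)%:E)%E)); last first.
  move=> u _; rewrite -EFinD; congr EFin; rewrite !indicE.
  case: (boolP (u < rr w)) => h.
    by rewrite mem_set// memNset ?mulr1 ?mulr0 ?addr0//= => /(lt_le_trans h); rewrite ltxx.
  by rewrite memNset//= ?mem_set ?mulr1 ?mulr0 ?add0r//= ?leNgt//; exact/negP.
rewrite ge0_integralD//; last first.
- by apply/measurable_EFinP/measurable_funM => //; exact: measurable_indic.
- by move=> u _; rewrite lee_fin !mulr_ge0.
- by apply/measurable_EFinP/measurable_funM => //; exact: measurable_indic.
- by move=> u _; rewrite lee_fin !mulr_ge0.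
rewrite (unif01_int_ind _ mlt) (unif01_int_ind _ mge) unif01_lt unif01_ge clamp_id// -!EFinM -EFinD; congr EFin.
by rewrite /qb -/pb -/c; ring.
Qed.

End one_edge.
End EL3.

Lemma resample_ext_off (R : realFieldType) (E : eqType) (p : R) (D : pred E) rho (S : seq E)
  (f g : (E -> bool) -> R) (eta : E -> bool) : (forall e, e \in S -> D e) ->
  (forall z, (forall e, ~~ D e -> z e = eta e) -> f z = g z) ->
  forall z, (forall e, ~~ D e -> z e = eta e) -> resample p rho S f z = resample p rho S g z.
Proof.
move=> SD fg; elim: S SD => [|e S IH] SD z hz /=; first exact: fg.
have SD' x : x \in S -> D x by move=> xS; apply: SD; rewrite in_cons xS orbT.
have hu b x : ~~ D x -> upd z e b x = eta x.
  move=> nx; rewrite /upd; case: eqP => [xe|_]; last exact: hz.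
  by rewrite xe SD ?mem_head in nx.
by rewrite /resample1 (IH SD' z hz) (IH SD' _ (hu true)) (IH SD' _ (hu false)).
Qed.

Lemma all_filterC (T : eqType) (P q : pred T) (s : seq T) :
  all P s = all P [seq x <- s | q x] && all P [seq x <- s | predC q x].
Proof. by elim: s => //= x s ->; case: (q x) => /=; case: (P x); rewrite /= ?andbF ?andbT. Qed.

(** * Finitely many edges at the first attempt *)

Section expect_first_step.
Variables (R : realType) (dO : measure_display) (O : measurableType dO).
Variables (p mu : R).
Hypothesis p01 : 0 <= p <= 1.
Hypothesis mu0 : 0 < mu.
Variables (Q : {measure set O -> \bar R}) (U : dyn_index -> O -> R).
Hypothesis iU : iid_measure Q U.
Hypothesis U01 : forall i w, 0 < U i w <= 1.
Let mU : forall i, measurable_fun setT (U i) := iU.2.1.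
Notation EQ := (expect Q).
Notation tau := (tau U).
Notation shifted := (shifted mu U).
Notation rr := (keep_prob mu U).
Notation config := (seq nat -> bool).

(** Restricted to a finite list so that only finitely many values occur; elsewhere the initial
    configuration stands in. *)
Definition attempt_env (B : seq (seq nat)) (eta : config) (w : O) : config :=
  fun e => if e \in B then env p mu eta U (tau w) e w else eta e.

Lemma tpr_nil eta w : attempt_env [::] eta w = eta.
Proof. by apply/funext => e. Qed.

Lemma tpr_cons e B eta w :
  attempt_env (e :: B) eta w = upd (attempt_env B eta w) e (env p mu eta U (tau w) e w).
Proof.
by apply/funext => x; rewrite /attempt_env /upd in_cons; case: eqP => [->|] //=.
Qed.

Lemma mtpr J B eta (G : config -> R) : J (inr (0%N, false)) ->
  (forall e k fl, e \in B -> J (inl (e, k, fl))) ->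
  measurable_fun (setT : set (subsigma U J)) (fun w => G (attempt_env B eta w)).
Proof.
move=> J0; elim: B G => [|e B IH] G JB.
  rewrite (_ : (fun w => _) = fun=> G eta); first exact: measurable_cst.
  by apply/funext => w; rewrite tpr_nil.
have JB' e' k fl : e' \in B -> J (inl (e', k, fl)) by move=> eB; apply: JB; rewrite in_cons eB orbT.
rewrite (_ : (fun w => _) = fun w => if env p mu eta U (tau w) e w
    then (fun z => G (upd z e true)) (attempt_env B eta w) else (fun z => G (upd z e false)) (attempt_env B eta w)).
  apply: measurable_fun_if => //.
  - by apply: mJ_env => // k fl; apply: JB; rewrite mem_head.
  - by apply: measurable_funTS; exact: (IH (fun z => G (upd z e true))).
  - by apply: measurable_funTS; exact: (IH (fun z => G (upd z e false))).
by apply/funext => w; rewrite tpr_cons; case: env.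
Qed.

Lemma mRx J B eta (G : config -> R) : J (inr (0%N, false)) ->
  measurable_fun (setT : set (subsigma U J)) (fun w => resample p (fun=> rr w) B G eta).
Proof.
move=> J0; elim: B eta => [|e B IH] eta /=; first exact: measurable_cst.
have mr : measurable_fun (setT : set (subsigma U J)) rr by exact: mJ_rr.
rewrite /resample1; apply: measurable_funD; first by apply: measurable_funM.
apply: measurable_funM; first by apply: measurable_funB.
by apply: measurable_funD; apply: measurable_funM.
Qed.

Lemma resample_ge0 B eta (G : config -> R) r : 0 <= r <= 1 -> (forall z, 0 <= G z) -> 0 <= resample p (fun=> r) B G eta.
Proof. by move=> r01 G0; apply: resample_ge_cst => // e _. Qed.

Definition Jw (i : dyn_index) : Prop := match i with inl _ => False | inr _ => True end.

Lemma qb_ge0 r b0 b : 0 <= r <= 1 -> 0 <= qb p r b0 b.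
Proof.
move: p01 => /andP[? ?] /andP[? ?]; rewrite /qb addr_ge0// mulr_ge0//; first lra.
by case: b; lra.
Qed.

(** Edges are exposed one by one. The box conditions of the head edge go to [EL_box], its state to
    [EL_env], and all the rest is a weight that does not read its variables. *)
Lemma expect_first_step_edges B eta sE a (Z : O -> R) (G : config -> R) :
  uniq B -> uniq sE -> (forall i, i \in sE -> exists e k fl, e \in B /\ i = inl (e, k, fl)) ->
  (forall i, 0 <= a i <= 1) ->
  measurable_fun (setT : set (subsigma U Jw)) Z -> (forall w, 0 <= Z w) -> (forall z, 0 <= G z) ->
  EQ (fun w => Z w * G (attempt_env B eta w) * (all (fun i => shifted i w <= a i) sE)%:R) =
  ((\prod_(i <- sE) a i)%:E * EQ (fun w => (Z w * resample p (fun=> rr w) B G eta)%R))%E.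
Proof.
elim: B sE Z G => [|e B IH] sE Z G.
  move=> _ _ sEB a01 mZ Z0 G0.
  have -> : sE = [::].
    case: sE sEB => // i s /(_ i (mem_head _ _)) [e [k [fl []]]] //.
  by rewrite big_nil mul1e; apply: eq_expect => w /=; rewrite tpr_nil mulr1.
rewrite cons_uniq => /andP[neB uB] usE sEB a01 mZ Z0 G0.
pose q (i : dyn_index) := if i is inl (e', _, _) then e' == e else false.
pose se := [seq x <- sE | q x]; pose sE' := [seq x <- sE | predC q x].
have see i : i \in se -> exists k fl, i = inl (e, k, fl).
  rewrite mem_filter => /andP[qi /sEB[e' [k [fl [_ ei]]]]]; exists k, fl.
  by move: qi; rewrite ei /= => /eqP->.
have sE'B i : i \in sE' -> exists e' k fl, e' \in B /\ i = inl (e', k, fl).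
  rewrite mem_filter => /andP[qi /sEB[e' [k [fl [eB ei]]]]]; exists e', k, fl.
  split => //; move: qi eB; rewrite ei /= in_cons => /negbTE->; exact.
have use : uniq se by exact: filter_uniq.
have usE' : uniq sE' by exact: filter_uniq.
pose Gb b z := G (upd z e b).
pose Zt b w := Z w * Gb b (attempt_env B eta w) * (all (fun i => shifted i w <= a i) sE')%:R.
have Zt0 b w : 0 <= Zt b w by rewrite !mulr_ge0// G0.
have mZt b : measurable_fun (setT : set (subsigma U (Je e))) (Zt b).
  apply: measurable_funM; [apply: measurable_funM|].
  - by apply: (mJ_mono (J := Jw)) => // -[].
  - by apply: mtpr => // e' k fl e'B; rewrite /Je => ee; rewrite -ee e'B in neB.
  - apply: measurable_nR; apply: measurable_all => i /sE'B[e' [k [fl [e'B ->]]]].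
    apply: measurable_fun_ler => //; apply: mJ_shU_e => // k' fl'.
    by rewrite /Je => ee; rewrite -ee e'B in neB.
have mZtO b := measurable_from_subsigma mU (mZt b).
have menvb b : measurable_fun setT (fun w => env p mu eta U (tau w) e w == b).
  have menv : measurable_fun setT (fun w => env p mu eta U (tau w) e w).
    by apply: (@measurable_from_subsigma R dO O dyn_index U (fun=> True)) => //; exact: mJ_env.
  case: b.
    by rewrite (_ : (fun w => _) = (fun w => env p mu eta U (tau w) e w))//; apply/funext => w; case: env.
  rewrite (_ : (fun w => _) = (fun w => ~~ env p mu eta U (tau w) e w)); first exact: measurable_neg.
  by apply/funext => w; case: env.
have mshU i : measurable_fun setT (shifted i).
  apply: (@measurable_from_subsigma R dO O dyn_index U (fun=> True)) => //.
  case: i => [[[e' k] fl]|[k fl]]; first exact: mJ_shU_e.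
  exact: measurable_coord.
have mterm b : measurable_fun setT (fun w => Zt b w * (env p mu eta U (tau w) e w == b)%:R * (all (fun i => shifted i w <= a i) se)%:R).
  apply: measurable_funM; first by apply: measurable_funM => //; exact: measurable_nR.
  by apply: measurable_nR; apply: measurable_all => i _; exact: measurable_fun_ler.
have tb b : EQ (fun w => Zt b w * (env p mu eta U (tau w) e w == b)%:R * (all (fun i => shifted i w <= a i) se)%:R) =
  ((\prod_(i <- sE) a i)%:E * EQ (fun w => (Z w * (qb p (rr w) (eta e) b * resample p (fun=> rr w) B (Gb b) eta))%R))%E.
  rewrite (EL_box p01 mu0 iU U01)//.
  rewrite (EL_env p01 mu0 iU U01)//.
  have mrr : measurable_fun (setT : set (subsigma U Jw)) rr by exact: mJ_rr.
  have := IH sE' (fun w => Z w * qb p (rr w) (eta e) b) (Gb b) uB usE' sE'B a01.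
  move=> h.
  have -> : EQ (fun w => Zt b w * qb p (rr w) (eta e) b) =
    EQ (fun w => Z w * qb p (rr w) (eta e) b * Gb b (attempt_env B eta w) * (all (fun i => shifted i w <= a i) sE')%:R).
    by apply: eq_expect => w; rewrite /Zt; ring.
  rewrite h.
  - rewrite muleA -EFinM; congr (_%:E * _)%E; last by apply: eq_expect => w; rewrite mulrA.
    by rewrite /se /sE' !big_filter [RHS](bigID q).
  - apply: measurable_funM => //; rewrite /qb; apply: measurable_funD; first by apply: measurable_funM.
    by apply: measurable_funM => //; apply: measurable_funB.
  - by move=> w; rewrite mulr_ge0// qb_ge0// (rr01 mu0 U01).
  - by move=> z; exact: G0.
rewrite (@eq_expect _ _ _ _ _ (fun w => (Zt true w * (env p mu eta U (tau w) e w == true)%:R * (all (fun i => shifted i w <= a i) se)%:R) +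
   (Zt false w * (env p mu eta U (tau w) e w == false)%:R * (all (fun i => shifted i w <= a i) se)%:R))); last first.
  move=> w; rewrite tpr_cons (all_filterC _ q) -/se -/sE' -mulnb natrM /Zt /Gb.
  by case: env => /=; ring.
have tn b w : 0 <= Zt b w * (env p mu eta U (tau w) e w == b)%:R * (all (fun i => shifted i w <= a i) se)%:R.
  by apply: mulr_ge0 => //; apply: mulr_ge0 => //; exact: Zt0.
rewrite (expectD Q (mterm true) (tn true) (mterm false) (tn false)).
have hRx b w : 0 <= resample p (fun=> rr w) B (Gb b) eta.
  by apply: resample_ge0; [exact: rr01|move=> z; exact: G0].
have mR b : measurable_fun setT (fun w => Z w * (qb p (rr w) (eta e) b * resample p (fun=> rr w) B (Gb b) eta)).
  apply: (@measurable_from_subsigma R dO O dyn_index U Jw) => //.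
  have mrr : measurable_fun (setT : set (subsigma U Jw)) rr by exact: mJ_rr.
  apply: measurable_funM => //; apply: measurable_funM; last exact: mRx.
  rewrite /qb; apply: measurable_funD; first by apply: measurable_funM.
  by apply: measurable_funM => //; apply: measurable_funB.
have n0 b w : 0 <= Z w * (qb p (rr w) (eta e) b * resample p (fun=> rr w) B (Gb b) eta).
  by rewrite !mulr_ge0// qb_ge0// (rr01 mu0 U01).
rewrite !tb -ge0_muleDr; [|exact: expect_ge0|exact: expect_ge0].
rewrite -expectD//; congr (_ * _)%E; apply: eq_expect => w /=.
by rewrite resample1_qb !resample_updl// mulrDr.
Qed.

End expect_first_step.

(** * Averages over the gap between two attempts *)

Section unif_mean.
Variables (R : realType) (p mu : R).
Hypothesis p01 : 0 <= p <= 1.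
Hypothesis mu0 : 0 < mu.

(** The keep probability [u ^ mu] over a gap [- ln u]; the cap makes it a probability for every real
    [u]. *)
Definition rf (u : R) : R := Num.min 1 (expR (mu * ln u)).

Lemma rf01 u : 0 <= rf u <= 1.
Proof. by rewrite le_min ler01 expR_ge0 ge_min lexx. Qed.

Lemma measurable_rf : measurable_fun setT rf.
Proof.
apply: measurable_minr => //; apply: (measurableT_comp (@measurable_expR R)).
by apply: measurable_funM => //; exact: measurable_ln.
Qed.

Definition unif_mean (f : R -> R) : R := \int[unif01 R]_u f (rf u).

Definition bmfun (f : R -> R) : Prop :=
  measurable_fun setT (fun u => f (rf u)) /\ exists C, forall u, `|f (rf u)| <= C.

Lemma lamT : unif01 R setT = 1%E. Proof. exact: probability_setT. Qed.

Lemma bmfun_int f : bmfun f -> (unif01 R).-integrable setT (EFin \o (fun u => f (rf u))).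
Proof.
move=> [mf [C hC]]; apply: measurable_bounded_integrable => //.
  by rewrite [X in (X < _)%E]lamT ltry.
exists C; split; first by rewrite num_real.
by move=> x Cx u _; apply: le_trans (hC u) _; exact: ltW.
Qed.

Lemma bmfun_cst c : bmfun (fun=> c).
Proof. by split; [exact: measurable_cst|exists `|c|]. Qed.

Lemma bmfun_id : bmfun (fun r => r).
Proof.
split; first exact: measurable_rf.
by exists 1 => u; have /andP[? ?] := rf01 u; rewrite ger0_norm.
Qed.

Lemma bmfunD f g : bmfun f -> bmfun g -> bmfun (fun r => f r + g r).
Proof.
move=> [mf [C hC]] [mg [D hD]]; split; first exact: measurable_funD.
by exists (C + D) => u; apply: le_trans (ler_normD _ _) _; exact: lerD.
Qed.

Lemma bmfunM f g : bmfun f -> bmfun g -> bmfun (fun r => f r * g r).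
Proof.
move=> [mf [C hC]] [mg [D hD]]; split; first exact: measurable_funM.
by exists (C * D) => u; rewrite normrM ler_pM.
Qed.

Lemma bmfunB f g : bmfun f -> bmfun g -> bmfun (fun r => f r - g r).
Proof.
move=> [mf [C hC]] [mg [D hD]]; split; first exact: measurable_funB.
by exists (C + D) => u; apply: le_trans (ler_normB _ _) _; exact: lerD.
Qed.

Lemma bmfun_min f g : bmfun f -> bmfun g -> bmfun (fun r => Num.min (f r) (g r)).
Proof.
move=> [mf [C hC]] [mg [D hD]]; split; first exact: measurable_minr.
exists (C + D) => u; have := hC u; have := hD u => h1 h2.
have C0 := le_trans (normr_ge0 _) h2; have D0 := le_trans (normr_ge0 _) h1.
by rewrite minEle; case: ifP => _; [apply: le_trans h2 _; rewrite lerDl|apply: le_trans h1 _; rewrite lerDr].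
Qed.

Lemma bmfun_sum (I : Type) (s : seq I) (F : I -> R -> R) :
  (forall i, bmfun (F i)) -> bmfun (fun r => \sum_(i <- s) F i r).
Proof.
move=> h; elim: s => [|i s IH].
  rewrite (_ : (fun r => _) = fun=> 0); first exact: bmfun_cst.
  by apply/funext => r; rewrite big_nil.
rewrite (_ : (fun r => _) = fun r => F i r + \sum_(j <- s) F j r); first exact: bmfunD.
by apply/funext => r; rewrite big_cons.
Qed.

Lemma bmfun_resample (E : eqType) (B : seq E) (c : E -> R) (G : (E -> bool) -> R) eta :
  bmfun (fun r => resample p (fun e => c e * r) B G eta).
Proof.
elim: B eta => [|e B IH] eta /=; first exact: bmfun_cst.
rewrite /resample1; apply: bmfunD; first by apply: bmfunM => //; apply: bmfunM; [exact: bmfun_cst|exact: bmfun_id].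
apply: bmfunM; first by apply: bmfunB; [exact: bmfun_cst|apply: bmfunM; [exact: bmfun_cst|exact: bmfun_id]].
by apply: bmfunD; (apply: bmfunM; [exact: bmfun_cst|exact: IH]).
Qed.

Lemma bmfun_resample1 (E : eqType) (B : seq E) (G : (E -> bool) -> R) eta :
  bmfun (fun r => resample p (fun=> r) B G eta).
Proof.
rewrite (_ : (fun r => _) = (fun r => resample p (fun=> 1 * r) B G eta)); first exact: bmfun_resample.
by apply/funext => r; rewrite mul1r.
Qed.

Lemma unif_mean_cst c : unif_mean (fun=> c) = c.
Proof.
rewrite /unif_mean Rintegral_cst//; have -> : fine (unif01 R setT) = 1 by exact: (congr1 fine lamT).
by rewrite mulr1.
Qed.

Lemma unif_meanD f g : bmfun f -> bmfun g -> unif_mean (fun r => f r + g r) = unif_mean f + unif_mean g.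
Proof. by move=> /bmfun_int bf /bmfun_int bg; rewrite /unif_mean RintegralD. Qed.

Lemma unif_meanB f g : bmfun f -> bmfun g -> unif_mean (fun r => f r - g r) = unif_mean f - unif_mean g.
Proof. by move=> /bmfun_int bf /bmfun_int bg; rewrite /unif_mean RintegralB. Qed.

Lemma unif_meanZ c f : bmfun f -> unif_mean (fun r => c * f r) = c * unif_mean f.
Proof. by move=> /bmfun_int bf; rewrite /unif_mean RintegralZl. Qed.

Lemma unif_mean_le f g : bmfun f -> bmfun g -> (forall r, 0 <= r <= 1 -> f r <= g r) -> unif_mean f <= unif_mean g.
Proof.
move=> /bmfun_int bf /bmfun_int bg h; rewrite /unif_mean le_Rintegral// => u _.
by apply: h; exact: rf01.
Qed.

Lemma unif_mean_le_cst f c : bmfun f -> (forall r, 0 <= r <= 1 -> f r <= c) -> unif_mean f <= c.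
Proof. by move=> bf h; rewrite -(unif_mean_cst c); apply: unif_mean_le => //; exact: bmfun_cst. Qed.

Lemma unif_mean_ge_cst f c : bmfun f -> (forall r, 0 <= r <= 1 -> c <= f r) -> c <= unif_mean f.
Proof. by move=> bf h; rewrite -(unif_mean_cst c); apply: unif_mean_le => //; exact: bmfun_cst. Qed.

Lemma unif_mean_sum (I : Type) (s : seq I) (F : I -> R -> R) : (forall i, bmfun (F i)) ->
  unif_mean (fun r => \sum_(i <- s) F i r) = \sum_(i <- s) unif_mean (F i).
Proof.
move=> h; elim: s => [|i s IH].
  rewrite big_nil (_ : (fun r => _) = fun=> 0) ?unif_mean_cst//.
  by apply/funext => r; rewrite big_nil.
rewrite big_cons -IH -unif_meanD//; last exact: bmfun_sum.
by congr unif_mean; apply/funext => r; rewrite big_cons.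
Qed.

Lemma unif_mean_norm_le f c : bmfun f -> (forall r, 0 <= r <= 1 -> `|f r| <= c) -> `|unif_mean f| <= c.
Proof.
move=> bf h; rewrite ler_norml; apply/andP; split.
  by apply: unif_mean_ge_cst => // r /h; rewrite ler_norml => /andP[].
by apply: unif_mean_le_cst => // r /h; rewrite ler_norml => /andP[].
Qed.

Lemma unif_mean_jensen f : bmfun f -> unif_mean f ^+ 2 <= unif_mean (fun r => f r ^+ 2).
Proof.
move=> bf; set c := unif_mean f.
have bf2 : bmfun (fun r => f r * f r) by exact: bmfunM.
have : 0 <= unif_mean (fun r => (f r * f r) - ((2 * c) * f r - c * c)).
  apply: unif_mean_ge_cst.
    by apply: bmfunB => //; apply: bmfunB; [apply: bmfunM => //|]; exact: bmfun_cst.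
  by move=> r _; have := sqr_ge0 (f r - c); rewrite !expr2; lra.
rewrite unif_meanB//; last by apply: bmfunB; [apply: bmfunM => //|]; exact: bmfun_cst.
rewrite unif_meanB; [|by apply: bmfunM => //; exact: bmfun_cst|exact: bmfun_cst].
rewrite unif_meanZ// unif_mean_cst -/c expr2; lra.
Qed.

End unif_mean.

(** * The first step: gap, chosen neighbour and shifted family jointly *)

Section STEP2.
Variables (R : realType) (dO : measure_display) (O : measurableType dO).
Variables (p mu : R) (d : nat).
Hypothesis p01 : 0 <= p <= 1.
Hypothesis mu0 : 0 < mu.
Hypothesis d0 : (0 < d)%N.
Variables (Q : {measure set O -> \bar R}) (U : dyn_index -> O -> R).
Hypothesis iU : iid_measure Q U.
Hypothesis U01 : forall i w, 0 < U i w <= 1.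
Let mU : forall i, measurable_fun setT (U i) := iU.2.1.
Notation EQ := (expect Q).
Notation tau := (tau U).
Notation shifted := (shifted mu U).
Notation rr := (keep_prob mu U).
Notation config := (seq nat -> bool).
Notation tpr := (attempt_env p mu U).
Let D : R := d%:R.
Let D0 : 0 < D. Proof. by rewrite ltr0n. Qed.

Lemma rr_rf w : rr w = rf mu (U (inr (0%N, false)) w).
Proof.
rewrite /rf /keep_prob tauE mulrN mulNr opprK; apply/esym/min_idPr.
rewrite -(expR0 R) ler_expR; apply: mulr_ge0_le0; first exact: ltW.
by apply: ln_le0; have /andP[] := U01 (inr (0%N, false)) w.
Qed.

Lemma choiceE k j w : (walk_choice d U k w == j) =
  (j%:R / D <= U (inr (k, true)) w) && (U (inr (k, true)) w < j.+1%:R / D).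
Proof.
rewrite /walk_choice truncn_eq ?ler_pdivrMr ?ltr_pdivlMr//; first by rewrite mulrC.
by rewrite mulr_ge0//; have /andP[/ltW] := U01 (inr (k, true)) w.
Qed.

Lemma unif01_choice j : (j < d)%N -> unif01 R [set u | (j%:R / D <= u) && (u < j.+1%:R / D)] = (D^-1)%:E.
Proof.
move=> jd.
have le1 (k : nat) : (k <= d)%N -> 0 <= k%:R / D <= 1.
  by move=> kd; rewrite divr_ge0//= ler_pdivrMr// mul1r ler_nat.
have mlt (y : R) : @measurable default_measure_display R [set u : R | u < y].
  rewrite (_ : [set u | _] = `]-oo, y[%classic); first exact: measurable_itv.
  by apply/seteqP; split => u; rewrite /= in_itv.
rewrite (_ : [set u | _] = [set u | u < j.+1%:R / D] `\` [set u | u < j%:R / D]); last first.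
  by apply/seteqP; split => u /=; rewrite leNgt; [move=> /andP[/negP ? ?]|move=> [? /negP->]].
rewrite measureD//; last by apply: le_lt_trans (probability_le1 _ _) (ltry _).
rewrite (_ : _ `&` _ = [set u | u < j%:R / D]).
  transitivity ((j.+1%:R / D)%:E - (j%:R / D)%:E)%E; last first.
    by rewrite -EFinB -mulrBl -natrB// subSnn mul1r.
  congr (_ - _)%E; first by rewrite -[X in X%:E](clamp_id (le1 _ jd)); exact: unif01_lt.
  by rewrite -[X in X%:E](clamp_id (le1 _ (ltnW jd))); exact: unif01_lt.
apply/seteqP; split => u /=; [by move=> []|move=> h; split => //].
by apply: lt_le_trans h _; rewrite ler_pM2r ?invr_gt0// ler_nat.
Qed.

Lemma mchoice (J : dyn_index -> Prop) k j : J (inr (k, true)) ->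
  measurable_fun (setT : set (subsigma U J)) (fun w => walk_choice d U k w == j).
Proof.
move=> Jk; rewrite (_ : (fun w => _) = (fun w => (j%:R / D <= U (inr (k, true)) w) && (U (inr (k, true)) w < j.+1%:R / D))).
  by apply: measurable_and; [apply: measurable_fun_ler|apply: measurable_fun_ltr] => //; exact: measurable_coord.
by apply/funext => w; exact: choiceE.
Qed.

Lemma expect_choice j : (j < d)%N -> EQ (fun w => (walk_choice d U 0 w == j)%:R) = ((D^-1)%:E * Q setT)%E.
Proof.
move=> jd.
rewrite (@eq_expect _ _ _ _ _ (fun w => 1 * \1_[set u | (j%:R / D <= u) && (u < j.+1%:R / D)] (U (inr (0%N, true)) w))); last first.
  move=> w; rewrite mul1r indicE choiceE.
  by case: (boolP (_ && _)) => h; [rewrite mem_set|rewrite memNset//=; exact/negP].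
rewrite (@expect_set R dO O dyn_index Q U iU (fun=> False) (inr (0%N, true)) _ D^-1 (fun=> 1)) //.
- rewrite (@eq_expect _ _ _ _ _ (fun w => D^-1 * 1)); last by move=> w; rewrite mulrC.
  rewrite expectZ//; last by rewrite invr_ge0 ltW.
  by rewrite /expect integral_cst// mul1e.
- rewrite (_ : [set u | _] = `[j%:R / D, j.+1%:R / D[%classic); first exact: measurable_itv.
  by apply/seteqP; split => u; rewrite /= in_itv.
- exact: unif01_choice.
Qed.

Definition shw (i : dyn_index) : dyn_index := match i with inr (k, fl) => inr (k.+1, fl) | x => x end.

(** Edges are correlated only through the common gap. Given the gap they are treated as independent;
    the gap is integrated out last, which produces [unif_mean]. *)
Lemma expect_first_step (B : seq (seq nat)) (eta : config) s a (G : config -> R) j :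
  uniq B -> uniq s -> (forall i, 0 <= a i <= 1) -> (forall z, 0 <= G z) -> (j < d)%N ->
  EQ (fun w => G (tpr B eta w) * (walk_choice d U 0 w == j)%:R * (all (fun i => shifted i w <= a i) s)%:R) =
  ((\prod_(i <- s) a i * (D^-1 * unif_mean mu (fun r => resample p (fun=> r) B G eta)))%:E * Q setT)%E.
Proof.
move=> uB us a01 G0 jd.
pose q (i : dyn_index) := if i is inl _ then true else false.
pose sE := [seq x <- s | q x]; pose sW := [seq x <- s | predC q x].
pose ed (i : dyn_index) : seq nat := if i is inl (e, _, _) then e else [::].
(* The edges that carry box conditions join [B]; [G2] puts the initial state back on those outside
   [B], so the weight is unchanged. *)
pose B2 := undup (B ++ map ed sE).
pose G2 z := G (fun e => if e \in B then z e else eta e).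
pose Z w : R := (walk_choice d U 0 w == j)%:R * (all (fun i => shifted i w <= a i) sW)%:R.
have Z0 w : 0 <= Z w by rewrite mulr_ge0.
have G20 z : 0 <= G2 z by exact: G0.
have sWE i : i \in sW -> exists k fl, i = inr (k, fl).
  by rewrite mem_filter /q; case: i => [//|[k fl] _]; exists k, fl.
have mZ : measurable_fun (setT : set (subsigma U Jw)) Z.
  apply: measurable_funM; first by apply: measurable_nR; exact: mchoice.
  apply: measurable_nR; apply: measurable_all => i /sWE[k [fl ->]].
  by apply: measurable_fun_ler => //; exact: measurable_coord.
have tprE w : G2 (tpr B2 eta w) = G (tpr B eta w).
  congr G; apply/funext => e; rewrite /attempt_env mem_undup mem_cat.
  by case: (e \in B).
transitivity (EQ (fun w => Z w * G2 (tpr B2 eta w) * (all (fun i => shifted i w <= a i) sE)%:R)).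
  by apply: eq_expect => w; rewrite (all_filterC _ q) -/sE -/sW -mulnb natrM /Z tprE; ring.
have uB2 : uniq B2 by exact: undup_uniq.
rewrite (expect_first_step_edges p01 mu0 iU U01)//; last 2 first.
- exact: filter_uniq.
- move=> i isE; move: (isE); rewrite mem_filter /q; case: i isE => [[[e k] fl] isE _|//].
  exists e, k, fl; split => //; rewrite mem_undup mem_cat; apply/orP; right.
  by apply/mapP; exists (inl (e, k, fl)).
have RxE r : resample p (fun=> r) B2 G2 eta = resample p (fun=> r) B G eta.
  rewrite (@resample_sub _ _ p (fun=> r) B2 B)//.
  - apply: (@resample_ext_off _ _ p (mem B)) => // z hz; congr G; apply/funext => e.
    by case: ifPn => // /hz.
  - move=> z z' hz; rewrite /G2; congr G; apply/funext => e.
    by case: ifP => // /hz.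
  - by move=> e eB; rewrite mem_undup mem_cat eB.
pose H u := resample p (fun=> rf mu u) B G eta.
have bH : bmfun mu (fun r => resample p (fun=> r) B G eta) by exact: bmfun_resample1.
have H0 u : 0 <= H u by apply: (resample_ge_cst p01) => // e _; exact: rf01.
rewrite (@eq_expect _ _ _ _ _ (fun w => Z w * H (U (inr (0%N, false)) w))); last first.
  by move=> w; rewrite RxE rr_rf.
pose c := unif_mean mu (fun r => resample p (fun=> r) B G eta).
have c0 : 0 <= c by apply: unif_mean_ge_cst => // r r01; apply: (resample_ge_cst p01) => // e _.
pose J0 (i : dyn_index) : Prop := match i with inr (0%N, false) => False | inr _ => True | inl _ => False end.
have mZ0 : measurable_fun (setT : set (subsigma U J0)) Z.
  apply: measurable_funM; first by apply: measurable_nR; exact: mchoice.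
  apply: measurable_nR; apply: measurable_all => i /sWE[k [fl ->]].
  by apply: measurable_fun_ler => //; exact: measurable_coord.
have mZO := measurable_from_subsigma mU mZ.
rewrite (@expect_fubini R dO O dyn_index Q U iU J0 (inr (0%N, false)) (fun w u => Z w * H u) _ _ _ (fun w => Z w * c)) //; last 3 first.
- apply: measurable_funM; first by apply: (measurableT_comp mZ0); exact: measurable_fst.
  by apply: (measurableT_comp bH.1); exact: measurable_snd.
- by move=> w u; rewrite mulr_ge0.
- move=> w; under eq_integral do rewrite EFinM.
  rewrite ge0_integralZl_EFin//.
  + rewrite [RHS]EFinM; congr (_ * _)%E; rewrite fineK//.
    exact: (integrable_fin_num measurableT (bmfun_int bH)).
  + by move=> u _; rewrite lee_fin.
  + by apply/measurable_EFinP; exact: bH.1.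
rewrite (@eq_expect _ _ _ _ _ (fun w => c * Z w)); last by move=> w; rewrite mulrC.
rewrite expectZ//.
have -> : EQ Z = ((\prod_(i <- sW) a i)%:E * ((D^-1)%:E * Q setT))%E.
  rewrite -(expect_choice jd).
  rewrite -(@expect_list R dO O dyn_index Q U iU (fun i => i = inr (0%N, true)) dyn_index shw sW a).
  - apply: eq_expect => w; rewrite /Z; congr (_ * (nat_of_bool _)%:R); apply: eq_in_all => i /sWE[k [fl ->]] //.
  - rewrite map_inj_in_uniq ?filter_uniq// => i i' /sWE[k [fl ->]] /sWE[k' [fl' ->]] /=.
    by move=> [-> ->].
  - by move=> i /sWE[k [fl ->]].
  - by [].
  - by apply: measurable_nR; exact: mchoice.
  - by [].
rewrite !muleA -!EFinM; congr (_%:E * _)%E.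
have -> : \prod_(i <- s) a i = \prod_(i <- sE) a i * \prod_(i <- sW) a i.
  by rewrite /sE /sW !big_filter [LHS](bigID q).
by rewrite -/c; ring.
Qed.

End STEP2.

(** * Weights of trajectories *)

Section restr.
Variables (R : realType) (dO : measure_display) (O : measurableType dO).
Implicit Type Q : {measure set O -> \bar R}.

Lemma expect_ind Q (b : O -> bool) : measurable_fun setT b ->
  expect Q (fun w => (b w)%:R) = Q [set w | b w].
Proof.
move=> mb; have mS : measurable [set w | b w].
  by have := mb measurableT [set true] Logic.I; rewrite setTI.
transitivity (\int[Q]_w (\1_[set w | b w] w)%:E)%E.
  apply: eq_integral => w _; rewrite indicE.
  by case: (boolP (b w)) => h; [rewrite mem_set|rewrite memNset//=; exact/negP].
by rewrite integral_indic// setIT.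
Qed.

Lemma expect_mrestr Q E (mE : measurable E) (f : O -> R) : measurable_fun setT f -> (forall w, 0 <= f w) ->
  expect (mrestr Q mE) f = expect Q (fun w => f w * \1_E w).
Proof.
move=> mf f0; have mfE : measurable_fun setT (fun w => (f w)%:E) by exact/measurable_EFinP.
rewrite /expect (@ge0_negligible_integral _ _ _ _ _ (~` E)) //.
- rewrite setTD setCK (eq_measure_integral Q); last first.
    by move=> A mA AE; rewrite /= /mrestr setIidl.
  rewrite integral_mkcond; apply: eq_integral => w _.
  rewrite /patch indicE; case: (w \in E); by rewrite ?mulr1 ?mulr0.
- exact: measurableC.
- by move=> w _; rewrite lee_fin.
- by rewrite /= /mrestr setICl measure0.
Qed.

End restr.

Section expect_path_weight.
Variables (R : realType) (dO : measure_display) (O : measurableType dO).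
Variables (p mu : R) (d : nat).
Hypothesis p01 : 0 <= p <= 1.
Hypothesis mu0 : 0 < mu.
Hypothesis d0 : (0 < d)%N.
Notation config := (seq nat -> bool).
Variable B : seq (seq nat).
Hypothesis uB : uniq B.
Variable mv : seq nat -> config -> nat -> seq nat.
Variable phi : seq nat -> config -> seq nat -> R.
Variable psi : seq nat -> R.
Hypothesis phi0 : forall x z y, 0 <= phi x z y.
Hypothesis psi0 : forall x, 0 <= psi x.

(** A multiplicative functional of the first [n] attempts: a factor [phi] for each step and [psi] at
    the end. The recursion restarts from the shifted family at the environment found at the
    attempt. *)
Fixpoint path_weight (n : nat) (x : seq nat) (eta : config) (U : dyn_index -> O -> R) (w : O) : R :=
  if n is n'.+1 then
    let z := attempt_env p mu U B eta w in
    let y := mv x z (walk_choice d U 0 w) in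
    phi x z y * path_weight n' y z (shifted mu U) w
  else psi x.

(** The candidate for the expectation of [path_weight]; the only trace of [mu] is the law of the
    keep probability [r]. *)
Fixpoint mean_weight (n : nat) (x : seq nat) (eta : config) : R :=
  if n is n'.+1 then
    unif_mean mu (fun r => resample p (fun=> r) B
      (fun z => d%:R^-1 * \sum_(j < d) (phi x z (mv x z j) * mean_weight n' (mv x z j) z)) eta)
  else psi x.

Lemma path_weight_ge0 n x eta U w : 0 <= path_weight n x eta U w.
Proof. by elim: n x eta U => //= n IH x eta U; rewrite mulr_ge0. Qed.

Lemma mean_weight_ge0 n x eta : 0 <= mean_weight n x eta.
Proof.
elim: n x eta => //= n IH x eta; apply: unif_mean_ge_cst => //; first exact: bmfun_resample1.
move=> r r01; apply: (resample_ge_cst p01) => [e _ //|z].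
by rewrite mulr_ge0 ?invr_ge0//; apply: sumr_ge0 => j _; rewrite mulr_ge0.
Qed.

Definition conf (eta : config) (pi : seq bool) : config :=
  fun e => if e \in B then nth false pi (index e B) else eta e.

Lemma tpr_conf eta (U : dyn_index -> O -> R) w : attempt_env p mu U B eta w = conf eta (map (attempt_env p mu U B eta w) B).
Proof.
apply/funext => e; rewrite /conf; case: ifPn => eB; last by rewrite /attempt_env (negbTE eB).
by rewrite (nth_map [::]) ?index_mem// nth_index.
Qed.

Notation tup := ((size B).-tuple bool).
Implicit Types (U : dyn_index -> O -> R) (w : O).

Lemma pat_size eta U w : size (map (attempt_env p mu U B eta w) B) == size B.
Proof. by rewrite size_map. Qed.

Lemma sum_pat eta U w (F : seq bool -> R) :
  F (map (attempt_env p mu U B eta w) B) = \sum_(pi : tup) (map (attempt_env p mu U B eta w) B == pi)%:R * F pi.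
Proof.
rewrite (bigD1 (Tuple (pat_size eta U w)))//= eqxx mul1r big1 ?addr0// => pi.
by rewrite -val_eqE /= eq_sym => /negbTE->; rewrite mul0r.
Qed.

Section U.
Variable (U : dyn_index -> O -> R).
Hypothesis mU : forall i, measurable_fun setT (U i).
Hypothesis U01 : forall i w, 0 < U i w <= 1.

Lemma mshU i : measurable_fun setT (shifted mu U i).
Proof.
apply: (@measurable_from_subsigma R dO O dyn_index U (fun=> True)) => //.
case: i => [[[e' k] fl]|[k fl]]; first exact: mJ_shU_e.
exact: measurable_coord.
Qed.

(** The value [d] is attained when the uniform variable equals 1; sums over the choice therefore
    include [d], and that term is shown to be null. *)
Lemma choice_le w : (walk_choice d U 0 w < d.+1)%N.
Proof.
rewrite ltnS /walk_choice -(ler_nat R).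
have /andP[u0 u1] := U01 (inr (0%N, true)) w.
apply: (@le_trans _ _ (d%:R * U (inr (0%N, true)) w)).
  by rewrite truncn_le mulr_ge0// ltW.
by rewrite ler_piMr.
Qed.

Definition Eb eta (pi : seq bool) (j : nat) (w : O) : bool :=
  (map (attempt_env p mu U B eta w) B == pi) && (walk_choice d U 0 w == j).

Lemma mEb eta pi j : measurable_fun setT (Eb eta pi j).
Proof.
apply: (@measurable_from_subsigma R dO O dyn_index U (fun=> True)) => //.
apply: measurable_and; last exact: mchoice.
have := @mtpr R dO O p mu mu0 U U01 (fun=> True) B eta (fun z => (map z B == pi)%:R : R) Logic.I (fun _ _ _ _ => Logic.I).
move=> h.
rewrite (_ : (fun w => _) = (fun w => 0 < ((map (attempt_env p mu U B eta w) B == pi)%:R : R))).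
  exact: measurable_fun_ltr.
by apply/funext => w; case: (_ == _); rewrite ?ltr01 ?ltxx.
Qed.

Lemma path_weight_split n x eta w : path_weight n.+1 x eta U w =
  \sum_(j < d.+1) \sum_(pi : tup) (phi x (conf eta pi) (mv x (conf eta pi) j) *
    (path_weight n (mv x (conf eta pi) j) (conf eta pi) (shifted mu U) w * (Eb eta pi j w)%:R)).
Proof.
rewrite (bigD1 (Ordinal (choice_le w)))//= [X in _ + X]big1 ?addr0; last first.
  move=> j; rewrite -val_eqE /= eq_sym => /negbTE nj; apply: big1 => pi _.
  by rewrite /Eb nj andbF !mulr0.
pose F pi := phi x (conf eta pi) (mv x (conf eta pi) (walk_choice d U 0 w)) *
    path_weight n (mv x (conf eta pi) (walk_choice d U 0 w)) (conf eta pi) (shifted mu U) w.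
transitivity (F (map (attempt_env p mu U B eta w) B)); first by rewrite /F -tpr_conf.
rewrite sum_pat; apply: eq_bigr => pi _.
by rewrite /Eb eqxx andbT /F; ring.
Qed.

End U.

Lemma measurable_path_weight n : forall U, (forall i, measurable_fun setT (U i)) -> (forall i w, 0 < U i w <= 1) ->
  forall x eta, measurable_fun setT (path_weight n x eta U).
Proof.
elim: n => [|n IH] U mU U01 x eta; first exact: measurable_cst.
rewrite (_ : path_weight n.+1 x eta U = fun w => \sum_(j < d.+1) \sum_(pi : tup) (phi x (conf eta pi) (mv x (conf eta pi) j) *
    (path_weight n (mv x (conf eta pi) j) (conf eta pi) (shifted mu U) w * (Eb U eta pi j w)%:R))); last first.
  by apply/funext => w; exact: path_weight_split.
apply: measurable_sum => j; apply: measurable_sum => pi.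
apply: measurable_funM => //; apply: measurable_funM.
  by apply: IH; [exact: mshU|move=> i w; exact: shU01].
by apply: measurable_nR; exact: mEb.
Qed.

Lemma expect_sum (Q : {measure set O -> \bar R}) (I : Type) (s : seq I) (F : I -> O -> R) :
  (forall i, measurable_fun setT (F i)) -> (forall i w, 0 <= F i w) ->
  expect Q (fun w => \sum_(i <- s) F i w) = (\sum_(i <- s) expect Q (F i))%E.
Proof.
move=> mF F0; rewrite -ge0_integral_sum//.
- by apply: eq_integral => w _; rewrite sumEFin.
- by move=> i; exact/measurable_EFinP.
- by move=> i w _; rewrite lee_fin.
Qed.

Lemma expect_mul (Q : {measure set O -> \bar R}) (c : R) (f : O -> R) : 0 <= c -> measurable_fun setT f ->
  (forall w, 0 <= f w) -> expect Q (fun w => c * f w) = (c%:E * expect Q f)%E.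
Proof. exact: expectZ. Qed.

(** The induction is over all measures at once. Restricting [Q] to the event that fixes the states
    on [B] and the chosen neighbour keeps the shifted family iid, so the induction hypothesis
    applies to each restriction, and there are finitely many of them. *)
Lemma expect_path_weight n : forall (Q : {measure set O -> \bar R}) U, iid_measure Q U -> (forall i w, 0 < U i w <= 1) ->
  forall x eta, expect Q (path_weight n x eta U) = ((mean_weight n x eta)%:E * Q setT)%E.
Proof.
elim: n => [|n IH] Q U iU U01 x eta.
  by rewrite /= /expect integral_cst.
have mU := iU.2.1.
have ms := mshU mU U01.
have s01 i w : 0 < shifted mu U i w <= 1 by exact: shU01.
pose Es pi j : set O := [set w | Eb U eta pi j w].
have mEs pi j : measurable (Es pi j).
  by have := mEb mU U01 eta pi j measurableT (Y := [set true]) Logic.I; rewrite setTI.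
have QEs pi j : Q (Es pi j) = expect Q (fun w => (Eb U eta pi j w)%:R).
  by rewrite expect_ind//; exact: mEb.
have Gpi0 (pi : seq bool) (z : config) : 0 <= ((map z B == pi)%:R : R) by [].
have boxE pi j s a : (j < d)%N -> uniq s -> (forall i, 0 <= a i <= 1) ->
    Q (box (shifted mu U) s a `&` Es pi j) =
    ((\prod_(i <- s) a i * (d%:R^-1 * unif_mean mu (fun r => resample p (fun=> r) B (fun z => (map z B == pi)%:R) eta)))%:E * Q setT)%E.
  move=> jd us a01.
  rewrite -(@expect_first_step R dO O p mu d p01 mu0 d0 Q U iU U01 B eta s a (fun z => (map z B == pi)%:R) j)//.
  rewrite (@eq_expect _ _ _ _ _ (fun w => (Eb U eta pi j w && all (fun i => shifted mu U i w <= a i) s)%:R)); last first.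
    by move=> w; rewrite /Eb -!mulnb !natrM.
  rewrite expect_ind; last first.
    by apply: measurable_and; [exact: mEb|apply: measurable_all => i _; exact: measurable_fun_ler].
  congr (Q _); apply/seteqP; split => w /=.
    by move=> [h1 h2]; apply/andP; split => //; apply/allP.
  by move=> /andP[h1 /allP h2].
have null pi j : ~~ (j < d)%N -> Q (Es pi j) = 0%E.
  rewrite -leqNgt => dj; apply/eqP; rewrite eq_le measure_ge0 andbT.
  have <- : Q [set w | 1 <= U (inr (0%N, true)) w] = 0%E.
    rewrite -[X in Q X]setTI (@indep_law R dO O dyn_index Q U (fun=> False) iU (inr (0%N, true)) setT [set u | 1 <= u]) //.
    - by rewrite unif01_ge clamp_id ?ler01 ?lexx// subrr mule0.
    - exact: (@measurableT _ (subsigma U (fun=> False))).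
    - rewrite (_ : [set u | _] = `[1, +oo[%classic); first exact: measurable_itv.
      by apply/seteqP; split => u; rewrite /= in_itv/= andbT.
  apply: le_measure; rewrite ?inE//.
    rewrite -[X in measurable X]setTI (_ : [set w | _] = U (inr (0%N, true)) @^-1` `[1, +oo[%classic).
      exact: mU.
    by apply/seteqP; split => u; rewrite /= in_itv/= andbT.
  move=> w /andP[_]; rewrite (choiceE d0 U01) => /andP[h _]; apply: le_trans h.
  by rewrite ler_pdivlMr ?ltr0n// mul1r ler_nat.
have iQ' pi j : iid_measure (mrestr Q (mEs pi j)) (shifted mu U).
  have E0 : mrestr Q (mEs pi j) setT = Q (Es pi j) by rewrite /mrestr setTI.
  split; first by rewrite [X in X \is a _]E0 (iid_measure_fin iU).
  split => // s a us a01; rewrite [X in (X * _)%E]E0 /= /mrestr.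
  have [jd|nj] := boolP (j < d)%N.
    have := boxE pi j [::] a jd isT a01; rewrite box_nil setTI big_nil mul1r => ->.
    by rewrite boxE// EFinM -muleA muleC.
  rewrite null// mul0e; apply/eqP; rewrite eq_le measure_ge0 andbT -(null pi j nj).
  by apply: le_measure; rewrite ?inE//; apply: measurableI => //; apply: measurable_box.
have termE pi j : expect Q (fun w => phi x (conf eta pi) (mv x (conf eta pi) j) *
    (path_weight n (mv x (conf eta pi) j) (conf eta pi) (shifted mu U) w * (Eb U eta pi j w)%:R)) =
    ((phi x (conf eta pi) (mv x (conf eta pi) j) * mean_weight n (mv x (conf eta pi) j) (conf eta pi))%:E * Q (Es pi j))%E.
  rewrite expect_mul//; last 2 first.
  - apply: measurable_funM; first exact: measurable_path_weight.
    by apply: measurable_nR; exact: mEb.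
  - by move=> w; rewrite mulr_ge0// path_weight_ge0.
  rewrite EFinM -muleA; congr (_ * _)%E.
  have := IH (mrestr Q (mEs pi j)) (shifted mu U) (iQ' pi j) s01 (mv x (conf eta pi) j) (conf eta pi).
  rewrite expect_mrestr; [|exact: measurable_path_weight|by move=> w; exact: path_weight_ge0].
  rewrite [X in _ = (_ * X)%E -> _](_ : _ = Q (Es pi j)); last by rewrite /= /mrestr setTI.
  move=> <-; apply: eq_expect => w; congr (_ * _).
  by rewrite indicE; case: (boolP (Eb U eta pi j w)) => h; [rewrite mem_set|rewrite memNset//=; exact/negP].
rewrite (eq_expect _ (path_weight_split U01 n x eta)) expect_sum; last 2 first.
- move=> j; apply: measurable_sum => pi; apply: measurable_funM => //; apply: measurable_funM.
    exact: measurable_path_weight.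
  by apply: measurable_nR; exact: mEb.
- by move=> j w; apply: sumr_ge0 => pi _; rewrite !mulr_ge0// path_weight_ge0.
have HjE (j : 'I_d.+1) : expect Q (fun w => \sum_(pi : tup) (phi x (conf eta pi) (mv x (conf eta pi) j) *
    (path_weight n (mv x (conf eta pi) j) (conf eta pi) (shifted mu U) w * (Eb U eta pi j w)%:R))) =
    expect Q (fun w => phi x (attempt_env p mu U B eta w) (mv x (attempt_env p mu U B eta w) j) * mean_weight n (mv x (attempt_env p mu U B eta w) j) (attempt_env p mu U B eta w) *
     (walk_choice d U 0 w == j)%:R).
  rewrite expect_sum; last 2 first.
  - move=> pi; apply: measurable_funM => //; apply: measurable_funM; first exact: measurable_path_weight.
    by apply: measurable_nR; exact: mEb.
  - by move=> pi w; rewrite !mulr_ge0// path_weight_ge0.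
  under eq_bigr do rewrite termE QEs.
  transitivity (expect Q (fun w => \sum_(pi : tup) (phi x (conf eta pi) (mv x (conf eta pi) j) * mean_weight n (mv x (conf eta pi) j) (conf eta pi)) * (Eb U eta pi j w)%:R)).
    rewrite expect_sum.
    - apply: eq_bigr => pi _; rewrite expect_mul//.
      + by rewrite mulr_ge0// mean_weight_ge0.
      + by apply: measurable_nR; exact: mEb.
    - by move=> pi; apply: measurable_funM => //; apply: measurable_nR; exact: mEb.
    - by move=> pi w; rewrite !mulr_ge0// mean_weight_ge0.
  apply: eq_expect => w.
  pose F pi := phi x (conf eta pi) (mv x (conf eta pi) j) * mean_weight n (mv x (conf eta pi) j) (conf eta pi) * (walk_choice d U 0 w == j)%:R.
  transitivity (F (map (attempt_env p mu U B eta w) B)); last by rewrite /F -tpr_conf.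
  rewrite sum_pat; apply: eq_bigr => pi _.
  by rewrite /F /Eb -mulnb natrM; ring.
rewrite (eq_bigr _ (fun j _ => HjE j)) big_ord_recr /=.
have -> : expect Q (fun w => phi x (attempt_env p mu U B eta w) (mv x (attempt_env p mu U B eta w) d) * mean_weight n (mv x (attempt_env p mu U B eta w) d) (attempt_env p mu U B eta w) *
     (walk_choice d U 0 w == d)%:R) = 0%E.
  rewrite -(HjE ord_max) expect_sum; last 2 first.
  - move=> pi; apply: measurable_funM => //; apply: measurable_funM; first exact: measurable_path_weight.
    by apply: measurable_nR; exact: mEb.
  - by move=> pi w; rewrite !mulr_ge0// path_weight_ge0.
  by rewrite big1// => pi _; rewrite termE null ?mule0//= ltnn.
rewrite adde0.
pose H (j : nat) (z : config) := phi x z (mv x z j) * mean_weight n (mv x z j) z.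
have H0 j z : 0 <= H j z by rewrite mulr_ge0// mean_weight_ge0.
rewrite (eq_bigr (fun j : 'I_d => ((d%:R^-1 * unif_mean mu (fun r => resample p (fun=> r) B (H j) eta))%:E * Q setT)%E)); last first.
  move=> j _; have := @expect_first_step R dO O p mu d p01 mu0 d0 Q U iU U01 B eta [::] (fun=> 1) (H j) j uB isT
    (fun _ => introT andP (conj ler01 (lexx 1))) (H0 j) (ltn_ord j).
  rewrite big_nil mul1r => <-; apply: eq_expect => w /=; by rewrite mulr1.
rewrite -ge0_sume_distrl; last first.
  move=> j _; rewrite lee_fin mulr_ge0 ?invr_ge0//; apply: unif_mean_ge_cst => //; first exact: bmfun_resample1.
  by move=> r r01; apply: (resample_ge_cst p01) => [e _ //|z].
congr (_ * _)%E; rewrite sumEFin; congr EFin; rewrite -mulr_sumr.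
rewrite -unif_mean_sum//; last by move=> j; exact: bmfun_resample1.
rewrite -unif_meanZ//; last by apply: bmfun_sum => j; exact: bmfun_resample1.
by congr (unif_mean _ _); apply/funext => r; rewrite resampleZ resample_sum.
Qed.

End expect_path_weight.

(** * Letters and words on the regular tree *)

Section tree_words.
Local Open Scope nat_scope.

(* Every vertex of T_d has one incident edge for each letter [s < d], both ends of an edge
   giving it the same letter, so that crossing the edge of letter [s] is an involution.
   [lastlet v] is the letter of the edge to the parent of [v]. *)
Definition lastlet (v : seq nat) : nat := if v is a :: s then foldl bump a s else 0.
Definition parent (v : seq nat) := take (size v).-1 v.
Definition act (v : seq nat) (s : nat) : seq nat :=
  if v == [::] then [:: s] else
  if s == lastlet v then parent v else rcons v (unbump (lastlet v) s).

Lemma lastlet_rcons u a : lastlet (rcons u a) = if u == [::] then a else bump (lastlet u) a.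
Proof. by case: u => [|b u] //=; rewrite foldl_rcons. Qed.

Lemma parent_rcons u a : parent (rcons u a) = u.
Proof. by rewrite /parent size_rcons /= -cats1 take_size_cat. Qed.

Lemma act_parent v : v != [::] -> act v (lastlet v) = parent v.
Proof. by rewrite /act => /negbTE->; rewrite eqxx. Qed.

Lemma act_child v s : (v == [::]) || (s != lastlet v) ->
  act v s = rcons v (if v == [::] then s else unbump (lastlet v) s).
Proof. by rewrite /act; case: eqP => [->|_] //= /negbTE->. Qed.

Lemma lastlet_child v s : (v == [::]) || (s != lastlet v) -> lastlet (act v s) = s.
Proof.
move=> h; rewrite act_child// lastlet_rcons; move: h; case: eqP => //= _ h.
by rewrite unbumpK// inE.
Qed.

Lemma rcons_nnil (v : seq nat) a : (rcons v a == [::]) = false.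
Proof. by case: v. Qed.

Lemma act_invol v s : act (act v s) s = v.
Proof.
have [h|] := boolP ((v == [::]) || (s != lastlet v)).
  rewrite -{2}(lastlet_child h) act_parent; first by rewrite act_child// parent_rcons.
  by rewrite act_child// rcons_nnil.
rewrite negb_or negbK => /andP[v0 /eqP->]; rewrite act_parent//.
elim/last_ind: v v0 => // u a _ _; rewrite parent_rcons act_child.
  rewrite lastlet_rcons; case: eqP => // _; by rewrite bumpK.
rewrite lastlet_rcons; case: eqP => //= _; by rewrite eq_sym neq_bump.
Qed.

Lemma edge_act v s : edge_of (act v s) v = edge_of v (act v s).
Proof.
have H u a : edge_of (rcons u a) u = edge_of u (rcons u a).
  by rewrite /edge_of size_rcons ltnS leqnn; case: ifP => //; rewrite ltnNge leqnSn.
have [h|] := boolP ((v == [::]) || (s != lastlet v)).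
  by rewrite act_child// H.
rewrite negb_or negbK => /andP[v0 /eqP->]; rewrite act_parent//.
by elim/last_ind: v v0 => // u a _ _; rewrite parent_rcons H.
Qed.

Lemma edge_child v a : edge_of v (rcons v a) = rcons v a.
Proof. by rewrite /edge_of size_rcons ltnS leqnn. Qed.

Lemma edge_parent v : v != [::] -> edge_of v (parent v) = v.
Proof.
elim/last_ind: v => // u a _ _; rewrite parent_rcons /edge_of size_rcons.
by rewrite ltnNge leqnSn.
Qed.

Lemma size_act v s : size (act v s) <= (size v).+1.
Proof.
rewrite /act; case: ifP => // _; case: ifP => _; last by rewrite size_rcons.
by rewrite size_take; case: ifP => _; rewrite ?leqnSn// (leq_trans (leq_pred _)).
Qed.

Section letters.
Variable d : nat.
Hypothesis d0 : 0 < d.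

Lemma valid_rcons v a : v != [::] -> valid_Td d (rcons v a) = valid_Td d v && (a < d.-1).
Proof. by case: v => // b s _ /=; rewrite all_rcons; case: (b < d) => //=; rewrite andbC. Qed.

Lemma valid_lastlet v : valid_Td d v -> lastlet v < d.
Proof.
elim/last_ind: v => // v a _; rewrite lastlet_rcons; case: eqP => [->|/eqP v0].
  by rewrite /= andbT.
rewrite valid_rcons// => /andP[_ h]; apply: leq_ltn_trans (_ : bump (lastlet v) a <= a.+1) _.
  by rewrite /bump -[a.+1]add1n leq_add2r leq_b1.
by rewrite -ltn_predRL.
Qed.

Lemma valid_parent v : valid_Td d v -> valid_Td d (parent v).
Proof.
elim/last_ind: v => // v a _; rewrite parent_rcons.
by case: v => // b s; rewrite valid_rcons// => /andP[].
Qed.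

Lemma valid_act v s : s < d -> valid_Td d v -> valid_Td d (act v s).
Proof.
move=> sd vv; rewrite /act; case: ifPn => [_|v0]; first by rewrite /= sd.
case: ifPn => [_|sl]; first exact: valid_parent.
rewrite valid_rcons// vv /= /unbump; have := valid_lastlet vv.
move=> hl; move: sl => /eqP sl; case: (ltnP (lastlet v) s) => h /=; lia.
Qed.

Lemma nbr_child v a : v != [::] -> a.+1 < d -> nbr d v a.+1 = rcons v a.
Proof. by move=> v0 ad; rewrite /nbr [d <= _]leqNgt ad /=; case: v v0. Qed.

Lemma nbr_parent v : v != [::] -> nbr d v 0 = parent v.
Proof. by move=> v0; rewrite /nbr [d <= _]leqNgt d0 /=; case: v v0. Qed.

Lemma nbr_root a : a < d -> nbr d [::] a = [:: a].
Proof. by move=> ad; rewrite /nbr [d <= _]leqNgt ad. Qed.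
End letters.

(** Away from the root, neighbour 0 is the letter of the parent and the neighbours [j + 1] enumerate
    the remaining letters through [bump]. *)
Lemma sum_nbr (V : nmodType) d (v : seq nat) (G : seq nat -> V) : 0 < d -> valid_Td d v ->
  (\sum_(j < d) G (nbr d v j) = \sum_(s < d) G (act v s))%R.
Proof.
case: d => // d _ vv.
have [v0|v0] := eqVneq v [::].
  by apply: eq_bigr => j _; rewrite v0 nbr_root.
rewrite big_ord_recl (bigD1_ord (Ordinal (valid_lastlet (ltn0Sn d) vv)))//= act_parent// nbr_parent//.
congr (_ + _)%R; apply: eq_bigr => j _; rewrite /bump /= add1n nbr_child//; last by rewrite ltnS.
rewrite act_child; first by rewrite (negbTE v0) bumpK.
by rewrite /= -/(bump (lastlet v) j) [_ == lastlet v]eq_sym neq_bump orbT.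
Qed.

(* Edges seen from the walker are labelled by reduced words of letters; [relabel s] is the effect of a step along [s] on these labels. *)
Definition relabel (s : nat) (w : seq nat) : seq nat :=
  match w with
  | [::] => [::]
  | a :: w' => if a != s then s :: w else
      match w' with [::] => w | b :: _ => if b == s then w else w' end
  end.

Definition red (w : seq nat) := (w != [::]) && sorted (fun a b => a != b) w.

Lemma relabel_invol s w : relabel s (relabel s w) = w.
Proof.
case: w => // a w /=; case: ifPn => [as_ /=|]; first by rewrite eqxx /= (negbTE as_).
rewrite negbK => /eqP ->; case: w => [|b w] /=; first by rewrite eqxx.
case: ifPn => [/eqP ->|bs] /=; first by rewrite !eqxx.
by rewrite bs.
Qed.

Lemma relabel_single s : relabel s [:: s] = [:: s].
Proof. by rewrite /= eqxx. Qed.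

Lemma red_psi s w : red w -> red (relabel s w).
Proof.
case: w => // a w; rewrite /red /= => h; case: ifPn => [as_ /=|]; first by rewrite eq_sym as_ h.
rewrite negbK => /eqP ea; case: w h => [|b w] //= /andP[ab h]; case: ifPn => [/eqP bs|_] //=.
by rewrite ea bs eqxx in ab.
Qed.

Lemma size_psi s w : size (relabel s w) <= (size w).+1.
Proof.
case: w => // a w /=; case: ifP => // _; case: w => // b w; case: ifP => //= _; by rewrite ltnW// ltnW.
Qed.

(** The last edge crossed when the letters of [w] are followed from [v]. On reduced words it names
    edges by their position relative to [v]; the value at the empty word is a default. *)
Fixpoint edge_at (v w : seq nat) : seq nat :=
  match w with
  | [::] => v
  | s :: w' => if w' is [::] then edge_of v (act v s) else edge_at (act v s) w'
  end.

(** A first letter [s] is either prepended or cancelled; the one-letter word [s] is fixed, since the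
    edge just crossed is the same from both ends. *)
Lemma edge_at_act v s w : red w -> edge_at (act v s) w = edge_at v (relabel s w).
Proof.
case: w => // a w; rewrite /red /= => h; case: ifPn => [as_ //|].
rewrite negbK => /eqP ea; case: w h => [|b w] /=; rewrite ea.
  by rewrite act_invol edge_act.
move=> /andP[sb _]; rewrite eq_sym (negbTE sb) act_invol.
by [].
Qed.

Lemma edge_at_cons v s w : w != [::] -> edge_at v (s :: w) = edge_at (act v s) w.
Proof. by case: w. Qed.

Definition walkw (v w : seq nat) := foldl act v w.

Lemma edge_at_rcons v w s : edge_at v (rcons w s) = edge_of (walkw v w) (act (walkw v w) s).
Proof.
elim: w v => //= a w IH v; rewrite -IH; by case: w {IH}.
Qed.

Lemma red_rcons w s : red (rcons w s) = (w == [::]) || (red w && (s != last 0 w)).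
Proof.
rewrite /red rcons_nnil /=; case: w => [|a w] //=.
by rewrite rcons_path eq_sym.
Qed.

Lemma walk_root w : red w || (w == [::]) -> size (walkw [::] w) = size w /\ (w != [::] -> lastlet (walkw [::] w) = last 0 w).
Proof.
elim/last_ind: w => // w s IH; rewrite rcons_nnil orbF red_rcons => h.
have hc : (walkw [::] w == [::]) || (s != lastlet (walkw [::] w)).
  case/orP: h => [/eqP -> //|/andP[rw sw]].
  have [_ ->] := IH (introT orP (or_introl rw)); first by rewrite sw orbT.
  by move: rw; rewrite /red => /andP[].
have h' : red w || (w == [::]) by case/orP: h => [->|/andP[->]]; rewrite ?orbT.
rewrite /walkw foldl_rcons -/(walkw _ _); split; last by rewrite lastlet_child// last_rcons.
by rewrite act_child// !size_rcons (IH h').1.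
Qed.

Lemma edge_at_root w : red w -> edge_at [::] w = walkw [::] w.
Proof.
elim/last_ind: w => // w s _ rw; rewrite edge_at_rcons /walkw foldl_rcons -/(walkw _ _).
move: rw; rewrite red_rcons => h.
have h' : red w || (w == [::]) by case/orP: h => [->|/andP[->]]; rewrite ?orbT.
have hc : (walkw [::] w == [::]) || (s != lastlet (walkw [::] w)).
  case/orP: h => [/eqP -> //|/andP[rw sw]].
  have [_ ->] := walk_root h'; first by rewrite sw orbT.
  by move: rw; rewrite /red => /andP[].
by rewrite act_child// edge_child.
Qed.

Lemma walk_root_inj w w' : red w || (w == [::]) -> red w' || (w' == [::]) -> walkw [::] w = walkw [::] w' -> w = w'.
Proof.
elim/last_ind: w w' => [|w s IH] w' rw rw' e.
  have [s' _] := walk_root rw'; move: s'; rewrite -e /=; by case: (w').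
case/lastP: w' rw' e => [|w' s'] rw' e.
  by have [s1 _] := walk_root rw; move: s1; rewrite e size_rcons.
have h x t : red (rcons x t) || (rcons x t == [::]) -> red x || (x == [::]).
  by rewrite rcons_nnil orbF red_rcons; case/orP => [->|/andP[->]]; rewrite ?orbT.
have es : s = s'.
  have [_ l1] := walk_root rw; have [_ l2] := walk_root rw'.
  by move: (l1 (negbT (rcons_nnil _ _))) (l2 (negbT (rcons_nnil _ _))); rewrite e !last_rcons => -> .
have ew : walkw [::] w = walkw [::] w'.
  move: e; rewrite es /walkw !foldl_rcons => e.
  by rewrite -(act_invol (foldl act [::] w) s') e act_invol.
by rewrite (IH w' (h _ _ rw) (h _ _ rw') ew) es.
Qed.

(** The bijections [relabel] move the base vertex to the root one step at a time; from the root a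
    reduced word never backtracks and is determined by the vertex it leads to. *)
Lemma edge_at_inj v w w' : red w -> red w' -> edge_at v w = edge_at v w' -> w = w'.
Proof.
elim/last_ind: v w w' => [|v a IH] w w' rw rw'.
  rewrite !edge_at_root// => e; apply: walk_root_inj => //; first by rewrite rw.
  by rewrite rw'.
have -> : rcons v a = act v (lastlet (rcons v a)).
  have := act_invol (rcons v a) (lastlet (rcons v a)).
  by rewrite (act_parent (negbT (rcons_nnil _ _))) parent_rcons => ->.
rewrite !edge_at_act// => e.
have := IH _ _ (red_psi _ rw) (red_psi _ rw') e.
by move=> /(congr1 (relabel (lastlet (rcons v a)))); rewrite !relabel_invol.
Qed.

Lemma size_kap v w : size (edge_at v w) <= size v + size w.
Proof.
elim: w v => [|s w IH] v; first by rewrite addn0.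
have ha := size_act v s.
case: w IH => [|b w] IH /=.
  by rewrite /edge_of; case: ifP => _; lia.
by apply: leq_trans (IH (act v s)) _; rewrite /=; lia.
Qed.

End tree_words.

(** * A Hardy inequality for the walk *)

Section branch.
Variable nx : nat -> seq nat.
Implicit Types (om : seq nat -> bool) (ls w : seq nat).

(** Configurations are read along words from the current vertex: [ls] lists the possible first
    letters and [nx s] those that may follow [s]. Excluding [s] itself describes the regular tree, a
    constant list the b-ary tree. *)
Fixpoint survives (n : nat) ls om : bool :=
  if n is n'.+1 then has (fun s => om [:: s] && survives n' (nx s) (fun w => om (s :: w))) ls
  else true.

Definition survives_via n s om : bool := om [:: s] && survives n (nx s) (fun w => om (s :: w)).

Lemma survivesS n ls om : survives n.+1 ls om = has (fun s => survives_via n s om) ls.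
Proof. by []. Qed.

Fixpoint rword (n : nat) ls w : bool :=
  match n, w with
  | n'.+1, s :: w' => (s \in ls) && ((w' == [::]) || rword n' (nx s) w')
  | _, _ => false
  end.

Lemma survives_supp n ls om om' : (forall w, rword n ls w -> om w = om' w) -> survives n ls om = survives n ls om'.
Proof.
elim: n ls om om' => //= n IH ls om om' h; apply: eq_in_has => s sl.
rewrite h ?sl//=; congr (_ && _); apply: IH => w hw.
by apply: h; rewrite sl hw orbT.
Qed.

Lemma survives_mono n ls om : survives n.+1 ls om -> survives n ls om.
Proof.
elim: n ls om => // n IH ls om; rewrite survivesS => /hasP[s sl] /andP[ho] /IH hb.
by rewrite survivesS; apply/hasP; exists s => //; rewrite /survives_via ho.
Qed.

Lemma survives_via_mono n s om : survives_via n.+1 s om -> survives_via n s om.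
Proof. by move=> /andP[ho /survives_mono hb]; rewrite /survives_via ho. Qed.

End branch.

Definition other_letters (d s : nat) : seq nat := [seq x <- iota 0 d | x != s].

Definition seen (v : seq nat) (eta : seq nat -> bool) : seq nat -> bool := fun w => eta (edge_at v w).

Definition letter_move (x : seq nat) (eta : seq nat -> bool) (s : nat) : seq nat :=
  if eta (edge_of x (act x s)) then act x s else x.

Lemma letter_move_invol x eta s : letter_move (letter_move x eta s) eta s = x.
Proof.
rewrite /letter_move; case E: (eta (edge_of x (act x s))); last by rewrite E.
by rewrite act_invol edge_act E.
Qed.

Lemma valid_mvl d x eta s : (0 < d)%N -> (s < d)%N -> valid_Td d x -> valid_Td d (letter_move x eta s).
Proof. by move=> d0 sd vx; rewrite /letter_move; case: ifP => // _; exact: valid_act. Qed.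

Section hardy.
Variables (R : realType) (d k : nat) (sg : R).
Hypothesis d3 : (3 <= d)%N.
Hypothesis sg0 : 0 <= sg.
Let d0 : (0 < d)%N. Proof. exact: leq_trans d3. Qed.
Let n := k.+1.
Let t : R := sg / (1 + sg).
Notation nx := (other_letters d).
Notation br := (survives nx).
Notation m := (survives_via nx).
Notation config := (seq nat -> bool).

(** A local lower bound for the relative decrease of [hardy_weight] in one step. Letters 0, 1, 2
    stand for three branches, at most one of them through the parent. The two negative terms pay for
    the quadratic error in [sg] and for the branches that reach length [k + 1] but not [k + 2]. *)
Definition potential (om : config) : R :=
  d%:R^-1 * (sg / (1 + sg) * [&& m k.+1 0 om, m k.+1 1 om & m k.+1 2 om]%:R
    - sg ^+ 2 * (\sum_(s < d) (m k.+1 s om)%:R)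
    - sg * \sum_(s < d) ((m k s om)%:R - (m k.+1 s om)%:R)).

Let s1 : 0 < 1 + sg. Proof. by rewrite ltr_pwDl. Qed.
Let t0 : 0 <= t. Proof. by rewrite /t divr_ge0// ltW. Qed.
Let tE : t = sg - sg * t.
Proof. by rewrite /t; field; rewrite gt_eqF. Qed.
Let tle : t <= sg. Proof. by rewrite tE lerBlDr lerDl mulr_ge0. Qed.

(* [l] is the letter from a vertex to its parent ([None] at the root) and [o] says whether that
   edge is open; [mm] and [mm'] are the branches surviving to depth [k + 1] and [k]. *)
Lemma potential_bound (l : option nat) (o A : bool) (mm mm' : nat -> bool) :
  (forall s, mm s -> mm' s) ->
  (if l is Some l' then (mm l' -> o) /\ A = has mm' (nx l') else o = false) ->
  t * [&& mm 0%N, mm 1%N & mm 2%N]%:R - sg ^+ 2 * (\sum_(s < d) (mm s)%:R)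
    - sg * \sum_(s < d) ((mm' s)%:R - (mm s)%:R)
  <= t * (\sum_(s < d | Some (val s) != l) (mm s)%:R) - sg * (o && A)%:R.
Proof.
move=> mono hl.
set Err := \sum_(s < d) ((mm' s)%:R - (mm s)%:R) : R.
set M := \sum_(s < d) (mm s)%:R : R.
set a := \sum_(s < d | _) _ : R.
have E0 : 0 <= Err.
  apply: sumr_ge0 => s _; rewrite subr_ge0 ler_nat.
  by case: (mm s) (mono s) => // -> .
have a0 : 0 <= a by apply: sumr_ge0.
have aM : a <= M.
  rewrite /M (bigID (fun s : 'I_d => Some (val s) != l))/= lerDl.
  by apply: sumr_ge0.
(* At most one of the letters 0, 1, 2 is that of the parent, so two branches through children
   survive. *)
have three : [&& mm 0%N, mm 1%N & mm 2%N] -> 2 <= a.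
  move=> /and3P[m0 m1 m2].
  have h (i j : 'I_d) : i != j -> mm i -> mm j -> Some (val i) != l -> Some (val j) != l -> 2 <= a.
    move=> ij mi mj li lj; rewrite /a (bigD1 i)//= (bigD1 j)/=; last by rewrite lj eq_sym.
    by rewrite mi mj addrA (_ : 1%:R + 1%:R = 2)// lerDl; apply: sumr_ge0.
  have i0 : 'I_d := Ordinal d0; have d1 : (1 < d)%N by exact: leq_trans d3.
  have [/eqP l0|l0] := boolP (Some 0%N == l).
    by apply: (h (Ordinal d1) (Ordinal d3)) => //; rewrite -l0.
  have [/eqP l1|l1] := boolP (Some 1%N == l).
    by apply: (h (Ordinal d0) (Ordinal d3)) => //; rewrite -l1.
  exact: (h (Ordinal d0) (Ordinal d1)).
have b01 : 0 <= ([&& mm 0%N, mm 1%N & mm 2%N]%:R : R) <= 1 by case: [&& _, _ & _]; rewrite ?lexx ler01.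
set b3 := ([&& mm 0%N, mm 1%N & mm 2%N]%:R : R) in b01 *.
have b3a : b3 <= a.
  by rewrite /b3; case: (boolP [&& _, _ & _]) => [/three h|_ //]; apply: le_trans h; rewrite ler1n.
have sq0 : 0 <= sg ^+ 2 by exact: sqr_ge0.
have sM : 0 <= sg ^+ 2 * M by rewrite mulr_ge0// (le_trans a0).
have sE : 0 <= sg * Err by rewrite mulr_ge0.
have tb : t * b3 <= t * a by apply: ler_wpM2l b3a; exact: t0.
have [/andP[oT AT]|nA] := boolP (o && A); last by rewrite mulr0; lra.
rewrite mulr1.
(* If some branch dies at the last level, [sg * Err] alone covers the loss [sg] of the step to the
   parent; otherwise both depths agree and the path below the vertex is counted in [a]. *)
have [E1|E1] := lerP 1 Err.
  have : sg <= sg * Err by rewrite ler_peMr.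
  by move=> h; lra.
have mmE s : (s < d)%N -> mm' s = mm s.
  move=> sd; apply/idP/idP; last exact: mono.
  move=> h'; apply: contraLR E1 => nm; rewrite -leNgt /Err (bigD1 (Ordinal sd))//= h' (negbTE nm) subr0.
  rewrite lerDl; apply: sumr_ge0 => i _; rewrite subr_ge0 ler_nat.
  by case: (mm i) (mono i) => // -> .
case: l hl @a a0 aM three b3a tb => [l|] hl; last by rewrite hl in oT.
move=> a a0 aM three b3a tb.
have a1 : 1 <= a.
  move: hl AT => [_ ->] /hasP[s]; rewrite mem_filter mem_iota add0n => /andP[sl /= sd] h'.
  rewrite /a (bigD1 (Ordinal sd))//= -mmE// h' lerDl; exact: sumr_ge0.
have st : sg * t <= sg ^+ 2 by rewrite expr2; apply: ler_wpM2l.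
have sM1 : sg ^+ 2 <= sg ^+ 2 * M by rewrite ler_peMr// (le_trans a1).
have [h3|h3] := boolP [&& mm 0%N, mm 1%N & mm 2%N].
  have a2 := three h3.
  have b31 : b3 = 1 by rewrite /b3 h3.
  have : 2 * t <= t * a by rewrite mulrC; exact: ler_wpM2l.
  by rewrite b31; move: tE; lra.
have b30 : b3 = 0 by rewrite /b3 (negbTE h3).
have : t <= t * a by rewrite ler_peMr.
by rewrite b30; move: tE; lra.
Qed.

Definition Adown (eta : config) (x : seq nat) : bool := br k.+1 (nx (lastlet x)) (seen x eta).

Definition hardy_weight (eta : config) (x : seq nat) : R := \prod_(i < size x) (1 + sg * (Adown eta (take i.+1 x))%:R)^-1.

Lemma hardy_weight_gt0 eta x : 0 < hardy_weight eta x.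
Proof. by apply: prodr_gt0 => i _; rewrite invr_gt0 ltr_pwDl// mulr_ge0. Qed.

Lemma hardy_weight_rcons eta u a : hardy_weight eta (rcons u a) = hardy_weight eta u / (1 + sg * (Adown eta (rcons u a))%:R).
Proof.
rewrite /hardy_weight size_rcons big_ord_recr /= take_oversize ?size_rcons//; congr (_ * _).
by apply: eq_bigr => i _; rewrite -cats1 takel_cat.
Qed.

Lemma survives_via_seen n' s x eta : survives_via nx n' s (seen x eta) =
  eta (edge_of x (act x s)) && br n' (nx s) (seen (act x s) eta).
Proof.
rewrite /survives_via /seen; congr (_ && _); apply: survives_supp => w rw; congr eta.
by case: w rw => //; case: n'.
Qed.

(** Crossing an open edge to a child with a path below multiplies [hardy_weight] by
    [1 / (1 + sg) = 1 - t]; going back to the parent from such a vertex multiplies it by [1 + sg].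
    The sum is controlled by [potential_bound] and [1 - u <= exp (- u)]. *)
Lemma hardy_step eta x : valid_Td d x ->
  d%:R^-1 * (\sum_(s < d) hardy_weight eta (letter_move x eta s)) <= expR (- potential (seen x eta)) * hardy_weight eta x.
Proof.
move=> vx.
have D0 : 0 < (d%:R : R) by rewrite ltr0n.
have h0 := hardy_weight_gt0 eta x.
pose l := if x == [::] then None else Some (lastlet x).
pose o := (x != [::]) && eta x.
pose A := Adown eta x.
have key : \sum_(s < d) hardy_weight eta (letter_move x eta s) = hardy_weight eta x * (d%:R - (t * (\sum_(s < d | Some (val s) != l) (m k.+1 s (seen x eta))%:R) - sg * (o && A)%:R)).
  have child (s : nat) : Some s != l ->
     hardy_weight eta (letter_move x eta s) = hardy_weight eta x * (1 - t * (m k.+1 s (seen x eta))%:R).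
    move=> sl; have hc : (x == [::]) || (s != lastlet x).
      by move: sl; rewrite /l; case: (x =P [::]) => //= _; apply: contra => /eqP ->.
    rewrite survives_via_seen /letter_move; case: ifP => _; last by rewrite mulr0 subr0 mulr1.
    have := lastlet_child hc; rewrite act_child// => ll.
    rewrite hardy_weight_rcons /Adown ll andTb; congr (_ * _).
    case: survives; rewrite ?mulr1 ?mulr0 ?addr0 ?invr1 ?subr0//.
    by rewrite /t; field; rewrite gt_eqF.
  rewrite (bigID (fun s : 'I_d => Some (val s) != l))/=.
  rewrite (eq_bigr (fun s : 'I_d => hardy_weight eta x * (1 - t * (m k.+1 s (seen x eta))%:R)) (fun (s : 'I_d) hs => child s hs)).
  rewrite -mulr_sumr sumrB -mulr_sumr.
  have [x0|x0] := eqVneq x [::].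
    rewrite [X in _ + X]big1 ?addr0; last by move=> s; rewrite /l x0.
    rewrite /o x0 /= mulr0 subr0; congr (_ * (_ - _)).
    by rewrite /l x0 /= sumr_const card_ord.
  have ld : (lastlet x < d)%N by exact: valid_lastlet.
  have lE : l = Some (lastlet x) by rewrite /l (negbTE x0).
  rewrite [X in _ + X](_ : _ = hardy_weight eta x * (1 + sg * (o && A)%:R)); last first.
    rewrite (bigD1 (Ordinal ld))/=; last by rewrite lE eqxx.
    rewrite big1 ?addr0; last first.
      move=> s /andP[]; rewrite lE negbK => /eqP[e]; rewrite -val_eqE /= e eqxx //.
    rewrite /letter_move act_parent// edge_parent// /o x0 /=.
    case: ifP => _ /=; last by rewrite mulr0 addr0 mulr1.
    rewrite /A; case/lastP: (x) x0 => // u a _; rewrite parent_rcons hardy_weight_rcons.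
    by rewrite divfK// gt_eqF// ltr_pwDl// mulr_ge0.
  rewrite -mulrDr; congr (_ * _).
  have e : (d%:R : R) = 1 + \sum_(s < d | Some (val s) != l) 1.
    rewrite (_ : d%:R = \sum_(s < d) 1); last by rewrite sumr_const card_ord.
    rewrite (bigD1 (Ordinal ld))//=; congr (_ + _); apply: eq_bigl => s.
    by rewrite lE -val_eqE /=; apply/idP/idP => /eqP h; apply/eqP => h'; apply: h; [case: h'|rewrite h'].
  by rewrite e; ring.
rewrite key mulrCA mulrC ler_pM2r//.
have pb := @potential_bound l o A (fun s => m k.+1 s (seen x eta)) (fun s => m k s (seen x eta)) _ _.
apply: (@le_trans _ _ (1 - potential (seen x eta))); last by have := expR_ge1Dx (- potential (seen x eta)); lra.
rewrite mulrBr mulVf ?gt_eqF// lerD2l lerN2 /potential ler_pM2l ?invr_gt0//.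
apply: pb => [s|]; first exact: survives_via_mono.
rewrite /l; case: eqP => [x0|/eqP x0]; first by rewrite /o x0.
split; last by [].
by rewrite survives_via_seen act_parent// edge_parent// /o x0 => /andP[].
Qed.

End hardy.

(** * Schur test for the tilted walk *)

Definition nbr_move (d : nat) (x : seq nat) (z : seq nat -> bool) (j : nat) : seq nat :=
  if z (edge_of x (nbr d x j)) then nbr d x j else x.

Section contraction.
Variables (R : realType) (d k : nat) (sg p mu : R).
Hypothesis d3 : (3 <= d)%N.
Hypothesis sg0 : 0 <= sg.
Hypothesis p01 : 0 <= p <= 1.
Variable B : seq (seq nat).
Variable y0 : seq nat.
Notation config := (seq nat -> bool).
Let d0 : (0 < d)%N. Proof. exact: leq_trans d3. Qed.
Let D0 : 0 < (d%:R : R). Proof. by rewrite ltr0n. Qed.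
Notation F := (potential d k sg).
Notation h := (hardy_weight d k sg).

(** Each end of the step contributes half of its potential, which makes the tilted kernel symmetric
    in [x] and the end point. *)
Definition phiH (x : seq nat) (z : config) (y : seq nat) : R :=
  expR ((F (seen x z) + F (seen y z)) / 2).

Definition psiH (x : seq nat) : R := (x == y0)%:R.

Notation an := (mean_weight p mu d B (nbr_move d) phiH psiH).

Let phi0 x z y : 0 <= phiH x z y. Proof. exact: expR_ge0. Qed.
Let psi0 x : 0 <= psiH x. Proof. exact: ler0n. Qed.

(** Weighted Cauchy-Schwarz on a row of the kernel with weights [h y / h x], whose first factor is
    at most 1 by [hardy_step]. It is carried out by completing one square for each letter. *)
Lemma schur_row (g : seq nat -> R) x z : valid_Td d x ->
  (d%:R^-1 * \sum_(s < d) (phiH x z (letter_move x z s) * g (letter_move x z s))) ^+ 2 <=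
  d%:R^-1 * \sum_(s < d) (expR (F (seen (letter_move x z s) z)) * (h z x / h z (letter_move x z s)) * g (letter_move x z s) ^+ 2).
Proof.
move=> vx; set m := d%:R^-1 * _.
have key (s : 'I_d) : 2 * m * (phiH x z (letter_move x z s) * g (letter_move x z s)) <=
   m ^+ 2 * (expR (F (seen x z)) * (h z (letter_move x z s) / h z x)) +
   expR (F (seen (letter_move x z s) z)) * (h z x / h z (letter_move x z s)) * g (letter_move x z s) ^+ 2.
  set y := letter_move x z s.
  have hx := hardy_weight_gt0 d k sg0 z x; have hy := hardy_weight_gt0 d k sg0 z y.
  rewrite /phiH [(_ + F _) / 2]mulrDl expRD.
  have e2 (v : R) : expR v = expR (v / 2) ^+ 2 by rewrite -expRM_natr -mulr_natr divfK.
  rewrite (e2 (F (seen x z))) (e2 (F (seen y z))).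
  set al := expR (_ / 2); set be := expR (_ / 2).
  rewrite -subr_ge0 (_ : _ - _ = (m * al * (h z y / h z x) - be * g y) ^+ 2 * (h z x / h z y)).
    by rewrite mulr_ge0// ?sqr_ge0// divr_ge0// ltW.
  by field; rewrite !gt_eqF.
have hs := @hardy_step R d k sg d3 sg0 z x vx.
have P1 : d%:R^-1 * \sum_(s < d) (expR (F (seen x z)) * (h z (letter_move x z s) / h z x)) <= 1.
  rewrite -mulr_sumr -mulr_suml mulrCA -[leRHS](mulfV (lt0r_neq0 (expR_gt0 (F (seen x z))))).
  have hx := hardy_weight_gt0 d k sg0 z x.
  rewrite ler_pM2l ?expR_gt0// mulrA ler_pdivrMr// -expRN; exact: hs.
have : d%:R^-1 * \sum_(s < d) (2 * m * (phiH x z (letter_move x z s) * g (letter_move x z s))) <=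
   d%:R^-1 * \sum_(s < d) (m ^+ 2 * (expR (F (seen x z)) * (h z (letter_move x z s) / h z x)) +
   expR (F (seen (letter_move x z s) z)) * (h z x / h z (letter_move x z s)) * g (letter_move x z s) ^+ 2).
  by rewrite ler_pM2l ?invr_gt0//; apply: ler_sum => s _; exact: key.
rewrite big_split/= -!mulr_sumr mulrCA -/m mulrDr (mulrCA _ (m ^+ 2)) => H1.
have : m ^+ 2 * (d%:R^-1 * (expR (F (seen x z)) * \sum_(s < d) (h z (letter_move x z s) / h z x))) <= m ^+ 2.
  by rewrite ler_piMr ?sqr_ge0// mulr_sumr.
by move: H1; rewrite expr2; lra.
Qed.

(** For each letter the move is an involution, so summing the row bounds over [x] exchanges the two
    ends, and [hardy_step] at the other end bounds the total by the squared norm of [g]. The norm is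
    tested on finite lists; [L'] collects the vertices reached from [L]. *)
Lemma schur (g : seq nat -> R) z :
  (forall L, uniq L -> {in L, forall x, valid_Td d x} -> \sum_(x <- L) g x ^+ 2 <= 1) ->
  forall L, uniq L -> {in L, forall x, valid_Td d x} ->
  \sum_(x <- L) (d%:R^-1 * \sum_(s < d) (phiH x z (letter_move x z s) * g (letter_move x z s))) ^+ 2 <= 1.
Proof.
move=> hg L uL vL.
pose G y x : R := expR (F (seen y z)) * (h z x / h z y) * g y ^+ 2.
have G0 y x : 0 <= G y x.
  have hx := ltW (hardy_weight_gt0 d k sg0 z x); have hy := ltW (hardy_weight_gt0 d k sg0 z y).
  apply: mulr_ge0 (sqr_ge0 _); apply: mulr_ge0 (divr_ge0 hx hy); exact: expR_ge0.
apply: (@le_trans _ _ (\sum_(x <- L) d%:R^-1 * \sum_(s < d) G (letter_move x z s) x)).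
  by rewrite big_seq [leRHS]big_seq; apply: ler_sum => x xL; apply: schur_row; exact: vL.
pose L' := undup (flatten [seq [seq letter_move x z s | x <- L] | s <- iota 0 d]).
have L'P (s : 'I_d) x : x \in L -> letter_move x z s \in L'.
  move=> xL; rewrite mem_undup; apply/flattenP; exists [seq letter_move x z s | x <- L].
    by apply/mapP; exists (val s) => //; rewrite mem_iota /=.
  by apply/mapP; exists x.
have vL' : {in L', forall x, valid_Td d x}.
  move=> y; rewrite mem_undup => /flattenP[T /mapP[s]]; rewrite mem_iota add0n => /andP[_ sd] ->.
  by move=> /mapP[x xL ->]; apply: valid_mvl => //; exact: vL.
apply: (@le_trans _ _ (\sum_(y <- L') d%:R^-1 * \sum_(s < d) G y (letter_move y z s))); last first.
  apply: le_trans (hg L' (undup_uniq _) vL'); rewrite big_seq [leRHS]big_seq; apply: ler_sum => y yL.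
  have hs := @hardy_step R d k sg d3 sg0 z y (vL' y yL).
  have hy := hardy_weight_gt0 d k sg0 z y.
  set c := expR (F (seen y z)) / h z y * g y ^+ 2.
  have c0 : 0 <= c by apply: mulr_ge0 (sqr_ge0 _); apply: divr_ge0 (ltW hy); exact: expR_ge0.
  have /(ler_wpM2r c0) := hs.
  rewrite (_ : expR (- _) * _ * c = g y ^+ 2); last first.
    by rewrite /c expRN; field; rewrite !gt_eqF// expR_gt0.
  congr (_ <= _); rewrite -mulrA mulr_suml; congr (_ * _); apply: eq_bigr => s _.
  by rewrite /G /c; ring.
rewrite -!mulr_sumr ler_pM2l ?invr_gt0// exchange_big/= [leRHS]exchange_big/=.
apply: ler_sum => s _.
rewrite (_ : \sum_(x <- L) _ = \sum_(y <- [seq letter_move x z s | x <- L]) G y (letter_move y z s)); last first.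
  by rewrite big_map; apply: eq_bigr => x _; rewrite letter_move_invol.
have uM : uniq [seq letter_move x z s | x <- L].
  by rewrite map_inj_uniq// => x y e; rewrite -(letter_move_invol x z s) e letter_move_invol.
rewrite [leRHS](bigID (mem [seq letter_move x z s | x <- L]))/= -[leLHS]addr0; apply: lerD; last exact: sumr_ge0.
rewrite -[leRHS]big_filter le_eqVlt; apply/orP; left; apply/eqP/perm_big/uniq_perm => //.
  by rewrite filter_uniq// undup_uniq.
move=> y; rewrite mem_filter /=; case E: (y \in _) => //=; apply/esym.
by move: E => /mapP[x xL ->]; exact: L'P.
Qed.

(** By Jensen the square passes inside the averages over gap and configurations. There the
    configuration [z] is the same for all starting points [x], so [schur] applies to the function of
    [x] given by the remaining [n] steps from [z]. The end point [y0] is fixed and the start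
    varies. *)
Lemma contraction n eta L : uniq L -> {in L, forall x, valid_Td d x} ->
  \sum_(x <- L) (an n x eta) ^+ 2 <= 1.
Proof.
elim: n eta L => [|n IH] eta L uL vL.
  rewrite /= /psiH; have [yL|yL] := boolP (y0 \in L).
    rewrite (bigD1_seq y0)//= eqxx expr1n big1 ?addr0// => x /negbTE ->; by rewrite expr0n.
  rewrite big_seq big1 ?ler01// => x xL; case: eqP => [e|_]; last by rewrite expr0n.
  by rewrite -e xL in yL.
pose f x r := resample p (fun=> r) B
      (fun z => d%:R^-1 * \sum_(j < d) (phiH x z (nbr_move d x z j) * an n (nbr_move d x z j) z)) eta.
have ok (r : R) : 0 <= r <= 1 -> rho_ok (fun=> r) B by move=> r01 e.
pose g x r := resample p (fun=> r) B
      (fun z => (d%:R^-1 * \sum_(j < d) (phiH x z (nbr_move d x z j) * an n (nbr_move d x z j) z)) ^+ 2) eta.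
apply: (@le_trans _ _ (\sum_(x <- L) unif_mean mu (fun r => g x r))).
  apply: ler_sum => x _; apply: le_trans (unif_mean_jensen (bmfun_resample1 p mu B _ eta)) _.
  apply: unif_mean_le; [|exact: bmfun_resample1|]; first by apply: bmfunM; exact: bmfun_resample1.
  by move=> r r01; apply: (resample_jensen p01); exact: ok.
rewrite -unif_mean_sum; last by move=> x; exact: bmfun_resample1.
apply: unif_mean_le_cst; first by apply: bmfun_sum => x; exact: bmfun_resample1.
move=> r r01; rewrite /g -resample_sum; apply: (resample_le_cst p01); first exact: ok.
move=> z; apply: (le_trans _ (@schur (fun x => an n x z) z (IH z) L uL vL)).
rewrite le_eqVlt; apply/orP; left; apply/eqP.
rewrite big_seq [RHS]big_seq; apply: eq_bigr => x xL; congr ((_ * _) ^+ 2).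
pose G v := phiH x z (if z (edge_of x v) then v else x) * an n (if z (edge_of x v) then v else x) z.
exact: (sum_nbr G d0 (vL x xL)).
Qed.

Lemma contraction_le1 n eta x : valid_Td d x -> an n x eta <= 1.
Proof.
move=> vx; have := @contraction n eta [:: x] isT _.
rewrite big_seq1 => h; have {}h := h _; rewrite -(@ler_pXn2r _ 2)// ?nnegrE ?ler01 ?mean_weight_ge0//.
by rewrite expr1n; apply: h => y; rewrite inE => /eqP ->.
Qed.

End contraction.

(** * The environment seen from the walker *)

Section relwords.
Variable d : nat.
Hypothesis d0 : (0 < d)%N.

Definition rel_word (N : nat) (w : seq nat) : bool :=
  [&& red w, all (fun a => (a < d)%N) w & (size w <= N)%N].

Fixpoint words (N : nat) : seq (seq nat) :=
  if N is N'.+1 then [::] :: [seq a :: w | a <- iota 0 d, w <- words N'] else [:: [::]].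

Lemma mem_words N w : all (fun a => (a < d)%N) w -> (size w <= N)%N -> w \in words N.
Proof.
elim: N w => [|N IH] [|a w] //= /andP[ad aw] sw.
rewrite in_cons /=; apply/allpairsP; exists (a, w) => /=.
by rewrite mem_iota ad; split => //; exact: IH.
Qed.

Definition rel_ball (N : nat) : seq (seq nat) := [seq w <- undup (words N) | rel_word N w].

Lemma mem_rball N w : (w \in rel_ball N) = rel_word N w.
Proof.
rewrite mem_filter mem_undup; case: (boolP (rel_word N w)) => //= /and3P[_ h1 h2].
exact: mem_words.
Qed.

Lemma uniq_rball N : uniq (rel_ball N).
Proof. by rewrite filter_uniq// undup_uniq. Qed.

Lemma relw_mono N N' w : (N <= N')%N -> rel_word N w -> rel_word N' w.
Proof. by move=> NN /and3P[h1 h2 h3]; rewrite /rel_word h1 h2 (leq_trans h3). Qed.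

Lemma relw_psi N s w : (s < d)%N -> rel_word N w -> rel_word N.+1 (relabel s w).
Proof.
move=> sd /and3P[h1 h2 h3]; apply/and3P; split; first exact: red_psi.
  case: w h2 {h1 h3} => [//|a w] /= /andP[ad aw]; case: ifP => _ /=; first by rewrite sd ad.
  by case: w aw => [|b w] /=; [rewrite ad|case: ifP => //= _ /andP[-> ->]; rewrite ad].
by rewrite (leq_trans (size_psi _ _)).
Qed.

Lemma relw_single s N : (s < d)%N -> rel_word N.+1 [:: s].
Proof. by move=> sd; rewrite /rel_word /= sd. Qed.

End relwords.

(** * Averages over the gap and regularity in the keep probabilities *)

Section RxEr.
Variables (R : realType) (p mu : R) (E : eqType).
Implicit Types (S : seq E).

Lemma bmfun_resample2 rho S (G : R -> (E -> bool) -> R) eta : (forall z, bmfun mu (fun r => G r z)) ->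
  bmfun mu (fun r => resample p rho S (G r) eta).
Proof.
move=> h; elim: S eta => //= e S IH eta; rewrite /resample1.
have hc c f : bmfun mu f -> bmfun mu (fun r : R => c * f r) by move=> bf; apply: bmfunM => //; exact: bmfun_cst.
apply: bmfunD; first exact: hc.
by apply: (hc _ (fun r => _)); apply: bmfunD; exact: hc.
Qed.

Lemma resample_Er rho S (G : R -> (E -> bool) -> R) eta : (forall z, bmfun mu (fun r => G r z)) ->
  resample p rho S (fun z => unif_mean mu (fun r => G r z)) eta = unif_mean mu (fun r => resample p rho S (G r) eta).
Proof.
move=> h; elim: S eta => //= e S IH eta; rewrite /resample1 !IH.
have b z := bmfun_resample2 rho S z h.
have hc c f : bmfun mu f -> bmfun mu (fun r : R => c * f r) by move=> bf; apply: bmfunM => //; exact: bmfun_cst.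
rewrite unif_meanD//; first last.
- by apply: (hc _ (fun r => _)); apply: bmfunD; exact: hc.
- exact: hc.
rewrite unif_meanZ// unif_meanZ; last by apply: bmfunD; exact: hc.
by rewrite unif_meanD//; [rewrite !unif_meanZ|exact: hc|exact: hc].
Qed.

(** The law of the keep probability charges every neighbourhood of 0: for [u] in the interval from 0
    to [a] the keep probability is at most [x / 2], and this has probability [a > 0]. The strictness
    drives [Phi_cvg]. *)
Lemma unif_mean_min_lt x : 0 < mu -> 0 < x -> unif_mean mu (fun r => Num.min x r) < x.
Proof.
move=> mu0 x0.
pose y := Num.min 1 (x / 2); have y0 : 0 < y by rewrite lt_min ltr01 divr_gt0.
pose a := expR (ln y / mu).
have a0 : 0 < a by exact: expR_gt0.
have a1 : a <= 1.
  rewrite -expR0 ler_expR; apply: mulr_le0_ge0; last by rewrite invr_ge0 ltW.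
  by rewrite ln_le0// ge_min lexx.
have small u : 0 < u <= a -> rf mu u <= x / 2.
  move=> /andP[u0 ua]; rewrite /rf ge_min; apply/orP; right.
  apply: (@le_trans _ _ y); last by rewrite ge_min lexx orbT.
  rewrite -[leRHS]lnK// ler_expR -ler_pdivlMl// mulrC.
  by rewrite -[leRHS]expRK ler_ln// posrE expR_gt0.
pose S := [set u : R | u <= a] `\` [set u : R | u <= 0].
have m0 c : measurable ([set u : R | u <= c] : set R).
  rewrite (_ : [set u | _] = `]-oo, c]%classic); first exact: measurable_itv.
  by apply/seteqP; split => u /=; rewrite in_itv.
have mS : measurable (S : set R).
  exact: measurableD.
have lS : unif01 R S = a%:E.
  rewrite /S measureD//; last by rewrite [X in (X < _)%E](unif01_le a) ltry.
  rewrite setIidr; last by move=> u /= /le_trans; apply; exact: ltW.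
  rewrite [X in (X - _)%E](unif01_le a) [X in (_ - X)%E](unif01_le 0) -EFinB; congr (_%:E).
  by rewrite !clamp_id ?subr0 ?lexx ?ler01 ?(ltW a0) ?a1.
have bi : bmfun mu (fun r => Num.min x r) by apply: bmfun_min; [exact: bmfun_cst|exact: bmfun_id].
have bj : (unif01 R).-integrable setT (EFin \o (fun u => (x / 2) * \1_S u)).
  apply: measurable_bounded_integrable => //.
  - by rewrite [X in (X < _)%E]lamT ltry.
  - by apply: measurable_funM => //; exact: measurable_indic.
  - exists (x / 2); split; first by rewrite num_real.
    move=> c hc u _ /=; rewrite indicE; case: (u \in S); rewrite ?mulr1 ?mulr0 ?normr0 ?ger0_norm; lra.
have : unif_mean mu (fun r => Num.min x r) <= \int[unif01 R]_u (x - (x / 2) * \1_S u).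
  have bc : (unif01 R).-integrable setT (EFin \o (fun=> x : R)) by exact: (bmfun_int (bmfun_cst mu x)).
  apply: le_Rintegral => //; first exact: bmfun_int.
    exact: (integrableB measurableT bc bj).
  move=> u _; rewrite indicE; case: (boolP (u \in S)) => [|_]; last by rewrite mulr0 subr0 ge_min lexx.
  rewrite inE => -[/= ua /negP]; rewrite -ltNge => u0; rewrite mulr1.
  rewrite ge_min; apply/orP; right; apply: (le_trans (small _ _)); first by rewrite u0.
  by lra.
rewrite RintegralB//; last exact: (bmfun_int (bmfun_cst mu x)).
rewrite RintegralZl//; last first.
  apply: measurable_bounded_integrable => //.
  - by rewrite [X in (X < _)%E]lamT ltry.
  - exists 1; split; first by rewrite num_real.
    move=> c hc u _ /=; rewrite indicE; case: (u \in S); rewrite ?normr1 ?normr0; lra.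
have -> : \int[unif01 R]_u \1_S u = a.
  by rewrite /Rintegral integral_indic// setIT; exact: (congr1 fine lS).
rewrite -[X in X - _]/(unif_mean mu (fun=> x)) unif_mean_cst => h.
by apply: le_lt_trans h _; rewrite ltrBlDr ltrDl mulr_gt0// divr_gt0.
Qed.

End RxEr.

Section RxLip.
Variables (R : realFieldType) (p : R) (E : eqType).
Hypothesis p01 : 0 <= p <= 1.
Implicit Types (S T : seq E) (f : (E -> bool) -> R) (eta : E -> bool).

Lemma resample_restrict rho S T f : uniq S -> uniq T -> supp (mem S) f ->
  resample p rho T f = resample p (fun e => if e \in T then rho e else 1) S f.
Proof.
move=> uS uT sf.
have peT : perm_eq T ([seq x <- T | x \in S] ++ [seq x <- T | x \notin S]) by rewrite perm_sym perm_filterC.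
have peS : perm_eq S ([seq x <- S | x \in T] ++ [seq x <- S | x \notin T]) by rewrite perm_sym perm_filterC.
rewrite (resample_perm _ _ _ uT peT) (resample_perm _ _ _ uS peS) !resample_cat.
rewrite [X in resample p rho _ X = _](@resample_drop _ _ p (mem S) _ _ _ sf); last by move=> e; rewrite mem_filter => /andP[].
rewrite [X in _ = resample _ _ _ X](@resample_one _ _ p); last by move=> e; rewrite mem_filter => /andP[/negbTE ->].
rewrite [RHS](@resample_rho _ _ p _ rho); last by move=> e; rewrite mem_filter => /andP[->].
apply: resample_perm; first exact: filter_uniq.
apply: uniq_perm; rewrite ?filter_uniq// => x.
by rewrite !mem_filter andbC.
Qed.

Lemma resample_if_fixed rho S (e0 : E) f g eta : e0 \notin S ->
  resample p rho S (fun z => if z e0 then f z else g z) eta =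
  if eta e0 then resample p rho S f eta else resample p rho S g eta.
Proof.
elim: S eta => //= e S IH eta; rewrite in_cons negb_or => /andP[ne nS].
by rewrite /resample1 !IH// /upd (negbTE ne); case: (eta e0).
Qed.

(** The constant grows with the number of edges, so this serves for lists of fixed size: the base
    case below and the [d] edges at the walker. *)
Lemma resample_lip_fin rho rho0 S f c r : rho_ok rho S -> rho_ok rho0 S ->
  (forall e, e \in S -> `|rho e - rho0 e| <= r) -> (forall z, `|f z| <= c) ->
  forall eta, `|resample p rho S f eta - resample p rho0 S f eta| <= (size S)%:R * (2 * c * r).
Proof.
move=> + + + fc; elim: S => [_ _ _ eta|e S IH /rho_ok_cons[r01 ok] /rho_ok_cons[_ ok0] hr eta].
  by rewrite /= subrr normr0 mul0r.
have hr' x : x \in S -> `|rho x - rho0 x| <= r by move=> xS; apply: hr; rewrite in_cons xS orbT.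
have {}IH := IH ok ok0 hr'.
rewrite /= /resample1; set A := resample p rho S f; set A0 := resample p rho0 S f.
have A0c z : `|A0 z| <= c by exact: (resample_norm_le p01).
move: p01 => /andP[p0 p1]; move: r01 => /andP[q0 q1].
have := hr e (mem_head _ _).
have := IH eta; have := IH (upd eta e true); have := IH (upd eta e false).
rewrite -/A -/A0; move: (A0c eta) (A0c (upd eta e true)) (A0c (upd eta e false)).
move: (A eta) (A0 eta) (A (upd eta e false)) (A0 (upd eta e false)) (A (upd eta e true)) (A0 (upd eta e true)) => a0 b0 a2 b2 a1 b1.
set K := (size S)%:R * (2 * c * r) => hb0 hb2 hb1 h1 h2 h0 hrr.
have avg x y z q : `|x| <= z -> `|y| <= z -> 0 <= q <= 1 -> `|q * x + (1 - q) * y| <= z.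
  move=> hx hy /andP[l0 l1]; apply: le_trans (ler_normD _ _) _; rewrite !normrM.
  rewrite ger0_norm// [`|1 - q|]ger0_norm ?subr_ge0//.
  have -> : z = q * z + (1 - q) * z by ring.
  by apply: lerD; apply: ler_wpM2l => //; rewrite subr_ge0.
rewrite -[(size S).+1]addn1 natrD [(_ + 1) * _]mulrDl [1 * _]mul1r -/K.
rewrite (_ : _ - _ = (rho e * (a0 - b0) + (1 - rho e) * (p * (a1 - b1) + (1 - p) * (a2 - b2))) +
  (rho e - rho0 e) * (b0 - (p * b1 + (1 - p) * b2))); last by ring.
apply: le_trans (ler_normD _ _) _.
apply: lerD.
  by apply: (avg); rewrite ?q0//; apply: (avg); rewrite ?p0.
rewrite normrM mulrC; apply: ler_pM => //.
apply: le_trans (ler_normB _ _) _; rewrite (_ : 2 * c = c + c); [apply: lerD => //|by ring].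
by apply: (avg); rewrite ?p0.
Qed.

End RxLip.

(** * Gap and move operators in the frame of the walker *)

Section rel.
Variables (R : realType) (d : nat) (p mu : R).
Hypothesis d0 : (0 < d)%N.
Hypothesis p01 : 0 <= p <= 1.
Hypothesis mu0 : 0 < mu.
Notation config := (seq nat -> bool).
Implicit Types (f g : config -> R) (om : config).
Notation relw := (rel_word d).
Notation rball := (rel_ball d).

Definition seen_move om (s : nat) : config := if om [:: s] then (fun w => om (relabel s w)) else om.

Definition move_mean f om : R := d%:R^-1 * \sum_(s < d) f (seen_move om s).

Definition env_mean N f om : R := unif_mean mu (fun r => resample p (fun=> r) (rball N) f om).

Let D0 : 0 < (d%:R : R). Proof. by rewrite ltr0n. Qed.

Lemma supp_rball N f : supp (relw N) f -> supp (mem (rball N)) f.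
Proof. by move=> sf z z' h; apply: sf => w hw; apply: h; rewrite /= mem_rball. Qed.

Lemma supp_mvr N f s : (s < d)%N -> supp (relw N) f -> supp (relw N.+1) (fun om => f (seen_move om s)).
Proof.
move=> sd sf z z' h; rewrite /seen_move (h [:: s]); last exact: relw_single.
case: ifP => _; apply: sf => w hw; apply: h; first exact: relw_psi.
exact: relw_mono hw.
Qed.

Lemma supp_Mv N f : supp (relw N) f -> supp (relw N.+1) (move_mean f).
Proof.
move=> sf z z' h; rewrite /move_mean; congr (_ * _); apply: eq_bigr => s _.
exact: (supp_mvr (ltn_ord s) sf).
Qed.

Lemma supp_Pe M N f : supp (relw M) f -> supp (relw M) (env_mean N f).
Proof.
move=> sf z z' h; rewrite /env_mean; congr (unif_mean mu _); apply/funext => r.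
exact: (@supp_resample _ _ p _ _ _ _ sf z z' h).
Qed.

Lemma resample_rball_mono rho N N' f : (N <= N')%N -> supp (relw N) f ->
  resample p rho (rball N') f = resample p rho (rball N) f.
Proof.
move=> NN sf; apply: resample_sub; rewrite ?uniq_rball//; first exact: supp_rball.
by move=> w; rewrite !mem_rball; exact: relw_mono.
Qed.

Lemma Mv_norm_le f c : (forall z, `|f z| <= c) -> forall om, `|move_mean f om| <= c.
Proof.
move=> fc om; rewrite /move_mean normrM ger0_norm ?invr_ge0// ler_pdivrMl//.
apply: le_trans (ler_norm_sum _ _ _) _.
by rewrite mulr_natl -[X in _ *+ X](card_ord d) -sumr_const; apply: ler_sum.
Qed.

Let okc (r : R) S : 0 <= r <= 1 -> rho_ok (E := seq nat) (fun=> r) S.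
Proof. by move=> r01 e. Qed.

Lemma Pe_norm_le N f c : (forall z, `|f z| <= c) -> forall om, `|env_mean N f om| <= c.
Proof.
move=> fc om; apply: unif_mean_norm_le; first exact: bmfun_resample1.
by move=> r r01; apply: (resample_norm_le p01) => //; exact: okc.
Qed.

(** The involution [relabel s] fixes the one-letter word that decides the move and permutes the
    other edges, so it preserves Bernoulli percolation both when that edge is open and when it is
    closed. *)
Lemma stationary_Mv N f eta : supp (relw N) f ->
  resample p (fun=> 0) (rball N.+1) (move_mean f) eta = resample p (fun=> 0) (rball N.+1) f eta.
Proof.
move=> sf.
rewrite (_ : move_mean f = fun z => d%:R^-1 * \sum_(s <- index_enum 'I_d) f (seen_move z s)); last by [].
rewrite resampleZ (resample_sum p (fun=> 0) (rball N.+1) _ (fun s : 'I_d => fun z => f (seen_move z s))).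
suff H (s : 'I_d) : resample p (fun=> 0) (rball N.+1) (fun z => f (seen_move z s)) eta = resample p (fun=> 0) (rball N.+1) f eta.
  by rewrite (eq_bigr _ (fun s _ => H s)) sumr_const card_ord -[X in _ * X]mulr_natl mulKf ?gt_eqF.
case: N sf => [|N] sf.
  have sf0 z z' : f z = f z'.
    by apply: sf => w /and3P[/andP[w0 _] _]; rewrite leqn0 size_eq0 (negbTE w0).
  by congr (resample _ _ _ _ _); apply/funext => z; exact: sf0.
pose f1 (z : config) : R := (z [:: val s])%:R * f z; pose f2 (z : config) : R := (~~ z [:: val s])%:R * f z.
have sf1 : supp (relw N.+1) f1.
  by move=> z z' h; rewrite /f1 (h _ (relw_single N (ltn_ord s))) (sf z z').
rewrite (_ : (fun z => f (seen_move z s)) = fun z => f1 (fun w => z (relabel s w)) + f2 z); last first.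
  apply/funext => z; rewrite /f1 /f2 /seen_move relabel_single; case: (z _) => /=; by rewrite ?mul1r ?mul0r ?addr0 ?add0r.
rewrite [in RHS](_ : f = fun z => f1 z + f2 z); last first.
  by apply/funext => z; rewrite /f1 /f2; case: (z _) => /=; rewrite ?mul1r ?mul0r ?addr0 ?add0r.
rewrite !resampleD; congr (_ + _).
have -> : resample p (fun=> 0) (rball N.+2) f1 = resample p (fun=> 0) (rball N.+1) f1 by exact: resample_rball_mono.
have pinj : injective (relabel s) by move=> w w' e; rewrite -(relabel_invol s w) e relabel_invol.
rewrite (@resample_sub _ _ p (fun=> 0) (rball N.+2) (map (relabel s) (rball N.+1))).
- rewrite (@resample_relabel _ _ _ p (relabel s) (relw N.+1))//; last by move=> e e' _ _ /pinj.
  by apply: (@resample_suppC _ _ p (relw N.+1)) => // w; rewrite mem_rball.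
- exact: uniq_rball.
- by rewrite map_inj_uniq// uniq_rball.
- move=> z z' h; apply: sf1 => w hw; apply: h => /=; apply/mapP; exists w => //.
  by rewrite mem_rball.
- by move=> w /mapP[w']; rewrite !mem_rball => hw ->; exact: relw_psi.
Qed.

Lemma stationary_Pe N f eta : supp (relw N) f ->
  resample p (fun=> 0) (rball N) (env_mean N f) eta = resample p (fun=> 0) (rball N) f eta.
Proof.
move=> sf; rewrite /env_mean resample_Er; last by move=> z; exact: bmfun_resample1.
rewrite (_ : (fun r => _) = fun=> resample p (fun=> 0) (rball N) f eta); first exact: unif_mean_cst.
apply/funext => r; rewrite resample_comp ?uniq_rball//; congr (resample _ _ _ _ _).
by apply/funext => e; rewrite mul0r.
Qed.

(** Comparing the constant family [r] with 0 bounds the distance to the stationary mean by [K * r].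
    The aim is a [K] that does not grow with the radius [N]. *)
Definition lipR N f K := forall rho rho0 (r : R), (forall e, 0 <= rho e <= 1) -> (forall e, 0 <= rho0 e <= 1) ->
  (forall e, `|rho e - rho0 e| <= r) -> forall eta,
  `|resample p rho (rball N) f eta - resample p rho0 (rball N) f eta| <= K * r.

Lemma lipR_fin N f c : (forall z, `|f z| <= c) -> exists2 K, 0 <= K & lipR N f K.
Proof.
move=> fc; have c0 : 0 <= c := le_trans (normr_ge0 _) (fc xpredT).
exists ((size (rball N))%:R * (2 * c)); first by rewrite !mulr_ge0.
move=> rho rho0 r ok ok0 hr eta; rewrite -mulrA.
by apply: (resample_lip_fin p01) => // e _.
Qed.

Definition gam : R := unif_mean mu (fun r => r).

Lemma gam_ge0 : 0 <= gam.
Proof. by apply: unif_mean_ge_cst => [|r /andP[]//]; exact: bmfun_id. Qed.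

Lemma gam_lt1 : gam < 1.
Proof.
apply: le_lt_trans (unif_mean_min_lt mu0 ltr01); apply: unif_mean_le; [exact: bmfun_id| |].
  by apply: bmfun_min; [exact: bmfun_cst|exact: bmfun_id].
by move=> r /andP[_ r1]; rewrite le_min r1 lexx.
Qed.

(** A gap multiplies both families by the same [r], hence their distance by [r], whose mean is
    [gam < 1]. *)
Lemma lipR_Pe N f K : 0 <= K -> lipR N f K -> lipR N (env_mean N f) (gam * K).
Proof.
move=> K0 lf rho rho0 r ok ok0 hr eta; rewrite /env_mean.
have b z : bmfun mu (fun r' => resample p (fun=> r') (rball N) f z) by exact: bmfun_resample1.
rewrite !resample_Er//.
have E1 rh : (fun r' : R => resample p rh (rball N) (resample p (fun=> r') (rball N) f) eta) =
   (fun r' => resample p (fun e => rh e * r') (rball N) f eta).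
  by apply/funext => r'; rewrite resample_comp ?uniq_rball.
rewrite !E1 -unif_meanB; [|exact: bmfun_resample|exact: bmfun_resample].
have bb : bmfun mu (fun r' => resample p (fun e => rho e * r') (rball N) f eta - resample p (fun e => rho0 e * r') (rball N) f eta).
  by apply: bmfunB; exact: bmfun_resample.
have key r' : 0 <= r' <= 1 -> `|resample p (fun e => rho e * r') (rball N) f eta - resample p (fun e => rho0 e * r') (rball N) f eta| <= K * r * r'.
  move=> /andP[r0 r1]; rewrite -mulrA; apply: lf => e.
  - by have /andP[a b'] := ok e; rewrite mulr_ge0//= mulr_ile1.
  - by have /andP[a b'] := ok0 e; rewrite mulr_ge0//= mulr_ile1.
  - by rewrite -mulrBl normrM (ger0_norm r0); apply: ler_wpM2r => //; exact: hr.
have bK c : bmfun mu (fun r' => c * r') by apply: bmfunM; [exact: bmfun_cst|exact: bmfun_id].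
rewrite (_ : gam * K * r = K * r * gam); last by ring.
rewrite ler_norml /gam -unif_meanZ; last exact: bmfun_id.
apply/andP; split.
  rewrite lerNl -mulN1r -unif_meanZ//.
  apply: unif_mean_le => // [|r' /key]; first by apply: bmfunM => //; exact: bmfun_cst.
  by rewrite mulN1r ler_norml => /andP[h1 h2]; lra.
by apply: unif_mean_le => // r' /key; rewrite ler_norml => /andP[].
Qed.

(** Only the [d] edges at the walker decide the move; they are separated off and cost [2 d c]. Given
    their states, a move merely relabels the other edges, which leaves the constant [K]
    unchanged. *)
Lemma lipR_Mv N f K c : 0 <= K -> supp (relw N) f -> (forall z, `|f z| <= c) -> lipR N f K ->
  lipR N.+1 (move_mean f) (K + d%:R * (2 * c)).
Proof.
move=> K0 sf fc lf rho rho0 r ok ok0 hr eta.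
pose Nb := [seq [:: s] | s <- iota 0 d]; pose rest := [seq w <- rball N.+1 | w \notin Nb].
have uNb : uniq Nb by rewrite map_inj_uniq ?iota_uniq// => a b [].
have urest : uniq rest by rewrite filter_uniq// uniq_rball.
have pe : perm_eq (rball N.+1) (Nb ++ rest).
  have h : perm_eq [seq w <- rball N.+1 | w \in Nb] Nb.
    apply: uniq_perm => //; first by rewrite filter_uniq// uniq_rball.
    move=> w; rewrite mem_filter mem_rball; case E: (w \in Nb) => //=.
    by move: E => /mapP[s]; rewrite mem_iota /= => sd ->; exact: relw_single.
  have pf : perm_eq (rball N.+1) ([seq x <- rball N.+1 | x \in Nb] ++ [seq x <- rball N.+1 | x \notin Nb]).
    by rewrite perm_sym perm_filterC.
  by apply: perm_trans pf _; rewrite perm_cat2r.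
rewrite !(resample_perm _ _ _ (uniq_rball _ _) pe) !resample_cat.
set G := resample p rho rest (move_mean f); set G0 := resample p rho0 rest (move_mean f).
rewrite -[X in `|X|](subrKA (resample p rho0 Nb G eta)) addrC mulrDl.
apply: le_trans (ler_normD _ _) _; apply: lerD; last first.
  rewrite -mulrA (_ : d%:R = (size Nb)%:R); last by rewrite size_map size_iota.
  apply: (resample_lip_fin p01) => [e _//|e _//|e _//|z].
  by apply: (resample_norm_le p01) => [e _//|]; exact: Mv_norm_le.
rewrite -resampleB; apply: (resample_norm_le p01) => [e _//|z].
rewrite /G /G0 /move_mean.
have RxM rh : resample p rh rest (fun om => d%:R^-1 * \sum_(s < d) f (seen_move om s)) z =
   d%:R^-1 * \sum_(s < d) resample p rh rest (fun om => f (seen_move om s)) z.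
  by rewrite resampleZ (resample_sum p rh rest _ (fun s : 'I_d => fun om => f (seen_move om s))).
rewrite !RxM -mulrBr -sumrB normrM ger0_norm ?invr_ge0// ler_pdivrMl//.
apply: le_trans (ler_norm_sum _ _ _) _.
rewrite mulr_natl -[X in _ *+ X](card_ord d) -sumr_const; apply: ler_sum => s _.
have nS : [:: val s] \notin rest.
  rewrite mem_filter negb_and negbK; apply/orP; left; apply/mapP; exists (val s) => //.
  by rewrite mem_iota /=.
have E1 rh : resample p rh rest (fun om => f (seen_move om s)) z =
   if z [:: val s] then resample p rh rest (fun om => f (fun w => om (relabel s w))) z else resample p rh rest f z.
  rewrite -(resample_if_fixed p rh _ _ _ nS); congr (resample _ _ _ _ _).
  by apply/funext => om; rewrite /seen_move; case: ifP.
have sfb := supp_rball sf.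
have ok1 (rh : seq nat -> R) (S : seq (seq nat)) : (forall e, 0 <= rh e <= 1) -> forall e, 0 <= (if e \in S then rh e else 1) <= 1.
  by move=> h e; case: ifP => // _; rewrite ler01 lexx.
have hr1 (rh rh0 : seq nat -> R) (S : seq (seq nat)) : (forall e, `|rh e - rh0 e| <= r) ->
   forall e, `|(if e \in S then rh e else 1) - (if e \in S then rh0 e else 1)| <= r.
  move=> h e; case: ifP => // _; rewrite subrr normr0.
  by apply: le_trans (h e).
rewrite !E1; case: ifP => _; last first.
  rewrite !(@resample_restrict _ p _ _ (rball N) rest) ?uniq_rball//.
  by apply: lf; [exact: ok1|exact: ok1|exact: hr1].
have pinj : injective (relabel s) by move=> w w' e; rewrite -(relabel_invol s w) e relabel_invol.
have E2 rh : resample p rh rest (fun om => f (fun w => om (relabel s w))) z =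
   resample p (fun x => rh (relabel s x)) (map (relabel s) rest) f (fun x => z (relabel s x)).
  rewrite -(@resample_relabel _ _ _ p (relabel s) (relw N))//; last by move=> e e' _ _ /pinj.
  by rewrite -map_comp map_id_in// => w _ /=; rewrite relabel_invol.
rewrite !E2 !(@resample_restrict _ p _ _ (rball N) (map (relabel s) rest)) ?uniq_rball ?map_inj_uniq//.
by apply: lf; [apply: ok1|apply: ok1|apply: hr1].
Qed.

End rel.

(** * Convergence of the expected gain to the stationary mean *)

Section ergodic.
Variables (R : realType) (d : nat) (p mu : R).
Hypothesis d0 : (0 < d)%N.
Hypothesis p01 : 0 <= p <= 1.
Hypothesis mu0 : 0 < mu.
Notation config := (seq nat -> bool).
Notation relw := (rel_word d).
Notation rball := (rel_ball d).
Notation Mv := (@move_mean R d).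
Notation Pe := (@env_mean R d p mu).
Variables (F : config -> R) (L : nat) (c : R).
Hypothesis sF : supp (relw L) F.
Hypothesis Fc : forall z, `|F z| <= c.
Let D0 : 0 < (d%:R : R). Proof. by rewrite ltr0n. Qed.
Let c0 : 0 <= c. Proof. exact: le_trans (Fc xpredT). Qed.

Definition cbar (om : config) : R := 2^-1 * F om + 2^-1 * Mv F om.

(** With a gap in front, this becomes [gain k]: the expected potential collected at attempt [k],
    counted from 0, as seen from the present environment. The radius grows by one with each move. *)
Fixpoint Gam (k : nat) : config -> R :=
  if k is k'.+1 then Mv (Pe (L.+1 + k') (Gam k')) else cbar.

Definition gain (k : nat) : config -> R := Pe (L.+1 + k) (Gam k).

(** The Bernoulli mean of [F]; [xpred0] is a placeholder, since every edge that [F] reads is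
    resampled. *)
Definition meanF : R := resample p (fun=> 0) (rball L) F xpred0.

Lemma supp_Gam k : supp (relw (L.+1 + k)) (Gam k).
Proof.
elim: k => [|k IH].
  rewrite addn0 => z z' h; rewrite /= /cbar (supp_Mv sF h); congr (_ * _ + _).
  by apply: sF => w hw; apply: h; exact: relw_mono hw.
by rewrite addnS; apply: supp_Mv; exact: supp_Pe.
Qed.

Lemma supp_Phi k : supp (relw (L.+1 + k)) (gain k).
Proof. by apply: supp_Pe; exact: supp_Gam. Qed.

Lemma Gam_norm_le k z : `|Gam k z| <= c.
Proof.
elim: k z => [|k IH] z.
  have := Fc z; have := Mv_norm_le d0 Fc z; rewrite /= /cbar !ler_norml => /andP[? ?] /andP[? ?].
  by apply/andP; split; lra.
by apply: Mv_norm_le => //; exact: Pe_norm_le.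
Qed.

Lemma Phi_norm_le k z : `|gain k z| <= c.
Proof. by apply: Pe_norm_le => //; exact: Gam_norm_le. Qed.

Lemma stationary_Gam k eta : resample p (fun=> 0) (rball (L.+1 + k)) (Gam k) eta = meanF.
Proof.
elim: k eta => [|k IH] eta.
  rewrite addn0 /= /cbar resample_lin (stationary_Mv p d0)// (_ : forall x : R, 2^-1 * x + 2^-1 * x = x); last by move=> x; lra.
  rewrite (resample_rball_mono p _ (leqnSn L) sF).
  by apply: (@resample_suppC _ _ p (relw L)) => // w; rewrite mem_rball.
rewrite addnS (stationary_Mv p d0); last by apply: supp_Pe; exact: supp_Gam.
rewrite (resample_rball_mono p _ (leqnSn _)); last by apply: supp_Pe; exact: supp_Gam.
by rewrite stationary_Pe//; exact: supp_Gam.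
Qed.

(** A gap followed by a move turns a constant [K] into [gam K + 2 d c], so all constants stay below
    the initial one plus [2 d c / (1 - gam)], although the supports grow. *)
Lemma lipR_Gam : exists2 K, 0 <= K & forall k, lipR d p (L.+1 + k) (Gam k) K.
Proof.
have [K0 K0p l0] := @lipR_fin R d p p01 (L.+1 + 0) (Gam 0) c (Gam_norm_le 0).
have g0 := gam_ge0 mu; have g1 := gam_lt1 mu0.
have e0 : 0 <= d%:R * (2 * c) / (1 - gam mu).
  by rewrite divr_ge0 ?mulr_ge0// subr_ge0 ltW.
pose K := K0 + d%:R * (2 * c) / (1 - gam mu).
have Kp : 0 <= K by rewrite addr_ge0.
exists K => //; elim=> [|k IH].
  move=> rho rho0 r ok ok0 hr eta; apply: le_trans (l0 _ _ r ok ok0 hr eta) _.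
  by apply: ler_wpM2r; [exact: le_trans (hr [::])|rewrite lerDl].
rewrite addnS => rho rho0 r ok ok0 hr eta.
have r0 : 0 <= r by exact: le_trans (hr [::]).
have sP : supp (relw (L.+1 + k)) (Pe (L.+1 + k) (Gam k)) by exact: supp_Phi.
have lP : lipR d p (L.+1 + k) (Pe (L.+1 + k) (Gam k)) (gam mu * K) by apply: lipR_Pe.
have := @lipR_Mv R d p d0 p01 (L.+1 + k) _ (gam mu * K) c (mulr_ge0 g0 Kp) sP (Phi_norm_le k)
  lP rho rho0 r ok ok0 hr eta.
move=> h; apply: le_trans h _; apply: ler_wpM2r => //.
have hX : d%:R * (2 * c) = d%:R * (2 * c) / (1 - gam mu) * (1 - gam mu).
  by rewrite divfK// gt_eqF// subr_gt0.
rewrite [in X in _ + X <= _]hX /K; move: (_ / _) => X.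
have : gam mu * K0 <= K0 by rewrite ler_piMl// ltW.
by lra.
Qed.

Lemma unif_mean_norm_le_fun (f g : R -> R) : bmfun mu f -> bmfun mu g -> (forall r, 0 <= r <= 1 -> `|f r| <= g r) ->
  `|unif_mean mu f| <= unif_mean mu g.
Proof.
move=> bf bg h; have bN : bmfun mu (fun r => -1 * g r) by apply: bmfunM => //; exact: bmfun_cst.
rewrite ler_norml -mulN1r -unif_meanZ//; apply/andP; split; apply: unif_mean_le => // r /h.
  by rewrite ler_norml mulN1r => /andP[].
by rewrite ler_norml => /andP[].
Qed.

(** Let [a] bound the distance of [gain k] to its mean. At the next index the distance is at most
    the average of [min a (K r)], which is below [a] by a fixed [del] as long as [a >= e]; finitely
    many such decrements lead to [e]. *)
Lemma Phi_cvg (e : R) : 0 < e -> exists m, forall om, `|gain m om - meanF| <= e.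
Proof.
move=> e0; have [K' K'0 lK] := lipR_Gam; pose K := K' + 1.
have K0 : 0 < K by rewrite ltr_wpDl.
pose del := e - unif_mean mu (fun r => Num.min e (K * r)).
have bmK : bmfun mu (fun r => K * r) by apply: bmfunM; [exact: bmfun_cst|exact: bmfun_id].
have bme a : bmfun mu (fun r => Num.min a (K * r)) by apply: bmfun_min => //; exact: bmfun_cst.
have del0 : 0 < del.
  rewrite subr_gt0 (_ : (fun r => _) = fun r => K * Num.min (e / K) r); last first.
    by apply/funext => r; rewrite minr_pMr ?ltW// mulrCA mulfV ?mulr1// gt_eqF.
  rewrite unif_meanZ; last by apply: bmfun_min; [exact: bmfun_cst|exact: bmfun_id].
  by rewrite -ltr_pdivlMl// [ltRHS]mulrC; apply: unif_mean_min_lt => //; exact: divr_gt0.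
have step a k : e <= a -> (forall om, `|gain k om - meanF| <= a) -> forall om, `|gain k.+1 om - meanF| <= a - del.
  move=> ea h om.
  have b1 : bmfun mu (fun r => resample p (fun=> r) (rball (L.+1 + k.+1)) (Gam k.+1) om) by exact: bmfun_resample1.
  rewrite /gain /env_mean -[X in _ - X](unif_mean_cst mu) -unif_meanB//; last exact: bmfun_cst.
  apply: (@le_trans _ _ (unif_mean mu (fun r => Num.min a (K * r)))).
    apply: unif_mean_norm_le_fun => //; first by apply: bmfunB => //; exact: bmfun_cst.
    move=> r /andP[r0 r1]; rewrite le_min; apply/andP; split.
      rewrite -[X in `|_ - X|](congr1 (fun g => g om) (resample_cst p (fun=> r) (rball (L.+1 + k.+1)) meanF)) -resampleB.
      apply: (resample_norm_le p01) => [w _|z]; first by rewrite r0.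
      rewrite (_ : _ - _ = Mv (fun z => gain k z - meanF) z); first exact: Mv_norm_le.
      rewrite /= /move_mean sumrB mulrBr; congr (_ - _).
      by rewrite sumr_const card_ord -[X in _ * X]mulr_natl mulKf// gt_eqF.
    rewrite -(stationary_Gam k.+1 om).
    apply: (@le_trans _ _ (K' * r)); last by apply: ler_wpM2r => //; rewrite lerDl.
    by apply: lK => // w; rewrite ?lexx ?ler01 ?r0 ?r1// subr0 ger0_norm.
  apply: (@le_trans _ _ (unif_mean mu (fun r => (a - e) + Num.min e (K * r)))).
    apply: unif_mean_le => //; first by apply: bmfunD => //; exact: bmfun_cst.
    by move=> r _; case: (leP a); case: (leP e); lra.
  by rewrite unif_meanD//; [rewrite unif_mean_cst /del; lra|exact: bmfun_cst].
apply: contrapT => nE.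
have H k : forall om, `|gain k om - meanF| <= 2 * c + e - k%:R * del.
  elim: k => [|k IH] om.
    rewrite mul0r subr0 -(stationary_Gam 0 om).
    apply: (@le_trans _ _ (c + c)); last by lra.
    apply: le_trans (ler_normB _ _) _; apply: lerD; first exact: Phi_norm_le.
    by apply: (resample_norm_le p01) => [w _|z]; [rewrite lexx ler01|exact: Gam_norm_le].
  rewrite [leRHS](_ : _ = (2 * c + e - k%:R * del) - del); last by rewrite -[k.+1]addn1 natrD; ring.
  apply: step => //.
  rewrite leNgt; apply/negP => lt; apply: nE; exists k => om'.
  by apply: le_trans (IH om') (ltW lt).
have hn := archi_boundP (divr_ge0 (addr_ge0 (mulr_ge0 (ler0n _ 2) c0) (ltW e0)) (ltW del0)).
set n := Num.Def.archi_bound _ in hn.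
have := le_trans (normr_ge0 _) (H n xpred0); apply/negP; rewrite -ltNge subr_lt0.
by rewrite -ltr_pdivrMr.
Qed.

End ergodic.

(** * The corrector and the exponential drift of the accumulated potential *)

Lemma expR_le_quad (R : realType) (t : R) : t <= 2^-1 -> expR t <= 1 + t + 2 * t ^+ 2.
Proof.
move=> t2; have h : 0 < 1 - t by lra.
rewrite -[expR t]invrK -expRN; apply: (@le_trans _ _ (1 - t)^-1).
  by rewrite lef_pV2 ?posrE ?expR_gt0//; exact: expR_ge1Dx.
rewrite -[leLHS]mul1r ler_pdivrMr//.
have := sqr_ge0 t; rewrite expr2 => t0.
have := mulr_ge0 t0 (_ : 0 <= 1 - 2 * t); lra.
Qed.

Section corrector.
Variables (R : realType) (d : nat) (p mu : R).
Hypothesis d0 : (0 < d)%N.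
Hypothesis p01 : 0 <= p <= 1.
Hypothesis mu0 : 0 < mu.
Notation config := (seq nat -> bool).
Notation relw := (rel_word d).
Notation rball := (rel_ball d).
Notation Mv := (@move_mean R d).
Notation Pe := (@env_mean R d p mu).
Variables (F : config -> R) (L : nat) (c : R).
Hypothesis sF : supp (relw L) F.
Hypothesis Fc : forall z, `|F z| <= c.
Notation Phi := (@gain R d p mu F L).
Notation meanF := (@meanF R d p F L).
Hypothesis mF0 : 0 < meanF.
Let D0 : 0 < (d%:R : R). Proof. by rewrite ltr0n. Qed.
Let c0 : 0 <= c. Proof. exact: le_trans (Fc xpredT). Qed.

(** A truncated solution of the Poisson equation for the potential; its defect is [gain m], which is
    nearly constant for large [m]. *)
Definition corr (m : nat) (om : config) : R := \sum_(j < m) Phi j om.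

Definition stepE (la : R) (m : nat) (z : config) : R :=
  d%:R^-1 * \sum_(s < d) expR (- la * ((F z + F (seen_move z s)) / 2 + corr m (seen_move z s))).

Lemma supp_corr m : supp (relw (L.+1 + m)) (corr m).
Proof.
move=> z z' h; apply: eq_bigr => j _; apply: supp_Phi => // w hw.
by apply: h; apply: relw_mono hw; rewrite leq_add2l ltnW.
Qed.

Lemma corr_norm_le m z : `|corr m z| <= m%:R * c.
Proof.
apply: le_trans (ler_norm_sum _ _ _) _.
rewrite mulr_natl -[X in _ *+ X](card_ord m) -sumr_const; apply: ler_sum => j _.
exact: Phi_norm_le.
Qed.

Lemma supp_stepE la m : supp (relw (L.+1 + m).+1) (stepE la m).
Proof.
move=> z z' h; rewrite /stepE; congr (_ * _); apply: eq_bigr => s _.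
have -> : F z = F z' by apply: sF => w hw; apply: h; apply: relw_mono hw; lia.
have -> : F (seen_move z s) = F (seen_move z' s).
  apply: (supp_mvr (ltn_ord s) sF) => w hw; apply: h; apply: relw_mono hw; lia.
by have -> := supp_mvr (ltn_ord s) (@supp_corr m) h.
Qed.

(* The sum telescopes, since one step of the environment turns [Phi j] into [Phi j.+1]. *)
Lemma Pe_corr m om N : (L.+1 + m <= N)%N ->
  Pe N (fun z => cbar d F z + Mv (corr m) z - corr m om) om = Phi m om.
Proof.
move=> mN; rewrite /env_mean.
have b f : bmfun mu (fun r => resample p (fun=> r) (rball N) f om) by exact: bmfun_resample1.
have Phi0 : unif_mean mu (fun r => resample p (fun=> r) (rball N) (cbar d F) om) = Phi 0 om.
  rewrite /gain /env_mean addn0; congr (unif_mean mu _); apply/funext => r.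
  rewrite (resample_rball_mono p _ (_ : L.+1 <= N)%N) ?(leq_trans _ mN) ?leq_addr//.
  by have := @supp_Gam R d p mu F L sF 0; rewrite addn0.
have PhiS j : (j < m)%N -> unif_mean mu (fun r => resample p (fun=> r) (rball N) (Mv (Phi j)) om) = Phi j.+1 om.
  move=> jm; rewrite /gain [in RHS]/env_mean; congr (unif_mean mu _); apply/funext => r.
  rewrite (resample_rball_mono p _ (_ : L.+1 + j.+1 <= N)%N)//; first by lia.
  by rewrite addnS; apply: supp_Mv; exact: supp_Phi.
have MvE z : Mv (corr m) z = \sum_(j < m) Mv (Phi j) z.
  by rewrite /move_mean /corr exchange_big/= mulr_sumr.
transitivity (unif_mean mu (fun r => (resample p (fun=> r) (rball N) (cbar d F) om +
    \sum_(j < m) resample p (fun=> r) (rball N) (Mv (Phi j)) om) - corr m om)).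
  congr (unif_mean mu _); apply/funext => r; rewrite resampleB resampleD.
  rewrite (congr1 (fun g => g om) (resample_cst p (fun=> r) (rball N) (corr m om))); congr (_ + _ - _).
  by rewrite (_ : Mv (corr m) = fun z => \sum_(j < m) Mv (Phi j) z) ?resample_sum//; apply/funext.
have bS : bmfun mu (fun r => \sum_(j < m) resample p (fun=> r) (rball N) (Mv (Phi j)) om).
  by apply: bmfun_sum => j.
rewrite unif_meanB; [|by apply: bmfunD|exact: bmfun_cst].
rewrite unif_meanD// unif_mean_cst unif_mean_sum// Phi0 (eq_bigr (fun j : 'I_m => Phi j.+1 om)); last by move=> j _; exact: PhiS.
rewrite /corr; elim: m {mN PhiS MvE bS} => [|m IH]; first by rewrite !big_ord0 addr0 subr0.
by rewrite !big_ord_recr/= addrA; move: IH; lra.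
Qed.

(** The exponential is expanded to second order around [corr m om]; the linear term averages to
    [gain m] by [Pe_corr]. *)
Lemma corr_step : exists m la, 0 < la /\ forall om N, (L.+1 + m < N)%N ->
  Pe N (stepE la m) om <= expR (- la * (3 / 4 * meanF)) * expR (- la * corr m om).
Proof.
have [m hm] := @Phi_cvg R d p mu d0 p01 mu0 F L c sF Fc (meanF / 8) (divr_gt0 mF0 (ltr0n _ 8)).
(* A bound for the absolute value of the exponent of one step, centred at [corr m om] and divided by
   [la]. *)
pose Y := c + 2 * (m%:R * c) + 1.
have mc : 0 <= m%:R * c by rewrite mulr_ge0.
have Y0 : 0 < Y by have c0' : 0 <= c := c0; rewrite /Y; lra.
(* The first bound puts the exponent in the range of [expR_le_quad]; the second makes the quadratic
   error at most [la * meanF / 8]. As [gain m] is within [meanF / 8] of the mean, three quarters of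
   the mean remain. *)
pose la := Num.min (2^-1 / Y) (meanF / (16 * Y ^+ 2)).
have Y2 : 0 < Y ^+ 2 by rewrite exprn_gt0.
have la0 : 0 < la by rewrite lt_min !divr_gt0// ?mulr_gt0.
have laY : la * Y <= 2^-1 by rewrite -ler_pdivlMr// ge_min lexx.
have laY2 : la * (16 * Y ^+ 2) <= meanF by rewrite -ler_pdivlMr ?mulr_gt0// ge_min lexx orbT.
exists m, la; split => // om N mN.
set G := corr m om.
have ptw z : stepE la m z <= expR (- la * G) *
   (1 + 2 * la ^+ 2 * Y ^+ 2 - la * (cbar d F z + Mv (corr m) z - G)).
  rewrite /stepE.
  have st (s : 'I_d) : expR (- la * ((F z + F (seen_move z s)) / 2 + corr m (seen_move z s))) <=
     expR (- la * G) * (1 + 2 * la ^+ 2 * Y ^+ 2 - la * ((F z + F (seen_move z s)) / 2 + corr m (seen_move z s) - G)).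
    set y := (F z + F (seen_move z s)) / 2 + corr m (seen_move z s) - G.
    have yY : `|y| <= Y.
      have := Fc z; have := Fc (seen_move z s); have := corr_norm_le m (seen_move z s); have := corr_norm_le m om.
      rewrite -/G /y !ler_norml /Y => /andP[? ?] /andP[? ?] /andP[? ?] /andP[? ?].
      by apply/andP; split; lra.
    rewrite (_ : - la * _ = - la * G + - la * y); last by rewrite /y; ring.
    rewrite expRD ler_pM2l ?expR_gt0//.
    have t2 : - la * y <= 2^-1.
      apply: le_trans laY; rewrite mulNr -mulrN; apply: ler_wpM2l; first exact: ltW.
      by move: yY; rewrite ler_norml => /andP[]; lra.
    apply: le_trans (expR_le_quad t2) _.
    have : y ^+ 2 <= Y ^+ 2 by rewrite -(real_normK (num_real y)) ler_pXn2r// nnegrE ltW.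
    move=> /(ler_wpM2l (sqr_ge0 la)); rewrite exprMn sqrrN; lra.
  apply: (@le_trans _ _ (d%:R^-1 * \sum_(s < d) (expR (- la * G) * (1 + 2 * la ^+ 2 * Y ^+ 2 - la * ((F z + F (seen_move z s)) / 2 + corr m (seen_move z s) - G))))).
    by rewrite ler_pM2l ?invr_gt0//; apply: ler_sum => s _; exact: st.
  rewrite -mulr_sumr mulrCA; apply/ler_wpM2l; first exact: expR_ge0.
  rewrite sumrB -mulr_sumr mulrBr [d%:R^-1 * (la * _)]mulrCA.
  have avgc (x : R) : d%:R^-1 * \sum_(s < d) x = x.
    by rewrite sumr_const card_ord -[X in _ * X]mulr_natl mulKf// gt_eqF.
  rewrite avgc lerD2l lerN2 ler_pM2l// sumrB mulrBr avgc lerD2r big_split/= mulrDr lerD2r.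
  rewrite -mulr_suml big_split/= mulrA mulrDr avgc /cbar /move_mean le_eqVlt; apply/orP; left; apply/eqP.
  by ring.
have b f : bmfun mu (fun r => resample p (fun=> r) (rball N) f om) by exact: bmfun_resample1.
set A := 1 + 2 * la ^+ 2 * Y ^+ 2 in ptw.
apply: (@le_trans _ _ (expR (- la * G) * (A - la * Phi m om))).
  rewrite -(@Pe_corr m om N (ltnW mN)) /env_mean.
  apply: (@le_trans _ _ (unif_mean mu (fun r => expR (- la * G) * (A - la * resample p (fun=> r) (rball N) (fun z => cbar d F z + Mv (corr m) z - G) om)))).
    apply: unif_mean_le => //.
      apply: bmfunM; first exact: bmfun_cst.
      by apply: bmfunB; [exact: bmfun_cst|apply: bmfunM => //; exact: bmfun_cst].
    move=> r r01; rewrite -resampleZ -{1}(congr1 (fun g => g om) (resample_cst p (fun=> r) (rball N) A)) -resampleB -resampleZ.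
    by apply: (resample_le p01).
  rewrite unif_meanZ; last by apply: bmfunB; [exact: bmfun_cst|apply: bmfunM => //; exact: bmfun_cst].
  rewrite unif_meanB; [|exact: bmfun_cst|by apply: bmfunM => //; exact: bmfun_cst].
  by rewrite unif_mean_cst unif_meanZ.
rewrite mulrC ler_pM2r ?expR_gt0//.
apply: le_trans (expR_ge1Dx _).
have := hm om; rewrite ler_norml => /andP[h1 h2].
have : la * (7 / 8 * meanF) <= la * Phi m om by apply: ler_wpM2l; [exact: ltW|lra].
have : la * (la * (16 * Y ^+ 2)) <= la * meanF by apply: ler_wpM2l => //; exact: ltW.
rewrite /A expr2; lra.
Qed.

End corrector.

(** * From the frame of the walker back to the tree: the lower tail *)

Section absolute.
Variables (R : realType) (d : nat) (p mu : R).
Hypothesis d0 : (0 < d)%N.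
Hypothesis p01 : 0 <= p <= 1.
Hypothesis mu0 : 0 < mu.
Notation config := (seq nat -> bool).
Notation relw := (rel_word d).
Notation rball := (rel_ball d).

Lemma seen_mvl N (f : config -> R) x z s : supp (relw N) f ->
  f (seen (letter_move x z s) z) = f (seen_move (seen x z) s).
Proof.
move=> sf; rewrite /letter_move /seen_move [seen x z [:: s]]/seen /=.
case: ifP => // _; apply: sf => w /and3P[rw _ _]; rewrite /seen.
by rewrite edge_at_act.
Qed.

(** [edge_at x] is injective on reduced words, so resampling the edges around [x] amounts to
    resampling their labels; the other edges of [B] average out. *)
Lemma resample_seen N (f : config -> R) (r : R) (B : seq (seq nat)) x eta : supp (relw N) f -> uniq B ->
  (forall w, relw N w -> edge_at x w \in B) ->
  resample p (fun=> r) B (fun z => f (seen x z)) eta = resample p (fun=> r) (rball N) f (seen x eta).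
Proof.
move=> sf uB hB.
have inj w w' : w \in rball N -> relw N w' -> edge_at x w' = edge_at x w -> w' = w.
  by rewrite mem_rball => /and3P[h _ _] /and3P[h' _ _]; exact: edge_at_inj.
rewrite (@resample_sub _ _ p (fun=> r) B (map (edge_at x) (rball N)))//.
- by rewrite (@resample_relabel _ _ _ p (edge_at x) (relw N)).
- rewrite map_inj_in_uniq ?uniq_rball// => w w' hw; rewrite mem_rball => hw' /esym e.
  by apply/esym; apply: inj.
- move=> z z' h; apply: sf => w hw; apply: h => /=; apply/mapP; exists w => //.
  by rewrite mem_rball.
- by move=> e /mapP[w]; rewrite mem_rball => hw ->; exact: hB.
Qed.

Variables (F : config -> R) (L : nat) (c : R).
Hypothesis sF : supp (relw L) F.
Hypothesis Fc : forall z, `|F z| <= c.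
Notation meanF := (@meanF R d p F L).
Hypothesis mF0 : 0 < meanF.

Definition phiL (la : R) (x : seq nat) (z : config) (y : seq nat) : R :=
  expR (- la * ((F (seen x z) + F (seen y z)) / 2)).

(** Induction on the number of remaining steps: the bound carries the factor [exp (- la * g)] at the
    current environment, and [corr_step] reproduces this factor with one more [q]. [B] has to
    contain the neighbourhood of every vertex within reach. *)
Lemma lower_tail : exists N la C, 0 < la /\ forall n (B : seq (seq nat)) eta, uniq B ->
  (forall x w, valid_Td d x -> (size x <= n)%N -> relw N w -> edge_at x w \in B) ->
  mean_weight p mu d B (nbr_move d) (phiL la) (fun=> 1) n [::] eta <= C * expR (- la * (3 / 4 * meanF)) ^+ n.
Proof.
have [m [la [la0 hstep]]] := @corr_step R d p mu d0 p01 mu0 F L c sF Fc mF0.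
pose N := (L.+1 + m).+1; exists N, la, (expR (2 * (la * (m%:R * c)))); split => // n B eta uB hB.
set q := expR (- la * (3 / 4 * meanF)) in hstep *.
have q0 : 0 < q by exact: expR_gt0.
set g := corr d p mu F L m in hstep.
have gb z : `|g z| <= m%:R * c by exact: corr_norm_le.
have sS : supp (relw N) (stepE d p mu F L la m) by exact: supp_stepE.
have sC : supp (relw (L.+1 + m)) g by exact: supp_corr.
have H k : forall x eta, valid_Td d x -> (size x + k <= n)%N ->
  mean_weight p mu d B (nbr_move d) (phiL la) (fun=> 1) k x eta <= expR (la * (m%:R * c)) * q ^+ k * expR (- la * g (seen x eta)).
  elim: k => [|k IH] x et vx sx.
    rewrite /= mulr1 -expRD -[leLHS]expR0 ler_expR.
    have := gb (seen x et); rewrite ler_norml => /andP[h1 h2].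
    have : la * g (seen x et) <= la * (m%:R * c) by apply: ler_wpM2l => //; exact: ltW.
    by lra.
  set K := expR (la * (m%:R * c)) * q ^+ k.
  have K0 : 0 <= K by rewrite mulr_ge0 ?expR_ge0// exprn_ge0// ltW.
  apply: (@le_trans _ _ (K * env_mean d p mu N (stepE d p mu F L la m) (seen x et))); last first.
    by rewrite exprSr mulrA -mulrA; apply: ler_wpM2l => //; apply: hstep.
  rewrite /env_mean -unif_meanZ; last exact: bmfun_resample1.
  apply: unif_mean_le; [exact: bmfun_resample1|by apply: bmfunM; [exact: bmfun_cst|exact: bmfun_resample1]|].
  move=> r r01; rewrite -(@resample_seen N _ r B x et sS uB); last first.
    by move=> w rw; apply: hB => //; apply: leq_trans sx; exact: leq_addr.
  rewrite -resampleZ; apply: (resample_le p01) => // z.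
  rewrite /stepE mulrCA; apply: ler_wpM2l; first by rewrite invr_ge0.
  pose f v := phiL la x z (if z (edge_of x v) then v else x) *
    mean_weight p mu d B (nbr_move d) (phiL la) (fun=> 1) k (if z (edge_of x v) then v else x) z.
  rewrite (sum_nbr f d0 vx) mulr_sumr; apply: ler_sum => s _; rewrite {}/f.
  rewrite -/(letter_move x z s) /phiL -!(seen_mvl x z s sF) -/g -(seen_mvl x z s sC).
  rewrite [- la * (_ + g _)]mulrDr [in leRHS]expRD [leRHS]mulrCA; apply: ler_wpM2l; first exact: expR_ge0.
  apply: IH; first exact: valid_mvl.
  rewrite /letter_move; case: ifP => _; last by apply: leq_trans sx; rewrite leq_add2l.
  by apply: leq_trans sx; rewrite addnS -addSn leq_add2r size_act.
apply: le_trans (H n [::] eta isT _) _ => //.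
rewrite mulrAC; apply: ler_wpM2r; first by rewrite exprn_ge0// ltW.
rewrite -expRD ler_expR.
have := gb (seen [::] eta); rewrite ler_norml => /andP[h1 h2].
have : la * (- (m%:R * c)) <= la * g (seen [::] eta) by apply: ler_wpM2l => //; exact: ltW.
by lra.
Qed.

End absolute.

(** * The mean of the potential *)

Section branching.
Variables (R : realType) (p : R) (b : nat) (nx : nat -> seq nat) (A : pred nat).
Notation config := (seq nat -> bool).
Hypothesis unx : forall s, A s -> uniq (nx s).
Hypothesis bnx : forall s, A s -> size (nx s) = b.
Hypothesis Anx : forall s t, A s -> t \in nx s -> A t.

(** Probability of an open path of length [n] going down from the root of the b-ary tree. *)
Fixpoint survival (n : nat) : R := if n is n'.+1 then 1 - (1 - p * survival n') ^+ b else 1.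

Lemma resample_prod_branch (S : seq (seq nat)) (ls : seq nat) (f : nat -> config -> R) eta : uniq ls ->
  (forall s, s \in ls -> supp (fun w => head 0%N w == s) (f s)) ->
  resample p (fun=> 0) S (fun om => \prod_(s <- ls) f s om) eta = \prod_(s <- ls) resample p (fun=> 0) S (f s) eta.
Proof.
elim: ls => [|s ls IH] => [_ _|/= /andP[nS uS] sf].
  rewrite big_nil (_ : (fun om => _) = fun=> 1) ?resample_cst//; apply/funext => om; by rewrite big_nil.
rewrite big_cons -IH//; last by move=> t tl; apply: sf; rewrite in_cons tl orbT.
rewrite -(@resample_prod _ _ p (fun w => head 0%N w == s)).
- by congr (resample _ _ _ _ _); apply/funext => om; rewrite big_cons.
- by apply: sf; rewrite mem_head.
- move=> z z' h; rewrite !big_seq; apply: eq_bigr => t tl; apply: (sf t) => [|w /eqP hw].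
    by rewrite in_cons tl orbT.
  by apply: h => /=; rewrite hw; apply/eqP => ts; rewrite -ts tl in nS.
Qed.

Lemma rword_nnil n ls w : rword nx n ls w -> w != [::].
Proof. by case: w => //; case: n. Qed.

(** The edge [[:: s]] and the longer words starting with [s] are disjoint sets of edges; stripping
    [s] turns the latter into a configuration at the next vertex, over the list [S'] of tails. *)
Lemma resample_brb_mb n : (forall s (S : seq (seq nat)) eta, A s -> uniq S ->
    (forall w, rword nx n (nx s) w -> w \in S) ->
    resample p (fun=> 0) S (fun om => (survives nx n (nx s) om)%:R) eta = survival n) ->
  forall s (S : seq (seq nat)) eta, A s -> uniq S -> [:: s] \in S ->
    (forall w, rword nx n (nx s) w -> s :: w \in S) ->
  resample p (fun=> 0) S (fun om => (survives_via nx n s om)%:R) eta = p * survival n.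
Proof.
move=> IH s S eta As uS sS hS.
rewrite (_ : (fun om => (survives_via nx n s om)%:R) = fun om => (om [:: s])%:R * (survives nx n (nx s) (fun w => om (s :: w)))%:R); last first.
  by apply/funext => om; rewrite /survives_via -mulnb natrM.
have sb (D : pred (seq nat)) : (forall w, rword nx n (nx s) w -> D (s :: w)) ->
    supp D (fun om => (survives nx n (nx s) (fun w => om (s :: w)))%:R : R).
  move=> hD z z' h; congr (_%:R); congr nat_of_bool; apply: survives_supp => w hw.
  exact: h (hD w hw).
rewrite (@resample_prod _ _ p (pred1 [:: s])); first last.
- by apply: sb => w /rword_nnil w0 /=; apply: contraNN w0 => /eqP[->].
- by move=> z z' h; rewrite h//=.
congr (_ * _).
  rewrite (@resample_sub _ _ p (fun=> 0) S [:: [:: s]])//.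
  - by rewrite /= /resample1 /upd eqxx /=; ring.
  - by move=> z z' h; rewrite h//= inE.
  - by move=> w; rewrite inE => /eqP ->.
pose S' := pmap (fun w : seq nat => if w is a :: w' then if a == s then Some w' else None else None) S.
have memS' w : (w \in S') = (s :: w \in S).
  rewrite mem_pmap; apply/mapP/idP => [[[|a w'] h]|h] //=.
    by case: eqP => // e [->]; rewrite -e.
  by exists (s :: w) => //; rewrite eqxx.
have uS' : uniq S'.
  apply: (@pmap_uniq _ _ _ (cons s)) => // -[|a w] //=.
  by case: eqP => [->|].
rewrite (@resample_sub _ _ p (fun=> 0) S (map (cons s) S'))//.
- rewrite (@resample_relabel _ _ _ p (cons s) xpredT _ S' (fun om => (survives nx n (nx s) om)%:R))//; last by move=> e e' _ _ [].
    by apply: IH => // w hw; rewrite memS'; exact: hS.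
  by move=> z z' h; congr (_%:R); congr nat_of_bool; apply: survives_supp => w _; exact: h.
- by rewrite map_inj_uniq// => ? ? [].
- by apply: sb => w hw /=; apply/mapP; exists w => //; rewrite memS'; exact: hS.
- by move=> w /mapP[w' h ->]; rewrite -memS'.
Qed.

(** Branches with different first letters read disjoint edges, so the probability that all of them
    fail is a product. *)
Lemma resample_brb n s (S : seq (seq nat)) eta : A s -> uniq S ->
  (forall w, rword nx n (nx s) w -> w \in S) ->
  resample p (fun=> 0) S (fun om => (survives nx n (nx s) om)%:R) eta = survival n.
Proof.
elim: n s S eta => [|n IH] s S eta As uS hS; first by rewrite resample_cst.
rewrite (_ : (fun om => _) = fun om => 1 - \prod_(t <- nx s) (1 - (survives_via nx n t om)%:R)); last first.
  apply/funext => om; rewrite survivesS; elim: (nx s) => [|t ts IHt] /=; first by rewrite big_nil subrr.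
  rewrite big_cons; case: (survives_via nx n t om) => /=; first by rewrite subrr mul0r subr0.
  by rewrite subr0 mul1r.
have rw t w : t \in nx s -> w == [::] \/ rword nx n (nx t) w -> rword nx n.+1 (nx s) (t :: w).
  by move=> ts /orP h; rewrite /= ts.
rewrite resampleB resample_cst resample_prod_branch ?unx//; last first.
  move=> t ts z z' h; congr (_ - _%:R); congr nat_of_bool; rewrite /survives_via h//=; congr (_ && _).
  by apply: survives_supp => w _; apply: h => /=.
rewrite /= -(bnx As); congr (1 - _).
have h t : t \in nx s -> resample p (fun=> 0) S (fun om => 1 - (survives_via nx n t om)%:R) eta = 1 - p * survival n.
  move=> ts; rewrite resampleB resample_cst (resample_brb_mb IH)//.
  - exact: (Anx As ts).
  - by apply: hS; apply: rw => //; left.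
  - by move=> w hw; apply: hS; apply: rw => //; right.
rewrite big_seq (eq_bigr _ h) -big_seq big_const_seq count_predT.
by elim: (size _) => //= k ->; rewrite exprS.
Qed.

End branching.

(** * Survival probabilities and the choice of the parameters *)

Section mean.
Variables (R : realType) (d : nat) (p : R).
Hypothesis d3 : (3 <= d)%N.
Hypothesis p01 : 0 <= p <= 1.
Notation config := (seq nat -> bool).
Notation relw := (rel_word d).
Notation rball := (rel_ball d).
Notation nx := (other_letters d).
Let d0 : (0 < d)%N. Proof. exact: leq_trans d3. Qed.
Let D0 : 0 < (d%:R : R). Proof. by rewrite ltr0n. Qed.

Lemma mem_other_letters s x : (x \in nx s) = (x < d)%N && (x != s).
Proof. by rewrite mem_filter mem_iota add0n andbC. Qed.

Lemma size_other_letters s : (s < d)%N -> size (nx s) = d.-1.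
Proof.
move=> sd; rewrite /other_letters size_filter (eq_count (a2 := predC (pred1 s)))//.
have := count_predC (pred1 s) (iota 0 d); rewrite size_iota count_uniq_mem ?iota_uniq// mem_iota add0n sd /=.
by lia.
Qed.

Lemma rword_relw n s w : (s < d)%N -> rword nx n (nx s) w -> relw n.+1 (s :: w) /\ relw n w.
Proof.
elim: n s w => [|n IH] s [|a w] //= sd /andP[]; rewrite mem_other_letters => /andP[ad as_] /orP[/eqP ->|/(IH _ _ ad)].
  by rewrite /rel_word /red /= sd ad eq_sym as_.
move=> [/and3P[/andP[_ /= h1] /= /andP[h2 h2'] h3] _].
by rewrite /rel_word /red /= eq_sym as_ h1 sd ad h2' !ltnS; move: h3; rewrite ltnS => ->.
Qed.

Lemma supp_mb n s : (s < d)%N -> supp (fun w => relw n.+1 w && (head 0%N w == s)) (fun om => (survives_via nx n s om)%:R : R).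
Proof.
move=> sd z z' h; congr (_%:R); congr nat_of_bool; rewrite /survives_via h ?relw_single//=.
congr (_ && _); apply: survives_supp => w hw; apply: h => /=; rewrite eqxx andbT.
by have [] := rword_relw sd hw.
Qed.

Lemma suppS (D D' : pred (seq nat)) (f : config -> R) : (forall w, D w -> D' w) -> supp D f -> supp D' f.
Proof. by move=> DD sf z z' h; apply: sf => w /DD; exact: h. Qed.

Notation Ex L f := (resample p (fun=> 0) (rball L) f xpred0).

Notation th := (survival p d.-1).

Lemma Ex_mb n L s : (s < d)%N -> (n < L)%N -> Ex L (fun om => (survives_via nx n s om)%:R) = p * th n.
Proof.
move=> sd nL; apply: (@resample_brb_mb _ p d.-1 nx (fun s => (s < d)%N)) => //.
- move=> t S eta td uS hS; apply: (@resample_brb _ p d.-1 nx (fun s => (s < d)%N)) => //.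
  + by move=> r _; rewrite filter_uniq// iota_uniq.
  + exact: size_other_letters.
  + by move=> r r' _; rewrite mem_other_letters => /andP[].
- exact: uniq_rball.
- by rewrite mem_rball; case: L nL => // L _; exact: relw_single.
- by move=> w hw; rewrite mem_rball; exact: relw_mono nL (rword_relw sd hw).1.
Qed.

Lemma th01 n : 0 <= th n <= 1.
Proof.
move: p01 => /andP[p0 p1].
elim: n => [|n /andP[h0 h1]] /=; first by rewrite ler01 lexx.
have a0 : 0 <= p * th n by rewrite mulr_ge0.
have a1 : p * th n <= 1 by rewrite mulr_ile1.
have h : 0 <= (1 - p * th n) ^+ d.-1 <= 1.
  by rewrite exprn_ge0 ?subr_ge0//= exprn_ile1// ?subr_ge0// gerBl.
by move: h => /andP[? ?]; apply/andP; split; lra.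
Qed.

Lemma th_decr n : th n.+1 <= th n.
Proof.
move: p01 => /andP[p0 p1].
elim: n => [|n IH]; first by have /andP[] := th01 1.
have h m : 0 <= 1 - p * th m.
  by have /andP[h0 h1] := th01 m; rewrite subr_ge0 mulr_ile1.
rewrite -[leLHS]/(1 - (1 - p * th n.+1) ^+ d.-1) -[leRHS]/(1 - (1 - p * th n) ^+ d.-1).
rewrite lerD2l lerN2; apply: lerXn2r; rewrite ?nnegrE ?h//.
by rewrite lerD2l lerN2 ler_wpM2l.
Qed.

(** Otherwise a sequence with values in [0, 1] would lose more than [e] at every step. *)
Lemma th_gap e : 0 < e -> exists n, th n - th n.+1 <= e.
Proof.
move=> e0; apply: contrapT => nE.
have H n : th n <= 1 - n%:R * e.
  elim: n => [|n IH]; first by rewrite mul0r subr0.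
  have : e < th n - th n.+1 by rewrite ltNge; apply/negP => h; apply: nE; exists n.
  by rewrite -[n.+1%:R]natr1; lra.
have hn := archi_boundP (ltW (divr_gt0 ltr01 e0)); set n := Num.Def.archi_bound _ in hn.
have /andP[h0 _] := th01 n; have := H n; move: hn; rewrite ltr_pdivrMr//; lra.
Qed.

Section mean_potential.
Variables (k : nat) (sg : R).
Hypothesis sg0 : 0 <= sg.
Notation F := (potential d k sg).

Lemma supp_potential : supp (relw k.+2) F.
Proof.
move=> z z' h.
have hm n s : (n <= k.+1)%N -> (s < d)%N -> survives_via nx n s z = survives_via nx n s z'.
  move=> nk sd; have := @supp_mb n s sd z z' _.
  have hh : (forall e, relw n.+1 e && (head 0%N e == s) -> z e = z' e).
    by move=> w /andP[hw _]; apply: h; exact: relw_mono hw.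
  by move=> /(_ hh) /eqP; rewrite eqr_nat; case: (survives_via _ _ _ z); case: (survives_via _ _ _ z').
have d1 : (1 < d)%N by exact: leq_trans d3.
rewrite /potential !hm//; congr (_ * (_ - _ - _)).
  by congr (_ * _); apply: eq_bigr => s _; rewrite hm.
by congr (_ * _); apply: eq_bigr => s _; rewrite !hm.
Qed.

Lemma potential_norm_le z : `|F z| <= sg + sg ^+ 2 + sg.
Proof.
have dV : d%:R^-1 * d%:R = 1 :> R by rewrite mulVf// gt_eqF.
have sumd (f : 'I_d -> R) : (forall s, 0 <= f s <= 1) -> 0 <= d%:R^-1 * \sum_(s < d) f s <= 1.
  move=> hf; rewrite mulr_ge0 ?invr_ge0 ?sumr_ge0//=; last by move=> s _; have /andP[] := hf s.
  rewrite ler_pdivrMl// mulr1 -[X in _ <= X%:R](card_ord d) -sumr_const.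
  by apply: ler_sum => s _; have /andP[] := hf s.
have h1 := sumd (fun s => (survives_via nx k.+1 s z)%:R) _.
have h2 := sumd (fun s => (survives_via nx k s z)%:R - (survives_via nx k.+1 s z)%:R) _.
have {}h1 : 0 <= d%:R^-1 * (\sum_(s < d) (survives_via nx k.+1 s z)%:R : R) <= 1.
  by apply: h1 => s; case: survives_via; rewrite ?ler01 ?lexx.
have {}h2 : 0 <= d%:R^-1 * (\sum_(s < d) ((survives_via nx k s z)%:R - (survives_via nx k.+1 s z)%:R) : R) <= 1.
  apply: h2 => s; have := @survives_via_mono nx k s z; case: (survives_via nx k.+1 s z) => [->//|_]; first by rewrite subrr lexx ler01.
  by rewrite subr0; case: survives_via; rewrite ?ler01 ?lexx.
rewrite /potential; set b := [&& _, _ & _]; move: h1 h2.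
set S1 := \sum_(s < d) _; set S2 := \sum_(s < d) _ => /andP[a1 b1] /andP[a2 b2].
have t0 : 0 <= sg / (1 + sg) <= sg.
  have s1 : 0 < 1 + sg by rewrite ltr_pwDl.
  rewrite divr_ge0 ?(ltW s1)//= ler_pdivrMr//.
  by have := sqr_ge0 sg; rewrite expr2; lra.
have di : 0 <= (d%:R^-1 : R) <= 1 by rewrite invr_ge0 ler0n invf_le1// ler1n.
have b01 : 0 <= d%:R^-1 * (sg / (1 + sg) * b%:R) <= sg.
  move: di t0 => /andP[? ?] /andP[t0 t1].
  have X0 : 0 <= sg / (1 + sg) * b%:R by rewrite mulr_ge0.
  rewrite mulr_ge0//=; apply: (@le_trans _ _ (sg / (1 + sg) * b%:R)); first by rewrite ler_piMl.
  by apply: le_trans t1; case: b X0 => _; rewrite ?mulr1 ?mulr0.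
have := sqr_ge0 sg => s2.
have c1 : 0 <= sg ^+ 2 * (d%:R^-1 * S1) <= sg ^+ 2 by rewrite mulr_ge0//= ler_piMr.
have c2 : 0 <= sg * (d%:R^-1 * S2) <= sg by rewrite mulr_ge0//= ler_piMr.
rewrite (_ : d%:R^-1 * _ = d%:R^-1 * (sg / (1 + sg) * b%:R) - sg ^+ 2 * (d%:R^-1 * S1) - sg * (d%:R^-1 * S2)); last by ring.
move: b01 c1 c2 => /andP[? ?] /andP[? ?] /andP[? ?].
by rewrite ler_norml; apply/andP; split; move: sg0; lra.
Qed.

Lemma meanF_potential : meanF d p F k.+2 = d%:R^-1 * (sg / (1 + sg) * (p * th k.+1) ^+ 3
   - sg ^+ 2 * (d%:R * (p * th k.+1)) - sg * (d%:R * (p * (th k - th k.+1)))).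
Proof.
have d1 : (1 < d)%N by exact: leq_trans d3.
rewrite /meanF /potential resampleZ !resampleB !resampleZ; congr (_ * (_ - _ - _)); congr (_ * _).
- rewrite (_ : (fun z => _) = fun om => \prod_(s <- [:: 0; 1; 2]%N) (survives_via nx k.+1 s om)%:R); last first.
    apply/funext => om; rewrite !big_cons big_nil mulr1 -!natrM.
    by rewrite !mulnb.
  rewrite resample_prod_branch//; last first.
    move=> s hs; have sd : (s < d)%N by move: hs; rewrite !inE => /or3P[] /eqP->.
    by apply: suppS (@supp_mb k.+1 s sd) => w /andP[].
  by rewrite !big_cons big_nil !Ex_mb// mulr1 -expr2 -exprS.
- rewrite (resample_sum p (fun=> 0) (rball k.+2) _ (fun s : 'I_d => fun z => (survives_via nx k.+1 s z)%:R)).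
  by rewrite (eq_bigr (fun=> p * th k.+1)) ?sumr_const ?card_ord ?mulr_natl// => s _; rewrite Ex_mb.
rewrite (resample_sum p (fun=> 0) (rball k.+2) _ (fun s : 'I_d => fun z => (survives_via nx k s z)%:R - (survives_via nx k.+1 s z)%:R)).
rewrite (eq_bigr (fun=> p * (th k - th k.+1))) ?sumr_const ?card_ord ?mulr_natl// => s _.
have kk : (k < k.+2)%N by lia.
by rewrite resampleB !Ex_mb// [RHS]mulrBr.
Qed.

End mean_potential.

Lemma potential_exists (y : R) : 0 < y <= 1 -> (forall n, y <= p * th n) ->
  exists k sg, 0 <= sg /\ y ^+ 5 / (8 * d%:R ^+ 2) <= meanF d p (potential d k sg) k.+2.
Proof.
move=> /andP[y0 y1] hy.
have dd : (3 : R) <= d%:R by rewrite ler_nat.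
(* With this value the term in [sg ^+ 2] equals [sg * x * y ^+ 2 / 4], at most a quarter of
   [sg * x ^+ 3], for [x] the survival probability of one branch. *)
pose sg := y ^+ 2 / (4 * d%:R).
have y2 : 0 < y ^+ 2 by rewrite exprn_gt0.
have y3 : 0 < y ^+ 3 by rewrite exprn_gt0.
have sg0 : 0 < sg by rewrite divr_gt0// mulr_gt0.
have sgd : sg * d%:R = y ^+ 2 / 4 by rewrite /sg; field; rewrite gt_eqF.
have sg12 : sg <= 12^-1.
  have : y ^+ 2 <= 1 by rewrite exprn_ile1// ltW.
  have : sg * 3 <= sg * d%:R by apply: ler_wpM2l => //; exact: ltW.
  by rewrite sgd; lra.
(* The dying branches then cost at most [sg * y ^+ 3 / 6]. As [1 - sg >= 11 / 12] and
   [11 / 12 - 1 / 4 - 1 / 6 = 1 / 2], half of [sg * y ^+ 3] is left. *)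
have [k hk] := @th_gap (y ^+ 3 / (6 * d%:R)) (divr_gt0 y3 (mulr_gt0 (ltr0n _ 6) D0)).
exists k, sg; split; first exact: ltW.
rewrite meanF_potential; last exact: ltW.
set x := p * th k.+1; set g := p * (th k - th k.+1).
have x1 : y <= x by exact: hy.
have g1 : d%:R * g <= y ^+ 3 / 6.
  have /andP[p0 p1] := p01.
  apply: (@le_trans _ _ (d%:R * (y ^+ 3 / (6 * d%:R)))).
    apply: ler_wpM2l => //; apply: le_trans hk.
    by rewrite ler_piMl// subr_ge0 th_decr.
  by rewrite le_eqVlt; apply/orP; left; apply/eqP; field; rewrite gt_eqF.
rewrite (_ : y ^+ 5 / _ = d%:R^-1 * (sg * (y ^+ 3 / 2))); last first.
  by rewrite /sg; field; rewrite gt_eqF.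
rewrite ler_pM2l ?invr_gt0//.
have t1 : sg * (1 - sg) <= sg / (1 + sg).
  rewrite ler_pdivlMr; last lra.
  by rewrite -mulrA ler_piMr ?(ltW sg0)//; have := sqr_ge0 sg; rewrite expr2; lra.
have x0 : 0 < x by exact: lt_le_trans x1.
have x2 : y ^+ 2 <= x ^+ 2 by rewrite ler_pXn2r// nnegrE ltW.
have h1 : sg * (1 - sg) * x ^+ 3 <= sg / (1 + sg) * x ^+ 3 by apply: ler_wpM2r t1; rewrite exprn_ge0// ltW.
have h2 : sg * (d%:R * g) <= sg * (y ^+ 3 / 6) by apply: ler_wpM2l => //; exact: ltW.
have h3 : sg ^+ 2 * (d%:R * x) = sg * (x * (y ^+ 2 / 4)) by rewrite -sgd; ring.
have h4 : sg * (x * y ^+ 2 * (2 / 3)) <= sg * ((1 - sg) * x ^+ 3 - x * (y ^+ 2 / 4)).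
  apply: ler_wpM2l; first exact: ltW.
  have : (11 / 12) * (x * y ^+ 2) <= (1 - sg) * (x * x ^+ 2).
    by apply: ler_pM; [lra|rewrite mulr_ge0// ltW|lra|apply: ler_wpM2l => //; exact: ltW].
  by rewrite -exprS; lra.
have h5 : sg * (y ^+ 3 * (2 / 3)) <= sg * (x * y ^+ 2 * (2 / 3)).
  apply: ler_wpM2l; first exact: ltW.
  by apply: ler_wpM2r; [lra|rewrite exprS; apply: ler_wpM2r => //; exact: ltW].
by rewrite h3; lra.
Qed.

End mean.

(** * The jump chain *)

Section neighbours.
Variable d : nat.
Hypothesis d0 : (0 < d)%N.

Lemma valid_nbr v j : valid_Td d v -> valid_Td d (nbr d v j).
Proof.
move=> vv; have [jd|dj] := ltnP j d; last by rewrite /nbr dj.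
case: v vv => [|a s] vv; first by rewrite nbr_root //= jd.
case: j jd => [|j] jd; first by rewrite nbr_parent//; exact: valid_parent.
by rewrite nbr_child// valid_rcons//; rewrite vv /=; lia.
Qed.

Lemma size_nbr v j : (size (nbr d v j) <= (size v).+1)%N.
Proof.
rewrite /nbr; case: ifP => // _; case: v => // a s; case: ifP => _; last by rewrite size_rcons.
by rewrite size_take; case: ifP => //= _; lia.
Qed.

(** Edges are named by their far end, so this asks for all edges of the ball of radius [n] around
    the root. *)
Definition closedB (B : seq (seq nat)) (n : nat) := forall e, valid_Td d e -> (size e <= n)%N -> e \in B.

Lemma nbr_move_ext B n x z z' j : valid_Td d x -> (size x < n)%N -> closedB B n ->
  {in B, z =1 z'} -> nbr_move d x z j = nbr_move d x z' j.
Proof.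
move=> vx sx cB zz; rewrite /nbr_move zz//; apply: cB.
  by rewrite /edge_of; case: ifP => // _; exact: valid_nbr.
by rewrite /edge_of; case: ifP => // _; [exact: leq_trans (size_nbr _ _) _|exact: ltnW].
Qed.

Lemma valid_mvd x z j : valid_Td d x -> valid_Td d (nbr_move d x z j).
Proof. by move=> vx; rewrite /nbr_move; case: ifP => // _; exact: valid_nbr. Qed.

Lemma size_mvd x z j : (size (nbr_move d x z j) <= (size x).+1)%N.
Proof. by rewrite /nbr_move; case: ifP => // _; exact: size_nbr. Qed.

End neighbours.

(** * The jump chain restarted at its first attempt *)

Section chain.
Variables (R : realType) (dO : measure_display) (O : measurableType dO) (d : nat) (p mu : R).
Hypothesis d0 : (0 < d)%N.
Hypothesis mu0 : 0 < mu.
Notation config := (seq nat -> bool).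
Implicit Types (U : dyn_index -> O -> R) (eta : config) (w : O).

Definition in01 U w := forall i, 0 < U i w <= 1.

Definition refreshing U w := forall e (M : R), exists n, M < refresh_sum mu U e n.+1 w.

Lemma gapf_ge0' U w e k : in01 U w -> 0 <= gapf mu U e k w.
Proof.
move=> h; apply: divr_ge0; last exact: ltW.
by rewrite oppr_ge0; apply: ln_le0; have /andP[_] := h (inl (e, k, false)).
Qed.

Lemma refresh_sum_le' U w e m n : in01 U w -> (m <= n)%N -> refresh_sum mu U e m w <= refresh_sum mu U e n w.
Proof.
move=> h /subnK <-; elim: (n - m)%N => // k IH.
by rewrite addSn refresh_sumS; apply: le_trans IH _; rewrite lerDl gapf_ge0'.
Qed.

Lemma env_interval U eta w e j t : in01 U w -> refresh_sum mu U e j w <= t < refresh_sum mu U e j.+1 w ->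
  env p mu eta U t e w = if j is k.+1 then refresh_open p U e k w else eta e.
Proof.
move=> h /andP[t1 t2]; rewrite /env; case: pselect => [ex|nex]; last first.
  by case: nex; exists j; rewrite refreshE.
case: ex_minnP => m; rewrite refreshE => hm mmin.
suff -> : m = j by case: (j).
have [mj|jm|//] := ltngtP m j.
  by exfalso; have := refresh_sum_le' e h mj; move: hm t1; lra.
by have := mmin j; rewrite refreshE => /(_ t2); rewrite leqNgt jm.
Qed.

Lemma interval_ex U w e t : refreshing U w -> 0 <= t ->
  exists j, refresh_sum mu U e j w <= t < refresh_sum mu U e j.+1 w.
Proof.
move=> rf t0; have ex : exists n, t < refresh_sum mu U e n.+1 w := rf e t.
exists (ex_minn ex); case: ex_minnP => m hm mmin; rewrite hm andbT.
case: m hm mmin => [|m] hm mmin; first by rewrite refresh_sum0.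
by rewrite leNgt; apply/negP => /mmin; rewrite ltnn.
Qed.

Lemma env_ext U U' eta t e w : (forall i, U i w = U' i w) -> env p mu eta U t e w = env p mu eta U' t e w.
Proof.
move=> h.
pose ev (f : nat -> R) (g : nat -> bool) := match pselect (exists n, t < f n) with
  | left h => match @ex_minn (fun n => t < f n) h with 0%N => eta e | k.+1 => g k end
  | right _ => eta e end.
rewrite -[LHS]/(ev (fun n => refresh_time mu U e n w) (fun k => refresh_open p U e k w)).
rewrite -[RHS]/(ev (fun n => refresh_time mu U' e n w) (fun k => refresh_open p U' e k w)).
congr (ev _ _); apply/funext => n; last by rewrite /refresh_open h.
by apply: eq_bigr => k _; rewrite h.
Qed.

Lemma walk_time_ext U U' k w : (forall i, U i w = U' i w) -> walk_time U k w = walk_time U' k w.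
Proof. by move=> h; apply: eq_bigr => i _; rewrite h. Qed.

Lemma jump_chain_ext U U' eta k w : (forall i, U i w = U' i w) ->
  jump_chain d p mu eta U k w = jump_chain d p mu eta U' k w.
Proof.
move=> h; elim: k => //= k ->; rewrite (walk_time_ext k h) (env_ext eta _ _ h).
by rewrite /walk_choice h.
Qed.

Fixpoint chain_from (x : seq nat) eta U (k : nat) w : seq nat :=
  if k is k'.+1 then
    nbr_move d (chain_from x eta U k' w) (fun e => env p mu eta U (walk_time U k' w) e w) (walk_choice d U k' w)
  else x.

Lemma jump_chainE eta U k w : jump_chain d p mu eta U k w = chain_from [::] eta U k w.
Proof. by elim: k => //= k ->. Qed.

Lemma walk_time_ge0 U k w : in01 U w -> 0 <= walk_time U k w.
Proof.
move=> h; apply: sumr_ge0 => i _; rewrite oppr_ge0; apply: ln_le0.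
by have /andP[_] := h (inr (val i, false)).
Qed.

Lemma shifted_in01 U w : in01 U w -> in01 (shifted mu U) w.
Proof.
move=> h [[[e [|k]] [|]]|[k fl]] /=; try exact: h.
by rewrite lt_min ltr01 expR_gt0 ge_min lexx.
Qed.

Lemma walk_time_shU U k w : walk_time U k.+1 w = tau U w + walk_time (shifted mu U) k w.
Proof. by rewrite tauE /walk_time big_ord_recl. Qed.

Lemma refresh_count_interval U w e : in01 U w -> refreshing U w ->
  refresh_sum mu U e (refresh_count mu U e w) w <= tau U w < refresh_sum mu U e (refresh_count mu U e w).+1 w.
Proof.
move=> h rf; have ex : hasN mu U e w by have [n hn] := rf e (tau U w); exists n; rewrite refreshE.
rewrite /refresh_count; case: pselect => // ex'; case: ex_minnP => m; rewrite refreshE => hm mmin.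
rewrite hm andbT; case: m hm mmin => [|m] hm mmin; first by rewrite refresh_sum0; exact: walk_time_ge0.
by rewrite leNgt; apply/negP => hh; have := mmin m; rewrite refreshE => /(_ hh); rewrite ltnn.
Qed.

(** The first shifted gap is the residual time up to the next refresh: [ln] undoes the exponential,
    and the cap at 1 is inactive because that time is nonnegative. *)
Lemma refresh_sum_shU U w e k : in01 U w -> refreshing U w ->
  refresh_sum mu (shifted mu U) e k.+1 w = refresh_sum mu U e (refresh_count mu U e w + k.+1)%N w - tau U w.
Proof.
move=> h rf; elim: k => [|k IH].
  rewrite refresh_sumS refresh_sum0 add0r addn1 /gapf /=.
  have /andP[t1 t2] := refresh_count_interval e h rf.
  rewrite (min_idPr _); last first.
    by rewrite -[leRHS]expR0 ler_expR mulNr oppr_le0 mulr_ge0 ?subr_ge0// ltW.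
  by rewrite expRK; field; rewrite gt_eqF.
by rewrite refresh_sumS IH [(_ + k.+2)%N]addnS refresh_sumS addrAC.
Qed.

Lemma shifted_refreshing U w : in01 U w -> refreshing U w -> refreshing (shifted mu U) w.
Proof.
move=> h rf e M; have [n hn] := rf e (M + tau U w); exists n.
rewrite refresh_sum_shU// ltrBrDr; apply: lt_le_trans hn _; apply: refresh_sum_le' => //; exact: leq_addl.
Qed.

Definition env1 eta U w : config := fun e => env p mu eta U (tau U w) e w.

(** Until its next refresh an edge keeps the state it had at the attempt, which is the initial state
    of the restarted environment; afterwards the same coin decides on both sides. *)
Lemma env_shU U eta t w : in01 U w -> refreshing U w -> 0 <= t ->
  (fun e => env p mu eta U (tau U w + t) e w) = (fun e => env p mu (env1 eta U w) (shifted mu U) t e w).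
Proof.
move=> h rf t0; apply/funext => e.
have h' := shifted_in01 h; have rf' := shifted_refreshing h rf.
have [j hj] := interval_ex e rf' t0.
rewrite (env_interval _ h' hj).
have Nh := refresh_count_interval e h rf.
case: j hj => [|k] /andP[h1 h2].
  rewrite /env1 (env_interval _ h Nh); apply: env_interval => //.
  move: h2 Nh; rewrite refresh_sum_shU// addn1 => h2 /andP[h3 h4].
  by apply/andP; split; lra.
rewrite (@env_interval _ _ _ _ (refresh_count mu U e w + k).+1)//.
  by rewrite /refresh_open; case: (k).
move: h1 h2; rewrite !refresh_sum_shU// !addnS => h1 h2.
by apply/andP; split; lra.
Qed.

(** The definition adds attempts at the end; this moves the first attempt to the front, as in the
    recursion of [path_weight]. *)
Lemma chain_fromS x eta U k w : in01 U w -> refreshing U w ->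
  chain_from x eta U k.+1 w =
  chain_from (nbr_move d x (env1 eta U w) (walk_choice d U 0 w)) (env1 eta U w) (shifted mu U) k w.
Proof.
move=> h rf; elim: k => [//|k IH].
rewrite -[LHS]/(nbr_move d (chain_from x eta U k.+1 w) (fun e => env p mu eta U (walk_time U k.+1 w) e w) (walk_choice d U k.+1 w)).
rewrite IH walk_time_shU env_shU//.
by apply: walk_time_ge0; exact: shifted_in01.
Qed.

Lemma valid_chain_from x eta U k w : valid_Td d x -> valid_Td d (chain_from x eta U k w).
Proof. by move=> vx; elim: k => //= k IH; exact: valid_mvd. Qed.

Lemma size_chain_from x eta U k w : (size (chain_from x eta U k w) <= size x + k)%N.
Proof.
elim: k => [|k IH] /=; first by rewrite addn0.
by apply: leq_trans (size_mvd d0 _ _ _) _; rewrite addnS.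
Qed.

Lemma chain_from_ext B n x eta eta' U k w : valid_Td d x -> (size x + k <= n)%N -> closedB d B n ->
  {in B, eta =1 eta'} -> chain_from x eta U k w = chain_from x eta' U k w.
Proof.
move=> vx sx cB ee; elim: k sx => //= k IH sx; rewrite IH; last by lia.
apply: (@nbr_move_ext d d0 B n) => //; first exact: valid_chain_from.
  by apply: leq_ltn_trans (size_chain_from _ _ _ _ _) _; lia.
by move=> e eB; rewrite /env ee.
Qed.

End chain.

Section Wfchain.
Variables (R : realType) (dO : measure_display) (O : measurableType dO) (d : nat) (p mu : R).
Hypothesis d0 : (0 < d)%N.
Hypothesis mu0 : 0 < mu.
Variable (B : seq (seq nat)).

(** During [n] attempts only edges within distance [N] of the root are read, and on these
    [attempt_env] is the true environment. *)
Lemma path_weight_chain_from (psi : seq nat -> R) N n x eta (U : dyn_index -> O -> R) w :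
  in01 U w -> refreshing mu U w -> valid_Td d x -> (size x + n <= N)%N -> closedB d B N ->
  path_weight p mu d B (nbr_move d) (fun _ _ _ => 1) psi n x eta U w = psi (chain_from d p mu x eta U n w).
Proof.
elim: n x eta U => [//|n IH] x eta U h rf vx sx cB.
have zz : {in B, attempt_env p mu U B eta w =1 env1 p mu eta U w} by move=> e eB; rewrite /attempt_env eB.
rewrite chain_fromS// /= mul1r IH//; first last.
- by have := size_mvd d0 x (attempt_env p mu U B eta w) (walk_choice d U 0 w); move: sx; lia.
- exact: valid_mvd.
- exact: shifted_refreshing.
- exact: shifted_in01.
rewrite -(@nbr_move_ext d d0 B N x (attempt_env p mu U B eta w) (env1 p mu eta U w) (walk_choice d U 0 w) vx _ cB zz); last by lia.
congr (psi _); apply: (@chain_from_ext R dO O d p mu d0 mu0 B N) => //; first exact: valid_mvd.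
by have := size_mvd d0 x (attempt_env p mu U B eta w) (walk_choice d U 0 w); move: sx; lia.
Qed.

(* The three weights of one trajectory: they only differ by a power of [expR S], [S] the accumulated potential. *)
Lemma path_weight_tilt (F : seq nat -> (seq nat -> bool) -> seq nat -> R) (la : R) n x eta (U : dyn_index -> O -> R) w :
  exists S, (forall psi, path_weight p mu d B (nbr_move d) (fun x z y => expR (F x z y)) psi n x eta U w =
       expR S * path_weight p mu d B (nbr_move d) (fun _ _ _ => 1) psi n x eta U w) /\
     path_weight p mu d B (nbr_move d) (fun x z y => expR (- la * F x z y)) (fun=> 1) n x eta U w = expR (- la * S).
Proof.
elim: n x eta U => [|n IH] x eta U.
  by exists 0; split => [psi|] /=; rewrite ?mulr0 expR0 ?mul1r.
set z := attempt_env p mu U B eta w; set y := nbr_move d x z (walk_choice d U 0 w).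
have [S [h1 h2]] := IH y z (shifted mu U).
exists (F x z y + S); split => [psi|] /=; rewrite -/z -/y.
  by rewrite h1 expRD mul1r mulrA.
by rewrite h2 -expRD mulrDr.
Qed.

End Wfchain.

(** * Borel-Cantelli and attempt times *)

Section BC.
Variables (R : realType) (dO : measure_display) (O : measurableType dO).
Variable Q : {measure set O -> \bar R}.

Lemma expect_le (f g : O -> R) : measurable_fun setT f -> (forall w, 0 <= f w) ->
  measurable_fun setT g -> (forall w, f w <= g w) -> (expect Q f <= expect Q g)%E.
Proof.
move=> mf f0 mg fg; apply: ge0_le_integral => //.
- by move=> w _; rewrite lee_fin.
- exact/measurable_EFinP.
- exact/measurable_EFinP.
- by move=> w _; rewrite lee_fin.
Qed.

(** Markov inequality at level 1, then Borel-Cantelli with a geometric series. *)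
Lemma eventually_lt1 (f : nat -> O -> R) (C rho : R) :
  (forall n, measurable_fun setT (f n)) -> (forall n w, 0 <= f n w) -> 0 <= C -> 0 <= rho < 1 ->
  (forall n, (expect Q (f n) <= (C * rho ^+ n)%:E)%E) ->
  exists N, [/\ measurable N, Q N = 0%E &
    forall w, ~ N w -> exists n0, forall n, (n0 <= n)%N -> f n w < 1].
Proof.
move=> mf f0 C0 /andP[r0 r1] hE.
pose F n := [set w | 1 <= f n w].
have mb n : measurable_fun setT (fun w => 1 <= f n w) by apply: measurable_fun_ler.
have mF n : measurable (F n).
  by have := mb n measurableT [set true] Logic.I; rewrite setTI.
have FE n : (Q (F n) <= (C * rho ^+ n)%:E)%E.
  apply: le_trans (hE n); rewrite -expect_ind//; apply: expect_le => //.
  - exact: measurable_nR.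
  - by move=> w; case: (leP 1 (f n w)).
exists (lim_sup_set F); split.
- by apply: bigcapT_measurable => n; exact: bigcup_measurable.
- apply: lim_sup_set_cvg0 => //.
  apply: (@le_lt_trans _ _ ((C / (1 - rho))%:E)); last exact: ltry.
  apply: lime_le; first by apply: is_cvg_nneseries => *; exact: measure_ge0.
  apply: nearW => n; apply: (@le_trans _ _ (\sum_(0 <= k < n) (C * rho ^+ k)%:E)%E).
    by apply: lee_sum => k _.
  rewrite sumEFin lee_fin -mulr_sumr; apply: ler_wpM2l => //.
  rewrite -[leRHS]mul1r ler_pdivlMr ?subr_gt0//.
  rewrite big_mkord mulrC -{1}(opprB rho 1) mulNr -subrX1 opprB lerBlDr lerDl.
  exact: exprn_ge0.
- move=> w nN; apply: contrapT => h; apply: nN => n _.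
  apply: contrapT => h'; apply: h; exists n => m nm; rewrite ltNge; apply/negP => f1.
  by apply: h'; exists m.
Qed.

End BC.

(** * A linear bound on the attempt times *)

Section times.
Variables (R : realType) (dO : measure_display) (O : measurableType dO).
Variable Q : {measure set O -> \bar R}.
Variable U : dyn_index -> O -> R.
Hypothesis iU : iid_measure Q U.
Hypothesis U01 : forall i w, 0 < U i w <= 1.
Let mU : forall i, measurable_fun setT (U i) := iU.2.1.

(* A simple function dominating [u ^ (-1/2)] away from 0. *)
Definition Hs (N : nat) (u : R) : R := 2 + \sum_(j < N) 2 ^+ j.+1 * (u <= 4^-1 ^+ j.+1)%R%:R.

Lemma Hs_ge2 N u : 2 <= Hs N u.
Proof. by rewrite lerDl; apply: sumr_ge0 => j _; rewrite mulr_ge0// exprn_ge0. Qed.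

Lemma Hs_ge0 N u : 0 <= Hs N u.
Proof. by apply: le_trans (Hs_ge2 N u). Qed.

Lemma Hs_sqr N u : 4^-1 ^+ N.+1 < u -> 1 <= u * Hs N u ^+ 2.
Proof.
elim: N => [|N IH] hu.
  by rewrite /Hs big_ord0 addr0 expr2; move: hu; rewrite expr1; lra.
have u0 : 0 < u by apply: lt_trans hu; rewrite exprn_gt0.
have [h|h] := ltP (4^-1 ^+ N.+1) u.
  apply: le_trans (IH h) _; rewrite ler_pM2l// ler_pXn2r ?nnegrE ?Hs_ge0//.
  by rewrite /Hs big_ord_recr/= addrA lerDl mulr_ge0// exprn_ge0.
have -> : Hs N.+1 u = 2 ^+ N.+2.
  rewrite /Hs (eq_bigr (fun j : 'I_N.+1 => 2 ^+ j.+1)); last first.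
    move=> j _; rewrite (_ : (u <= _) = true) ?mulr1//; apply: le_trans h _.
    apply: ler_wiXn2l; [lra|lra|exact: ltn_ord].
  elim: (N.+1) => [|k IHk]; first by rewrite big_ord0 addr0 expr1.
  by rewrite big_ord_recr/= addrA IHk [RHS]exprS; ring.
rewrite -exprM mulnC exprM (_ : 2 ^+ 2 = 4); last by rewrite expr2; ring.
by rewrite -ler_pdivrMr ?exprn_gt0// mul1r -exprVn ltW.
Qed.

Lemma measurable_Hs N : measurable_fun setT (Hs N).
Proof.
apply: measurable_funD; first exact: measurable_cst.
apply: measurable_sum => j; apply: measurable_funM; first exact: measurable_cst.
by apply: measurable_nR; exact: measurable_fun_ler.
Qed.

(** The mean of [Hs N] under the uniform law; the geometric series keeps it below 3 for every
    [N]. *)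
Definition hN N : R := 2 + \sum_(j < N) 2 ^+ j.+1 * 4^-1 ^+ j.+1.

Lemma hN_le N : hN N <= 3.
Proof.
have p0 m : 0 <= (2^-1 : R) ^+ m by apply: exprn_ge0; lra.
suff : hN N + 2^-1 ^+ N <= 3 by have := p0 N; lra.
rewrite /hN; elim: N => [|N IH]; first by rewrite big_ord0 expr0; lra.
have e : 2 ^+ N.+1 * 4^-1 ^+ N.+1 = 2^-1 ^+ N.+1 :> R.
  by rewrite -exprMn; congr (_ ^+ _); lra.
rewrite big_ord_recr/= e; move: IH; rewrite [_ ^+ N.+1]exprS.
by have := p0 N; lra.
Qed.

Lemma int_Hs N : (\int[unif01 R]_u (Hs N u)%:E = (hN N)%:E)%E.
Proof.
rewrite -[LHS]/(expect (unif01 R) (Hs N)).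
have mi (c : R) : measurable_fun setT (fun u : R => (u <= c)%R%:R : R).
  by apply: measurable_nR; exact: measurable_fun_ler.
have lt : unif01 R setT = 1%E by exact: probability_setT.
rewrite expectD//; first last.
- by move=> u; apply: sumr_ge0 => j _; rewrite mulr_ge0// exprn_ge0.
- by apply: measurable_sum => j; apply: measurable_funM.
rewrite expect_sum; first last.
- by move=> j u; rewrite mulr_ge0// exprn_ge0.
- by move=> j; apply: measurable_funM.
rewrite /expect integral_cst// [X in (_ * X + _)%E]lt mule1 /hN [RHS]EFinD; congr (_ + _)%E.
rewrite -sumEFin; apply: eq_bigr => j _.
rewrite -[LHS]/(expect (unif01 R) (fun u => 2 ^+ j.+1 * (u <= 4^-1 ^+ j.+1)%R%:R)) expect_mul//.
rewrite expect_ind; last exact: measurable_fun_ler.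
rewrite [X in (_ * X)%E](unif01_le (4^-1 ^+ j.+1)) clamp_id ?EFinM//.
by rewrite exprn_ge0//= exprn_ile1// ; lra.
Qed.

Notation UU := (fun k => U (inr (k, false))).

Lemma mprod N n (J : dyn_index -> Prop) : (forall k, (k < n)%N -> J (inr (k, false))) ->
  measurable_fun (setT : set (subsigma U J)) (fun w => \prod_(k < n) Hs N (UU k w)).
Proof.
elim: n => [|n IH] h.
  rewrite (_ : (fun w => _) = fun=> 1); first exact: measurable_cst.
  by apply/funext => w; rewrite big_ord0.
rewrite (_ : (fun w => _) = fun w => (\prod_(k < n) Hs N (UU k w)) * Hs N (UU n w)); last first.
  by apply/funext => w; rewrite big_ord_recr.
apply: measurable_funM; first by apply: IH => k kn; apply: h; exact: ltnW.
apply: measurableT_comp; first exact: measurable_Hs.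
by apply: measurable_coord; exact: h.
Qed.

Lemma prod_Hs_ge0 N n w : 0 <= \prod_(k < n) Hs N (UU k w).
Proof. by apply: prodr_ge0 => k _; exact: Hs_ge0. Qed.

Lemma expect_prod_Hs N n : expect Q (fun w => \prod_(k < n) Hs N (UU k w)) = ((hN N ^+ n)%:E * Q setT)%E.
Proof.
have h0 : 0 <= hN N.
  by rewrite addr_ge0// sumr_ge0// => j _; rewrite mulr_ge0// exprn_ge0.
elim: n => [|n IH].
  rewrite (eq_expect _ (g := fun=> 1)); last by move=> w; rewrite big_ord0.
  by rewrite /expect integral_cst.
pose J (i : dyn_index) := exists2 k, (k < n)%N & i = inr (k, false).
have nJ : ~ J (inr (n, false)) by move=> [k kn [e]]; move: kn; rewrite e ltnn.
rewrite (eq_expect _ (g := fun w => (\prod_(k < n) Hs N (UU k w)) * Hs N (UU n w))); last first.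
  by move=> w; rewrite big_ord_recr.
rewrite (@expect_fubini _ _ _ _ Q U iU J _ (fun w u => (\prod_(k < n) Hs N (UU k w)) * Hs N u) nJ _ _
  (fun w => hN N * \prod_(k < n) Hs N (UU k w))).
- rewrite expect_mul//; [by rewrite IH exprS EFinM muleA| |by move=> w; exact: prod_Hs_ge0].
  apply: (@measurable_from_subsigma R dO O dyn_index U (fun=> True)) => //; exact: mprod.
- apply: measurable_funM; last by apply: measurableT_comp; [exact: measurable_Hs|exact: measurable_snd].
  have mJ : measurable_fun (setT : set (subsigma U J)) (fun w => \prod_(k < n) Hs N (UU k w)).
    by apply: mprod => k kn; exists k.
  by apply: (measurableT_comp mJ); exact: measurable_fst.
- by move=> w u; rewrite mulr_ge0 ?prod_Hs_ge0 ?Hs_ge0.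
- move=> w; rewrite -[LHS]/(expect (unif01 R) (fun u => (\prod_(k < n) Hs N (UU k w)) * Hs N u)).
  rewrite expect_mul; [|exact: prod_Hs_ge0|exact: measurable_Hs|exact: Hs_ge0].
  by rewrite [X in (_ * X)%E]int_Hs -EFinM mulrC.
Qed.

(** Dominates the indicator that [n] gaps sum to at least [4 n]: exponential Markov with parameter
    1/2 and [Hs] in place of [u ^ (-1/2)], plus the event that some variable is too small for this
    replacement. *)
Definition slow (n : nat) (w : O) : R :=
  expR (- (2 * n%:R)) * (\prod_(k < n) Hs n (UU k w)) + \sum_(k < n) (UU k w <= 4^-1 ^+ n.+1)%R%:R.

Lemma slow_ge0 n w : 0 <= slow n w.
Proof. by rewrite addr_ge0 ?sumr_ge0// mulr_ge0 ?expR_ge0 ?prod_Hs_ge0. Qed.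

Lemma mslow n : measurable_fun setT (slow n).
Proof.
apply: measurable_funD.
  apply: measurable_funM; first exact: measurable_cst.
  apply: (@measurable_from_subsigma R dO O dyn_index U (fun=> True)) => //; exact: mprod.
apply: measurable_sum => k; apply: measurable_nR; apply: measurable_fun_ler => //; exact: mU.
Qed.

Lemma slow_ge1 n w : 4 * n%:R <= \sum_(k < n) - ln (UU k w) -> 1 <= slow n w.
Proof.
move=> h; have [/existsP[k hk]|/existsPn nk] := boolP [exists k : 'I_n, UU k w <= 4^-1 ^+ n.+1].
  rewrite /slow [X in _ + X](bigD1 k)//= hk; apply: (@le_trans _ _ (1 + 0)); first by rewrite addr0.
  rewrite addrCA; apply: lerD => //; rewrite addr_ge0 ?sumr_ge0//.
  by rewrite mulr_ge0 ?expR_ge0 ?prod_Hs_ge0.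
apply: (@le_trans _ _ (expR (- (2 * n%:R)) * \prod_(k < n) Hs n (UU k w))); last first.
  by rewrite lerDl sumr_ge0.
rewrite expRN ler_pdivlMl ?expR_gt0// mulr1.
apply: (@le_trans _ _ (expR (\sum_(k < n) - ln (UU k w) / 2))).
  by rewrite ler_expR -mulr_suml ler_pdivlMr//; lra.
rewrite expR_sum; apply: ler_prod => k _; rewrite expR_ge0 /=.
have /andP[u0 u1] := U01 (inr (val k, false)) w.
rewrite -(@ler_pXn2r _ 2)// ?nnegrE ?expR_ge0 ?Hs_ge0// -expRM_natr -mulr_natr divfK//.
rewrite expRN lnK// -[leLHS]mulr1 ler_pdivrMl//.
by apply: Hs_sqr; have := nk k; rewrite -ltNge.
Qed.

(** From [3 * exp (-2) <= 3 / 4] for the product, and [n * 4 ^ (- n - 1) <= (3 / 4) ^ n] for the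
    small variables. *)
Lemma expect_slow n : Q setT = 1%E -> (expect Q (slow n) <= (2 * (3 / 4) ^+ n)%:E)%E.
Proof.
move=> Q1.
have mi k : measurable_fun setT (fun w => (UU k w <= 4^-1 ^+ n.+1)%R%:R : R).
  by apply: measurable_nR; apply: measurable_fun_ler => //; exact: mU.
have mp : measurable_fun setT (fun w => \prod_(k < n) Hs n (UU k w)).
  by apply: (@measurable_from_subsigma R dO O dyn_index U (fun=> True)) => //; exact: mprod.
rewrite expectD; first last.
- by move=> w; exact: sumr_ge0.
- by apply: measurable_sum => k; exact: mi.
- by move=> w; rewrite mulr_ge0 ?expR_ge0 ?prod_Hs_ge0.
- by apply: measurable_funM.
rewrite expect_mul ?expR_ge0//; last by move=> w; exact: prod_Hs_ge0.
rewrite expect_prod_Hs Q1 mule1 expect_sum//.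
have e4 : 0 <= (4^-1 ^+ n.+1 : R) <= 1 by rewrite exprn_ge0//= exprn_ile1//; lra.
have hU (k : 'I_n) : (expect Q (fun w => (UU k w <= 4^-1 ^+ n.+1)%R%:R) = (4^-1 ^+ n.+1)%:E)%E.
  rewrite expect_ind; last by apply: measurable_fun_ler => //; exact: mU.
  have := iU.2.2 [:: inr (val k, false)] (fun=> 4^-1 ^+ n.+1) isT (fun=> e4).
  by rewrite box_cons box_nil setIT big_seq1 Q1 mul1e.
rewrite (eq_bigr _ (fun k _ => hU k)) sumEFin -EFinM -EFinD lee_fin.
rewrite sumr_const card_ord -[X in _ + X]mulr_natl.
have h3 : hN n <= 3 by exact: hN_le.
have h0 : 0 <= hN n by rewrite addr_ge0// sumr_ge0// => j _; rewrite mulr_ge0// exprn_ge0.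
have e2 : expR (- (2 * n%:R)) <= (4^-1 : R) ^+ n.
  rewrite expRN exprVn lef_pV2 ?posrE ?expR_gt0 ?exprn_gt0//.
  rewrite expRM_natr ; apply: lerXn2r; rewrite ?nnegrE ?expR_ge0//.
  have := expR_ge1Dx (1 : R); rewrite (_ : 2 = 1 + 1 :> R)// expRD => e1.
  have : (2 : R) * 2 <= expR 1 * expR 1 by apply: ler_pM => //; lra.
  by lra.
have hA : expR (- (2 * n%:R)) * hN n ^+ n <= (3 / 4) ^+ n.
  rewrite exprMn mulrC; apply: ler_pM; rewrite ?exprn_ge0 ?expR_ge0//.
  by apply: lerXn2r; rewrite ?nnegrE.
have hB : n%:R * 4^-1 ^+ n.+1 <= (3 / 4 : R) ^+ n.
  rewrite exprMn exprS mulrA; apply: ler_wpM2r; first by apply: exprn_ge0; lra.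
  apply: (@le_trans _ _ (n%:R)); first by have : 0 <= (n%:R : R); [exact: ler0n|lra].
  by rewrite -natrX ler_nat ltnW// ltn_expl.
have e22 (x : R) : 2 * x = x + x by ring.
by rewrite [leRHS]e22; exact: lerD.
Qed.

Lemma walk_time_le_ae : Q setT = 1%E -> exists N, [/\ measurable N, Q N = 0%E &
  forall w, ~ N w -> exists n0, forall n, (n0 <= n)%N -> walk_time U n w < 4 * n.+1%:R].
Proof.
move=> Q1.
have r01 : 0 <= (3 / 4 : R) < 1 by apply/andP; split; lra.
have [N [mN N0 h]] := @eventually_lt1 R dO O Q slow 2 (3 / 4) mslow slow_ge0 (ler0n _ 2) r01 (fun n => expect_slow n Q1).
exists N; split => // w /h[n0 hn]; exists n0 => n nn.
rewrite ltNge; apply/negP => hh.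
(* The attempt of index [n] is a sum of [n + 1] gaps. *)
by have := hn n.+1 (leqW nn); rewrite ltNge slow_ge1.
Qed.

End times.

(** * Counting words and vertices *)

Section words.
Variable d : nat.
Hypothesis d3 : (3 <= d)%N.
Let d0 : (0 < d)%N. Proof. exact: leq_trans d3. Qed.

Lemma size_words N : (size (words d N) <= 2 * d ^ N)%N.
Proof.
(* The extra 1 makes the bound inductive, by [2 + d s <= d (s + 1)]. *)
suff : (size (words d N) + 1 <= 2 * d ^ N)%N by lia.
elim: N => [//|N IH] /=; rewrite size_allpairs size_iota expnS.
have : (d * (size (words d N) + 1) <= d * (2 * d ^ N))%N by rewrite leq_mul2l IH orbT.
by move: d3; lia.
Qed.

Lemma valid_all v : valid_Td d v -> all (fun a => (a < d)%N) v.
Proof.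
case: v => // a s /= /andP[-> h] /=; apply: sub_all h => j jd.
by apply: leq_trans jd _; exact: leq_pred.
Qed.

Lemma valid_kap x w : valid_Td d x -> all (fun a => (a < d)%N) w -> valid_Td d (edge_at x w).
Proof.
elim: w x => [//|s w IH] x vx /andP[sd wd].
case: w IH wd => [|t w] IH wd.
  by rewrite /= /edge_of; case: ifP => // _; exact: valid_act.
by rewrite edge_at_cons//; apply: IH => //; exact: valid_act.
Qed.

Definition edgeB (n : nat) := undup (words d n).

Lemma closed_edgeB n N : closedB d (edgeB (n + N)) n.
Proof.
move=> e ve se; rewrite mem_undup; apply: mem_words; first exact: valid_all.
by apply: leq_trans se _; exact: leq_addr.
Qed.

Lemma edge_at_edgeB n N x w : valid_Td d x -> (size x <= n)%N -> rel_word d N w -> edge_at x w \in edgeB (n + N).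
Proof.
move=> vx sx /and3P[_ wd sw]; rewrite mem_undup; apply: mem_words.
  by apply: valid_all; exact: valid_kap.
by apply: leq_trans (size_kap _ _) _; exact: leq_add.
Qed.

Definition vballs (r : nat) := [seq y <- undup (words d r) | valid_Td d y].

Lemma mem_vballs r y : valid_Td d y -> (size y <= r)%N -> y \in vballs r.
Proof.
move=> vy sy; rewrite mem_filter vy mem_undup; apply: mem_words => //; exact: valid_all.
Qed.

Lemma size_vballs r : (size (vballs r) <= 2 * d ^ r)%N.
Proof.
rewrite size_filter; apply: leq_trans (count_size _ _) _.
exact: leq_trans (size_undup _) (size_words r).
Qed.
End words.

(** * Exponentially small probability of staying near the root *)

Section tail.
Variables (R : realType) (dO : measure_display) (O : measurableType dO).
Variables (d : nat) (p mu : R).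
Hypothesis d3 : (3 <= d)%N.
Hypothesis p01 : 0 <= p <= 1.
Hypothesis mu0 : 0 < mu.
Variable Q : {measure set O -> \bar R}.
Variable U : dyn_index -> O -> R.
Hypothesis iU : iid_measure Q U.
Hypothesis U01 : forall i w, 0 < U i w <= 1.
Hypothesis Q1 : Q setT = 1%E.
Variable eta : seq nat -> bool.
Let d0 : (0 < d)%N. Proof. exact: leq_trans d3. Qed.
Let mU : forall i, measurable_fun setT (U i) := iU.2.1.

(** There are countably many edges; their null sets are collected through [pickle]. *)
Lemma refreshing_ae : exists N, [/\ measurable N, Q N = 0%E & forall w, ~ N w -> refreshing mu U w].
Proof.
have inj e : injective (fun k : nat => inl (e, k, false) : dyn_index) by move=> k k' [].
have hE e : exists N, [/\ measurable N, Q N = 0%E &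
    forall w, ~ N w -> forall L : R, exists n, L < \sum_(k < n.+1) - ln (U (inl (e, val k, false)) w)].
  exact: (sum_unbounded iU U01 (inj e)).
pose Ne e := sval (cid (hE e)).
have NeP e := svalP (cid (hE e)).
pose M (k : nat) := if unpickle k is Some e then Ne e else set0.
have mM k : measurable (M k).
  by rewrite /M; case: unpickle => [e|]; [have [] := NeP e|exact: measurable0].
have M0 k : Q (M k) = 0%E.
  by rewrite /M; case: unpickle => [e|]; [have [] := NeP e|exact: measure0].
exists (\bigcup_k M k); split.
- exact: bigcup_measurable.
- apply/eqP; rewrite eq_le measure_ge0 andbT.
  apply: (@le_trans _ _ (\sum_(k <oo) Q (M k))%E).
    by apply: measure_sigma_subadditive => //; exact: bigcup_measurable.
  by rewrite eseries0// => k _ _; exact: M0.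
- move=> w nw e L.
  have [_ _ h] := NeP e.
  have nN : ~ Ne e w by move=> hN; apply: nw; exists (pickle e) => //; rewrite /M pickleK.
  have [n hn] := h w nN (mu * L); exists n.
  by rewrite /refresh_sum /gapf -mulr_suml ltr_pdivlMr// mulrC.
Qed.

Lemma walk_time_unbounded_ae : exists N, [/\ measurable N, Q N = 0%E &
  forall w, ~ N w -> forall L : R, exists n, L < walk_time U n w].
Proof.
have inj : injective (fun k : nat => inr (k, false) : dyn_index) by move=> k k' [].
exact: (sum_unbounded iU U01 inj).
Qed.

Section mean_potential.
Variables (k : nat) (sg : R).
Hypothesis sg0 : 0 <= sg.
Notation F := (potential d k sg).
Notation mF := (meanF d p F k.+2).
Hypothesis mF0 : 0 < mF.

(** Chosen so that the ball has at most [2 exp (n mF / 4)] vertices, which uses up half of the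
    exponential gain [n mF / 2] of [expect_near]. *)
Definition rad (n : nat) : nat := Num.truncn (mF / (4 * ln d%:R) * n%:R).

Lemma lnd0 : 0 < ln (d%:R : R).
Proof. by rewrite ln_gt0// ltr1n; exact: leq_trans d3. Qed.

Lemma rad_le n : (rad n)%:R <= mF / (4 * ln d%:R) * n%:R.
Proof. by rewrite truncn_le mulr_ge0// divr_ge0 ?mulr_ge0// ltW// lnd0. Qed.

(** Almost surely the indicator that the chain is in the ball of radius [rad n] after [n] attempts,
    written with path weights so that its expectation is computable. *)
Definition near_weight (N n : nat) (w : O) : R :=
  \sum_(y <- vballs d (rad n)) path_weight p mu d (edgeB d (n + N)) (nbr_move d) (fun _ _ _ => 1) (fun x => (x == y)%:R) n [::] eta U w.

(** The accumulated potential [S] is compared with [a = n mF / 2]. If [S >= a], each indicator is at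
    most [exp (- a)] times a tilted weight of expectation at most 1, and there are at most
    [2 exp (n mF / 4)] end points. If [S < a], the rate [3 / 4] of [lower_tail] against [1 / 2]
    leaves [exp (- la mF n / 4)]. *)
Lemma expect_near : exists N C rho, [/\ 0 <= C, 0 <= rho < 1 & forall n, (expect Q (near_weight N n) <= (C * rho ^+ n)%:E)%E].
Proof.
have sF : supp (rel_word d k.+2) F by exact: supp_potential.
have [N [la [C [la0 hL]]]] := @lower_tail R d p mu d0 p01 mu0 F k.+2 _ sF (potential_norm_le d3 k sg0) mF0.
exists N, (2 + `|C|), (Num.max (expR (- (mF / 4))) (expR (- la * (mF / 4)))).
split.
- by rewrite addr_ge0.
- have m4 : 0 < mF / 4 by exact: divr_gt0.
  by rewrite le_max expR_ge0 /= gt_max !expR_lt1 mulNr !oppr_lt0 m4 mulr_gt0.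
move=> n; set B := edgeB d (n + N); set Y := vballs d (rad n).
have uB : uniq B by exact: undup_uniq.
pose W1 y := path_weight p mu d B (nbr_move d) (fun _ _ _ => 1) (fun x => (x == y)%:R) n [::] eta U.
pose WH y := path_weight p mu d B (nbr_move d) (phiH d k sg) (psiH R y) n [::] eta U.
pose WL := path_weight p mu d B (nbr_move d) (phiL F la) (fun=> 1) n [::] eta U.
have ge0R (b : bool) : 0 <= (b%:R : R) by exact: ler0n.
have m1 y : measurable_fun setT (W1 y) by exact: measurable_path_weight.
have mH y : measurable_fun setT (WH y) by exact: measurable_path_weight.
have mL : measurable_fun setT WL by exact: measurable_path_weight.
have WH0 y w : 0 <= WH y w by apply: path_weight_ge0 => *; [exact: expR_ge0|exact: ge0R].
have WL0 w : 0 <= WL w by apply: path_weight_ge0 => *; [exact: expR_ge0|exact: ler01].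
have W10 y w : 0 <= W1 y w by apply: path_weight_ge0 => *; [exact: ler01|exact: ge0R].
have EH y : (expect Q (WH y) <= 1)%E.
  rewrite (@expect_path_weight R dO O p mu d p01 mu0 d0 B uB _ _ _ _ _ n Q U iU U01 [::] eta).
  - rewrite Q1 mule1 lee_fin; exact: contraction_le1.
  - by move=> *; exact: expR_ge0.
  - by move=> *; exact: ge0R.
set q := expR (- la * (3 / 4 * mF)) in hL.
have EL : (expect Q WL <= (C * q ^+ n)%:E)%E.
  rewrite (@expect_path_weight R dO O p mu d p01 mu0 d0 B uB _ _ _ _ _ n Q U iU U01 [::] eta).
  - by rewrite Q1 mule1 lee_fin; apply: hL => // x w; exact: edge_at_edgeB.
  - by move=> *; exact: expR_ge0.
  - by move=> *; exact: ler01.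
pose a := n%:R * (mF / 2).
have sum1 w : \sum_(y <- Y) W1 y w <= 1.
  have H (nn : nat) x et U' : \sum_(y <- Y) path_weight p mu d B (nbr_move d) (fun _ _ _ => 1) (fun x => (x == y)%:R) nn x et U' w <= 1.
    elim: nn x et U' => [|nn IHn] x et U' /=.
      have uY : uniq Y by rewrite filter_uniq// undup_uniq.
      have [xY|xY] := boolP (x \in Y).
        rewrite (bigD1_seq x)//= eqxx big1 ?addr0// => y; by rewrite eq_sym => /negbTE ->.
      rewrite big_seq big1// => y yY; case: eqP => // e; by rewrite e yY in xY.
    rewrite (eq_bigr (fun y => path_weight p mu d B (nbr_move d) (fun _ _ _ => 1) (fun x => (x == y)%:R) nn (nbr_move d x (attempt_env p mu U' B et w) (walk_choice d U' 0 w)) (attempt_env p mu U' B et w) (shifted mu U') w)).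
      exact: IHn.
    by move=> y _; rewrite mul1r.
  exact: H.
have key w : near_weight N n w <= expR (- a) * (\sum_(y <- Y) WH y w) + expR (la * a) * WL w.
  have [S [hS1 hS2]] := @path_weight_tilt R dO O d p mu B (fun x z y => (F (seen x z) + F (seen y z)) / 2) la n [::] eta U w.
  have -> : \sum_(y <- Y) WH y w = expR S * \sum_(y <- Y) W1 y w.
    by rewrite mulr_sumr; apply: eq_bigr => y _; exact: hS1.
  have -> : WL w = expR (- la * S) by exact: hS2.
  rewrite mulrA -!expRD -/Y.
  have s0 : 0 <= \sum_(y <- Y) W1 y w by exact: sumr_ge0.
  have [aS|Sa] := leP a S.
    apply: (@le_trans _ _ (expR (- a + S) * \sum_(y <- Y) W1 y w)); last by rewrite lerDl expR_ge0.
    by rewrite -[leLHS]mul1r; apply: ler_wpM2r => //; rewrite -expR0 ler_expR; lra.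
  apply: (@le_trans _ _ (expR (la * a + - la * S))); last by rewrite lerDr mulr_ge0// expR_ge0.
  apply: le_trans (sum1 w) _; rewrite -expR0 ler_expR mulNr -mulrBr mulr_ge0//; first exact: ltW.
  by rewrite subr_ge0 ltW.
have mS : measurable_fun setT (fun w => \sum_(y <- Y) WH y w) by exact: measurable_sum.
have S0 w : 0 <= \sum_(y <- Y) WH y w by exact: sumr_ge0.
apply: (@le_trans _ _ (expect Q (fun w => expR (- a) * (\sum_(y <- Y) WH y w) + expR (la * a) * WL w))).
  apply: expect_le => //; first by apply: measurable_sum.
    by move=> w; apply: sumr_ge0 => y _; exact: W10.
  by apply: measurable_funD; apply: measurable_funM.
rewrite expectD; first last.
- by move=> w; rewrite mulr_ge0 ?expR_ge0.
- exact: measurable_funM.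
- by move=> w; rewrite mulr_ge0 ?expR_ge0.
- exact: measurable_funM.
rewrite !expect_mul ?expR_ge0// expect_sum//.
have h1 : (\sum_(y <- Y) expect Q (WH y) <= ((2 * d ^ rad n)%:R)%:E)%E.
  apply: (@le_trans _ _ (\sum_(y <- Y) 1%:E)%E); first by apply: lee_sum => y _; exact: EH.
  by rewrite sumEFin lee_fin big_const_seq count_predT iter_addr_0 ler_nat size_vballs.
have dr : ((d ^ rad n)%:R : R) <= expR (n%:R * (mF / 4)).
  rewrite natrX -[d%:R]lnK ?posrE ?ltr0n// -expRM_natr ler_expR.
  have := ler_wpM2l (ltW lnd0) (rad_le n) => h; apply: le_trans h _.
  by rewrite le_eqVlt; apply/orP; left; apply/eqP; field; rewrite gt_eqF// lnd0.
set rho := Num.max _ _.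
have rho0 : 0 <= rho by rewrite le_max expR_ge0.
have r1 : expR (- a) * (2 * d ^ rad n)%:R <= 2 * rho ^+ n.
  rewrite natrM mulrCA; apply: ler_wpM2l => //.
  apply: (@le_trans _ _ (expR (- a) * expR (n%:R * (mF / 4)))); first by apply: ler_wpM2l => //; exact: expR_ge0.
  apply: (@le_trans _ _ (expR (- (mF / 4)) ^+ n)).
    by rewrite -expRD -expRM_natr ler_expR /a; lra.
  by apply: lerXn2r; rewrite ?nnegrE ?expR_ge0// le_max lexx.
have r2 : expR (la * a) * (C * q ^+ n) <= `|C| * rho ^+ n.
  apply: (@le_trans _ _ (`|C| * (expR (la * a) * q ^+ n))).
    by rewrite mulrCA; apply: ler_wpM2r; [rewrite mulr_ge0 ?exprn_ge0 ?expR_ge0|exact: ler_norm].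
  apply: ler_wpM2l => //.
  apply: (@le_trans _ _ (expR (- la * (mF / 4)) ^+ n)).
    by rewrite /q -!expRM_natr -expRD ler_expR /a le_eqVlt; apply/orP; left; apply/eqP; field.
  by apply: lerXn2r; rewrite ?nnegrE ?expR_ge0// le_max lexx orbT.
rewrite mulrDl EFinD; apply: leeD.
  apply: (@le_trans _ _ ((expR (- a))%:E * ((2 * d ^ rad n)%:R)%:E)%E); last by rewrite -EFinM lee_fin.
  by apply: lee_wpmul2l => //; rewrite lee_fin expR_ge0.
apply: (@le_trans _ _ ((expR (la * a))%:E * (C * q ^+ n)%:E)%E); last by rewrite -EFinM lee_fin.
by apply: lee_wpmul2l => //; rewrite lee_fin expR_ge0.
Qed.

Lemma escape_ae : exists N, [/\ measurable N, Q N = 0%E & forall w, ~ N w ->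
  exists n0, forall n, (n0 <= n)%N -> mF / (4 * ln d%:R) * n%:R <= (size (jump_chain d p mu eta U n w))%:R].
Proof.
have [N [C [rho [C0 r01 h]]]] := expect_near.
have ge0R (b : bool) : 0 <= (b%:R : R) by exact: ler0n.
have W10 n y w : 0 <= path_weight p mu d (edgeB d (n + N)) (nbr_move d) (fun _ _ _ => 1) (fun x => (x == y)%:R) n [::] eta U w.
  by apply: path_weight_ge0 => *; [exact: ler01|exact: ge0R].
have mW n : measurable_fun setT (near_weight N n) by apply: measurable_sum => y; exact: measurable_path_weight.
have W0 n w : 0 <= near_weight N n w by apply: sumr_ge0.
have [N1 [mN1 N10 h1]] := eventually_lt1 mW W0 C0 r01 h.
have [N2 [mN2 N20 h2]] := refreshing_ae.
exists (N1 `|` N2); split; [exact: measurableU|by rewrite measureU0|].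
move=> w /not_orP[/h1[n0 hn] /h2 rf]; exists n0 => n nn.
rewrite jump_chainE; set v := chain_from _ _ _ _ _ _ _ _.
have vv : valid_Td d v by exact: valid_chain_from.
have hv : (rad n < size v)%N.
  rewrite ltnNge; apply/negP => sv; have := hn n nn; rewrite ltNge => /negP; apply.
  have vY : v \in vballs d (rad n) by exact: mem_vballs.
  rewrite /near_weight (bigD1_seq v)//=; last by rewrite filter_uniq// undup_uniq.
  rewrite (@path_weight_chain_from R dO O d p mu d0 mu0 (edgeB d (n + N)) _ n)//; last exact: closed_edgeB.
  rewrite -/v eqxx lerDl; exact: sumr_ge0.
apply: (@le_trans _ _ ((rad n).+1%:R)); last by rewrite ler_nat.
by apply: ltW; rewrite truncnS_gt.
Qed.

End mean_potential.
End tail.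

(** * Escape at linear speed *)

Section unit_interval.
Variables (R : realType) (dO : measure_display) (O : measurableType dO).
Variables (P : probability O R) (I : eqType) (U : I -> O -> R).
Hypothesis iU : iid_uniform P U.
Let mU : forall i, measurable_fun setT (U i) := iU.1.

Lemma iid_uniform_measure : iid_measure P U.
Proof.
have P1 : P setT = 1%E by exact: probability_setT.
split; first exact: fin_num_measure.
split => // s a us a01; rewrite [X in (X * _)%E]P1 mul1e; exact: iU.2.
Qed.

(** A modification on a null set after which [0 < U <= 1] holds at every point, as the pathwise
    lemmas require. *)
Definition trunc01 (i : I) (w : O) : R := if 0 < U i w <= 1 then U i w else 1.

Lemma trunc01_in i w : 0 < trunc01 i w <= 1.
Proof. by rewrite /trunc01; case: ifP => // _; rewrite ltr01 lexx. Qed.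

Lemma measurable_trunc01 i : measurable_fun setT (trunc01 i).
Proof.
apply: measurable_fun_ifT => //; apply: measurable_and.
  by apply: measurable_fun_ltr.
by apply: measurable_fun_ler.
Qed.

Definition out01 (i : I) : set O := [set w | U i w <= 0] `|` ~` [set w | U i w <= 1].

Lemma measurable_out01 i : measurable (out01 i).
Proof. by apply: measurableU; [|apply: measurableC]; exact: measurable_le_cst. Qed.

Lemma out01_null i : P (out01 i) = 0%E.
Proof.
have h (c : R) : 0 <= c <= 1 -> P [set w | U i w <= c] = c%:E.
  move=> c01; have := iU.2 [:: i] (fun=> c) isT (fun=> c01).
  by rewrite -[[set w | _]]/(box U [:: i] (fun=> c)) box_cons box_nil setIT big_seq1.
have m (c : R) : measurable [set w | U i w <= c] by exact: measurable_le_cst.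
have B0 : P (~` [set w | U i w <= 1]) = 0%E.
  by rewrite probability_setC// [X in (_ - X)%E]h ?subee// ler01 lexx.
apply: etrans (measureU0 (m 0) (measurableC (m 1)) B0) _.
by apply: (h 0); rewrite lexx ler01.
Qed.

Lemma trunc01E i w : ~ out01 i w -> trunc01 i w = U i w.
Proof.
move=> /not_orP[/= /negP h0 /contrapT h1]; rewrite /trunc01 h1 andbT.
by rewrite ltNge h0.
Qed.

Lemma iid_measure_trunc01 : iid_measure P trunc01.
Proof.
split; first exact: fin_num_measure.
split; first exact: measurable_trunc01.
move=> s a us a01; rewrite -(iid_uniform_measure.2.2 s a us a01).
have NE (s' : seq I) : measurable (\big[setU/set0]_(i <- s') out01 i) /\ P (\big[setU/set0]_(i <- s') out01 i) = 0%E.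
  elim: s' => [|i s' [mN N0]].
    by rewrite big_nil; split; [exact: measurable0|exact: measure0].
  rewrite big_cons; have mi := measurable_out01 i; split; first exact: measurableU.
  by apply: etrans (measureU0 mi mN N0) _; exact: out01_null.
have [mN N0] := NE s.
have memN (s' : seq I) w i : i \in s' -> out01 i w -> (\big[setU/set0]_(j <- s') out01 j) w.
  elim: s' => // j s' IH; rewrite in_cons big_cons => /orP[/eqP <-|/IH h] hi; first by left.
  by right; exact: h.
have mb (V : I -> O -> R) : (forall i, measurable_fun setT (V i)) -> measurable (box V s a).
  by move=> mV; apply: measurable_box.
apply: etrans (esym (measureU0 (mb _ measurable_trunc01) mN N0)) _.
apply: etrans _ (measureU0 (mb _ mU) mN N0).
congr (P _); apply/seteqP; split => w /= [h|h]; try (by right);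
  (have [nw|nw] := pselect ((\big[setU/set0]_(j <- s) out01 j) w); [by right|left]) => i is_;
  have e : trunc01 i w = U i w by apply: trunc01E => hi; apply: nw; exact: memN hi.
- by rewrite -e; exact: h.
- by rewrite e; exact: h.
Qed.

End unit_interval.

Section core.
Variables (R : realType) (d : nat) (p mu : R) (eta : seq nat -> bool).
Hypothesis d3 : (3 <= d)%N.
Hypothesis p01 : 0 <= p <= 1.
Hypothesis mu0 : 0 < mu.

Lemma speed_at_least_le (v v' : R) : v' <= v -> speed_at_least d p mu eta v -> speed_at_least d p mu eta v'.
Proof.
move=> vv h dO O P U iU; have [N [mN N0 hN]] := h dO O P U iU.
exists N; split => // w nw; apply: hN => /= hw; apply: nw => eps e0.
have [T hT] := hw eps e0; exists T => t Tt; apply: le_trans (hT t Tt).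
by rewrite lerD2r.
Qed.

Lemma speed_at_least0 : speed_at_least d p mu eta 0.
Proof.
move=> dO O P U iU; exists set0; split; [exact: measurable0|exact: measure0|].
move=> w; apply => eps e0; exists 1 => t t1; rewrite sub0r.
apply: (@le_trans _ _ 0); first by rewrite oppr_le0 ltW.
by rewrite divr_ge0// (le_trans ler01).
Qed.

(** At time [t] the walk has made [n] attempts with [t < walk_time n < 4 (n + 1)], so
    [n > t / 4 - 1]; the loss [be] is at most [eps * t] once [t >= be / eps]. *)
Lemma position_ge (dO : measure_display) (O : measurableType dO) (U : dyn_index -> O -> R) (w : O) (be : R) (n0 n1 : nat) :
  0 < be -> (forall i, 0 < U i w <= 1) ->
  (forall n, (n0 <= n)%N -> be * n%:R <= (size (jump_chain d p mu eta U n w))%:R) ->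
  (forall n, (n1 <= n)%N -> walk_time U n w < 4 * n.+1%:R) ->
  (forall L : R, exists n, L < walk_time U n w) ->
  forall eps : R, 0 < eps -> exists T : R, forall t : R, T <= t ->
    be / 4 - eps <= (dist_root (position d p mu eta U t w))%:R / t.
Proof.
move=> be0 U01 hs ht hu eps e0.
have mono m n : (m <= n)%N -> walk_time U m w <= walk_time U n w.
  move=> /subnK <-; elim: (n - m)%N => // k IH; rewrite addSn.
  apply: le_trans IH _; rewrite /walk_time [leRHS]big_ord_recr/= lerDl oppr_ge0.
  by apply: ln_le0; have /andP[_] := U01 (inr ((k + m).+1, false)).
pose n2 := maxn n0 n1.
exists (Num.max (walk_time U n2 w) (Num.max 1 (be / eps))) => t.
rewrite !ge_max => /and3P[t1 t2 t3].
have t0 : 0 < t by exact: lt_le_trans t2.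
rewrite /position; case: pselect => [h|nh]; last by case: nh; exact: hu.
case: ex_minnP => n hn nmin.
have n2n : (n2 <= n)%N.
  rewrite leqNgt; apply/negP => nn; have := mono n n2 (ltnW nn).
  by move=> h'; have := lt_le_trans hn h'; rewrite ltNge t1.
have s1 := hs n (leq_trans (leq_maxl _ _) n2n).
have s2 := lt_trans hn (ht n (leq_trans (leq_maxr _ _) n2n)).
rewrite /dist_root ler_pdivlMr//; apply: le_trans s1.
have : be * (t / 4 - 1) <= be * n%:R.
  by apply: ler_wpM2l; [exact: ltW|rewrite -natr1 in s2; lra].
have : be <= eps * t by rewrite -ler_pdivrMl// mulrC.
by lra.
Qed.

(** The constant is [128 = 8 * 4 * 4]: the mean of the potential, the radius [rad], and the bound on
    attempt times. Percolation enters only through the lower bound [y], so that both halves of the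
    final statement can use it. *)
Lemma speed_core (y : R) : 0 < y <= 1 -> (forall n, y <= p * survival p d.-1 n) ->
  speed_at_least d p mu eta (y ^+ 5 / (128 * d%:R ^+ 2 * ln d%:R)).
Proof.
move=> y01 hy; have [k [sg [sg0 hm]]] := potential_exists d3 p01 y01 hy.
set mF := meanF _ _ _ _ in hm.
have y0 : 0 < y by case/andP: y01.
have D0 : 0 < (d%:R : R) by rewrite ltr0n (leq_trans _ d3).
have mF0 : 0 < mF.
  by apply: lt_le_trans hm; rewrite divr_gt0 ?mulr_gt0 ?exprn_gt0.
have ln0 := @lnd0 R d d3.
pose be := mF / (4 * ln d%:R).
have be0 : 0 < be by rewrite divr_gt0// mulr_gt0.
apply: (@speed_at_least_le (be / 4)).
  rewrite (_ : be / 4 = mF / (16 * ln d%:R)); last by rewrite /be; field; rewrite gt_eqF.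
  rewrite ler_pdivlMr ?mulr_gt0//; apply: le_trans hm; rewrite le_eqVlt; apply/orP; left; apply/eqP.
  by field; rewrite !gt_eqF.
move=> dO O P U iU.
have iV := iid_measure_trunc01 iU; set V := trunc01 U in iV.
have V01 : forall i w, 0 < V i w <= 1 by move=> i w; exact: trunc01_in.
have P1 : P setT = 1%E by exact: probability_setT.
have [N1 [mN1 N10 h1]] := @escape_ae R dO O d p mu d3 p01 mu0 P V iV V01 P1 eta k sg sg0 mF0.
have [N2 [mN2 N20 h2]] := walk_time_le_ae iV V01 P1.
have [N3 [mN3 N30 h3]] := walk_time_unbounded_ae iV V01.
pose M (j : nat) : set O := if (unpickle j : option ((seq nat * nat * bool) + (nat * bool))%type) is Some i then out01 U i else set0.
have mM j : measurable (M j).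
  by rewrite /M; case: unpickle => [i|]; [exact: (measurable_out01 iU)|exact: measurable0].
have mN4 : measurable (\bigcup_j M j) by exact: bigcup_measurable.
have N40 : P (\bigcup_j M j) = 0%E.
  apply/eqP; rewrite eq_le measure_ge0 andbT.
  apply: (@le_trans _ _ (\sum_(j <oo) P (M j))%E).
    exact: measure_sigma_subadditive.
  rewrite eseries0// => j _ _; rewrite /M; case: unpickle => [i|]; [exact: (out01_null iU)|exact: measure0].
exists (((N1 `|` N2) `|` N3) `|` \bigcup_j M j); split.
- by do 3! apply: measurableU => //.
- rewrite measureU0//; last by do 2! apply: measurableU => //.
  by rewrite measureU0 ?measureU0//; apply: measurableU.
move=> w nw; apply: contrapT => /not_orP[/not_orP[/not_orP[/h1[n0 hn0] /h2[n1 hn1]] /h3 hu] n4].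
apply: nw => eps e0.
have UV i : U i w = V i w.
  rewrite /V trunc01E// => hi; apply: n4.
  by exists (pickle (i : ((seq nat * nat * bool) + (nat * bool))%type)) => //; rewrite /M pickleK.
apply: (@position_ge dO O U w be n0 n1 be0) => //.
- by move=> i; rewrite UV.
- by move=> n nn; rewrite (jump_chain_ext _ _ _ _ _ UV); exact: hn0.
- by move=> n nn; rewrite (walk_time_ext _ UV); exact: hn1.
- by move=> L; have [n hn] := hu L; exists n; rewrite (walk_time_ext _ UV).
Qed.

End core.

(** * Percolation on the b-ary tree *)

Section percolation.
Variables (R : realType) (dO : measure_display) (O : measurableType dO).
Variables (b : nat) (p : R).
Hypothesis p01 : 0 <= p <= 1.
Variables (P : probability O R) (W : seq nat -> O -> R).
Hypothesis iW : iid_uniform P W.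
Notation config := (seq nat -> bool).
Let mW : forall i, measurable_fun setT (W i) := iW.1.
Let iM : iid_measure P W := iid_uniform_measure iW.

Definition openS (S : seq (seq nat)) (w : O) : config := fun e => (e \in S) && (W e w < p).

Lemma openS_cons e S w : openS (e :: S) w = upd (openS S w) e (W e w < p).
Proof. by apply/funext => x; rewrite /openS /upd in_cons; case: eqP => //= ->. Qed.

Lemma measurable_openS (J : seq nat -> Prop) S (f : config -> R) : (forall e, e \in S -> J e) ->
  measurable_fun (setT : set (subsigma W J)) (fun w => f (openS S w)).
Proof.
elim: S f => [|e S IH] f h.
  by rewrite (_ : (fun w => _) = fun=> f xpred0)//; exact: measurable_cst.
rewrite (_ : (fun w => _) = fun w => if W e w < p then f (upd (openS S w) e true) else f (upd (openS S w) e false)); last first.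
  by apply/funext => w; rewrite openS_cons; case: ifP.
have h' x : x \in S -> J x by move=> xS; apply: h; rewrite in_cons xS orbT.
apply: measurable_fun_ifT; [|exact: (IH (fun z => f (upd z e true)))|exact: (IH (fun z => f (upd z e false)))].
by apply: measurable_fun_ltr => //; apply: measurable_coord; apply: h; rewrite mem_head.
Qed.

(** Edges are exposed one at a time; this links a percolation on an arbitrary probability space to
    [resample] with keep probability 0. *)
Lemma expect_openS S (f : config -> R) : uniq S -> (forall z, 0 <= f z) ->
  expect P (fun w => f (openS S w)) = (resample p (fun=> 0) S f xpred0)%:E.
Proof.
elim: S f => [|e S IH] f.
  move=> _ f0; rewrite (eq_expect _ (g := fun=> f xpred0))// /expect integral_cst//.
  by rewrite [X in (_ * X)%E](_ : _ = 1%E) ?mule1//; exact: probability_setT.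
move=> /andP[nS uS] f0; move: p01 => /andP[p0 p1].
pose g z := resample1 p 0 e f z.
have gE z : g z = p * f (upd z e true) + (1 - p) * f (upd z e false) by rewrite /g /resample1; ring.
have g0 z : 0 <= g z by rewrite gE addr_ge0// mulr_ge0// subr_ge0.
rewrite [resample _ _ _ _]/= -resample_resample1// -(IH g uS g0).
pose J x := x \in S.
have nJ : ~ J e by move=> h; rewrite /J (negbTE nS) in h.
pose h (w : O) (u : R) : R := (u < p)%R%:R * f (upd (openS S w) e true) + (1 - (u < p)%R%:R) * f (upd (openS S w) e false).
transitivity (expect P (fun w => h w (W e w))).
  apply: eq_expect => w; rewrite openS_cons /h; case: (W e w < p) => /=; ring.
have i0 u : 0 <= (1 - (u < p)%R%:R : R) by case: (u < p); rewrite ?subrr ?subr0.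
apply: (@expect_fubini _ _ _ _ P W iM J e h nJ).
- have mi : measurable_fun setT (fun u : R => (u < p)%R%:R : R).
    by apply: measurable_nR; exact: measurable_fun_ltr.
  have mi2 : measurable_fun (setT : set (subsigma W J * R)) (fun z => (z.2 < p)%R%:R : R).
    by apply: (measurableT_comp mi); exact: measurable_snd.
  have mf b' : measurable_fun (setT : set (subsigma W J * R)) (fun z => f (upd (openS S z.1) e b')).
    have m1 : measurable_fun (setT : set (subsigma W J)) (fun w => f (upd (openS S w) e b')).
      exact: (@measurable_openS J S (fun z => f (upd z e b'))).
    by apply: (measurableT_comp m1); exact: measurable_fst.
  by apply: measurable_funD; apply: measurable_funM => //; apply: measurable_funB.
- by move=> w u; rewrite addr_ge0// mulr_ge0.
- move=> w; rewrite -[LHS]/(expect (unif01 R) (h w)) /h gE.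
  have mlt : measurable_fun setT (fun u : R => u < p) by exact: measurable_fun_ltr.
  have mi : measurable_fun setT (fun u : R => (u < p)%R%:R : R) by exact: measurable_nR.
  have mge : measurable_fun setT (fun u : R => p <= u) by exact: measurable_fun_ler.
  have mi' : measurable_fun setT (fun u : R => (p <= u)%R%:R : R) by exact: measurable_nR.
  rewrite (eq_expect _ (g := fun u : R => f (upd (openS S w) e true) * (u < p)%R%:R + f (upd (openS S w) e false) * (p <= u)%R%:R)); last first.
    by move=> u; rewrite leNgt; case: (u < p) => /=; ring.
  rewrite expectD; first last.
  + by move=> u; rewrite mulr_ge0.
  + exact: measurable_funM.
  + by move=> u; rewrite mulr_ge0.
  + exact: measurable_funM.
  rewrite !expect_mul// !expect_ind//.
  rewrite [X in (_ * X + _)%E](unif01_lt p) [X in (_ + _ * X)%E](unif01_ge p) clamp_id ?p0//.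
  by rewrite -!EFinM -EFinD; congr (_%:E); ring.
Qed.

Notation nxb := (fun _ : nat => iota 0 b).

Definition depth (n : nat) (om : config) : bool := survives nxb n (iota 0 b) om.

Lemma rword_words n w : rword nxb n (iota 0 b) w -> w \in undup (words b n).
Proof.
rewrite mem_undup => h; apply: mem_words.
  elim: n w h => [|n IH] [|s w] //= /andP[]; rewrite mem_iota add0n => /= -> /orP[/eqP -> //|/IH].
  by [].
elim: n w h => [|n IH] [|s w] //= /andP[_ /orP[/eqP -> //|/IH]].
by rewrite ltnS.
Qed.

Lemma P_depth n : measurable [set w | depth n (fun e => W e w < p)] /\
  P [set w | depth n (fun e => W e w < p)] = (survival p b n)%:E.
Proof.
pose S := undup (words b n).
have dE w : depth n (fun e => W e w < p) = depth n (openS S w).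
  by apply: survives_supp => e /rword_words eS; rewrite /openS eS.
have m1 : measurable_fun setT (fun w => (depth n (openS S w))%:R : R).
  apply: (@measurable_from_subsigma R dO O _ W (fun=> True)) => //.
  exact: (@measurable_openS (fun=> True) S (fun z => (depth n z)%:R)).
have mb : measurable_fun setT (fun w => depth n (fun e => W e w < p)).
  rewrite (_ : (fun w => _) = (fun w => 0 < ((depth n (openS S w))%:R : R))).
    exact: measurable_fun_ltr.
  by apply/funext => w; rewrite dE; case: depth; rewrite ?ltr01 ?ltxx.
split; first by have := mb measurableT [set true] Logic.I; rewrite setTI.
rewrite -expect_ind// (eq_expect _ (g := fun w => (depth n (openS S w))%:R)); last by move=> w; rewrite dE.
rewrite (expect_openS (f := fun z => (depth n z)%:R)) ?undup_uniq//.
congr (_%:E); apply: (@resample_brb _ p b nxb xpredT _ _ _ n 0%N) => //.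
- by move=> s _; exact: iota_uniq.
- by move=> s _; rewrite size_iota.
- exact: undup_uniq.
- exact: rword_words.
Qed.

Lemma depth_path n (om : config) v : all (fun j => (j < b)%N) v -> (n <= size v)%N ->
  (forall k, (0 < k <= size v)%N -> om (take k v)) -> depth n om.
Proof.
elim: n om v => // n IH om [//|s v] /= /andP[sb vb] nv h.
apply/hasP; exists s; first by rewrite mem_iota.
apply/andP; split; first by have := h 1%N isT; rewrite /= take0.
by apply: (IH (fun w => om (s :: w)) v) => // k /andP[k0 kv]; exact: (h k.+1).
Qed.

Lemma path_depth n (om : config) : depth n om -> exists v, [/\ all (fun j => (j < b)%N) v, size v = n &
  forall k, (0 < k <= size v)%N -> om (take k v)].
Proof.
elim: n om => [|n IH] om; first by move=> _; exists [::]; split => // k; case: k.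
move=> /hasP[s]; rewrite mem_iota add0n => /= sb /andP[os /IH[v [vb sv hv]]].
exists (s :: v); split; rewrite /= ?sb ?sv//.
move=> [|[|k]] //=; first by rewrite take0.
by move=> kn; apply: (hv k.+1); rewrite sv.
Qed.

(** Branching is finite, so a cluster without open paths of length [n] lies among finitely many
    words; conversely, open paths of all lengths give words of unbounded length. *)
Lemma infinite_cluster w : ~ finite_set (root_cluster b p W w) <->
  forall n, depth n (fun e => W e w < p).
Proof.
split => [inf n|h fin].
  apply: contrapT => nd; apply: inf.
  apply: (@sub_finite_set _ _ [set` words b n]); last exact: finite_seq.
  move=> v [vb hv]; apply: mem_words => //.
  by rewrite leqNgt; apply/negP => nv; apply: nd; apply: (depth_path vb (ltnW nv)).
have /finite_seqP[s hs] := fin.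
have [v [vb sv hv]] := path_depth (h (\max_(x <- s) size x).+1).
have : [set` s] v by rewrite -hs; split.
move=> /= vs; have := @leq_bigmax_seq _ s xpredT size v vs isT.
by rewrite sv ltnn.
Qed.

Lemma theta_tilde_ge0 : 0 <= theta_tilde b p P W.
Proof. by rewrite /theta_tilde fine_ge0. Qed.

Lemma theta_tilde_le n : theta_tilde b p P W <= survival p b n.
Proof.
rewrite /theta_tilde; set A := [set w | _].
have AE : A = \bigcap_n [set w | depth n (fun e => W e w < p)].
  apply/seteqP; split => w; first by move=> /infinite_cluster h m _; exact: h.
  by move=> h; apply/infinite_cluster => m; exact: h.
have mA : measurable A by rewrite AE; apply: bigcapT_measurable => m; have [] := P_depth m.
have [mD PD] := P_depth n.
rewrite -lee_fin fineK ?fin_num_measure// -PD; apply: le_measure; rewrite ?inE//.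
by rewrite AE; exact: bigcap_inf.
Qed.

End percolation.

(** * Survival near criticality and the final bounds *)

Lemma exp_one_minus_le (R : realType) (x : R) n : 0 <= x <= 1 ->
  (1 - x) ^+ n <= 1 - n%:R * x + (n%:R * x) ^+ 2.
Proof.
move=> /andP[x0 x1]; elim: n => [|n IH]; first by rewrite expr0; lra.
rewrite exprS; apply: (@le_trans _ _ ((1 - x) * (1 - n%:R * x + (n%:R * x) ^+ 2))).
  by apply: ler_wpM2l => //; lra.
rewrite -natr1; have n0 : 0 <= (n%:R : R) by exact: ler0n.
have x2 := sqr_ge0 x; have h1 := mulr_ge0 n0 x2.
have h2 : 0 <= x * (n%:R * x) ^+ 2 by rewrite mulr_ge0 ?sqr_ge0.
by move: x2 h1 h2; rewrite !expr2; lra.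
Qed.

(** The left side [L] is a subsolution of the recursion: [1 - (1 - p L) ^+ b >= b p L - (b p L) ^+
    2], and since [b ^+ 2 * L = b p - 1] and [p <= 1], the quadratic term is at most [(b p - 1) L],
    the excess of [b p L] over [L]. *)
Lemma survival_ge (R : realType) (p : R) (b n : nat) : (0 < b)%N -> b%:R^-1 < p <= 1 ->
  (b%:R * p - 1) / b%:R ^+ 2 <= survival p b n.
Proof.
move=> b0 /andP[bp p1]; have B0 : 0 < (b%:R : R) by rewrite ltr0n.
have B1 : 1 <= (b%:R : R) by rewrite ler1n.
have bp1 : 1 < b%:R * p by rewrite -ltr_pdivrMl// mulr1.
have p0 : 0 < p by apply: lt_trans bp; rewrite invr_gt0.
set L := _ / _.
have B2 : 0 < (b%:R : R) ^+ 2 by rewrite exprn_gt0.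
have L0 : 0 <= L by apply: divr_ge0; rewrite ?subr_ge0; exact: ltW.
have BL : b%:R ^+ 2 * L = b%:R * p - 1 by rewrite /L mulrC divfK// gt_eqF.
have BB : b%:R <= b%:R ^+ 2 :> R by rewrite expr2 ler_peMr// ltW.
have bpb : b%:R * p <= b%:R by rewrite ler_piMr// ltW.
have L1 : L <= 1 by rewrite /L ler_pdivrMr// mul1r; lra.
have p2 : p ^+ 2 <= 1 by rewrite exprn_ile1// ltW.
have pL1 : p * L <= 1 by rewrite mulr_ile1// ltW.
have pL0 : 0 <= p * L by rewrite mulr_ge0// ltW.
suff : L <= survival p b n <= 1 by case/andP.
elim: n => [|n /andP[IH1 IH2]] /=; first by rewrite L1 lexx.
have s0 : 0 <= survival p b n by exact: le_trans IH1.
have s1 : p * survival p b n <= 1 by apply: mulr_ile1 => //; exact: ltW.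
apply/andP; split; last by rewrite gerBl exprn_ge0// subr_ge0.
apply: (@le_trans _ _ (1 - (1 - p * L) ^+ b)); last first.
  rewrite lerD2l lerN2; apply: lerXn2r; rewrite ?nnegrE ?subr_ge0//.
  by rewrite lerD2l lerN2 ler_pM2l.
have := @exp_one_minus_le R (p * L) b; rewrite pL0 pL1 => /(_ isT).
have e1 : (b%:R * (p * L)) ^+ 2 = p ^+ 2 * (b%:R ^+ 2 * L) * L by ring.
have : p ^+ 2 * (b%:R ^+ 2 * L) * L <= (b%:R ^+ 2 * L) * L.
  have X0 : 0 <= b%:R ^+ 2 * L * L by apply: mulr_ge0 => //; apply: mulr_ge0 => //; exact: ltW.
  by rewrite -[leLHS]mulrA ler_piMl.
by rewrite e1 BL; lra.
Qed.

Theorem mainTheorem13 (R : realType) :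
  (forall d : nat, (3 <= d)%N ->
   forall p : R, ((d.-1)%:R)^-1 < p <= 1 ->
   forall mu : R, 0 < mu ->
   forall eta0 : seq nat -> bool,
   forall (dO : measure_display) (O : measurableType dO)
     (P : probability O R) (W : seq nat -> O -> R),
   iid_uniform P W ->
   speed_at_least d p mu eta0
     (p ^+ 3 * (p * theta_tilde d.-1 p P W) ^+ 9 /
      (48 * expR 1 ^+ 2 * (d%:R) ^+ 3 * ln (d%:R))))
  /\
  (forall d : nat, (3 <= d)%N ->
   exists c : R, 0 < c /\
   exists delta : R, 0 < delta /\
   forall p : R, ((d.-1)%:R)^-1 < p < ((d.-1)%:R)^-1 + delta -> p <= 1 ->
   forall mu : R, 0 < mu ->
   forall eta0 : seq nat -> bool,
   speed_at_least d p mu eta0 (c * (p - ((d.-1)%:R)^-1) ^+ 9)).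
Proof.
split=> d d3.
  move=> p /andP[pb p1] mu mu0 eta0 dO O P W iW.
  have D1 : 0 < (d.-1%:R : R) by rewrite ltr0n; lia.
  have p0 : 0 < p by apply: lt_trans pb; rewrite invr_gt0.
  have p01 : 0 <= p <= 1 by rewrite (ltW p0).
  set th := theta_tilde _ _ _ _.
  have th0 : 0 <= th by exact: theta_tilde_ge0.
  have thn n : th <= survival p d.-1 n by exact: theta_tilde_le.
  (* For a vanishing percolation probability the claimed speed is 0; [speed_core] requires a
     positive [y]. *)
  move: th0; rewrite le_eqVlt => /orP[/eqP <-|th0].
    by rewrite mulr0 expr0n /= mulr0 mul0r; exact: speed_at_least0.
  have y0 : 0 < p * th by rewrite mulr_gt0.
  have y1 : p * th <= 1 by have := thn 0%N; rewrite /= => t1; rewrite mulr_ile1// ltW.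
  set y := p * th in y0 y1 *.
  apply: (@speed_at_least_le _ _ _ _ _ (y ^+ 5 / (128 * d%:R ^+ 2 * ln d%:R))); last first.
    apply: speed_core => //; first by rewrite y0.
    by move=> n; rewrite ler_pM2l.
  have D3 : (3 : R) <= d%:R by rewrite ler_nat.
  have D0 : 0 < (d%:R : R) by lra.
  have ln0 := @lnd0 R d d3.
  have e1 : (2 : R) <= expR 1 by have := expR_ge1Dx (1 : R); lra.
  have e2 : (4 : R) <= expR 1 ^+ 2.
    rewrite expr2 (_ : (4 : R) = 2 * 2); last by ring.
    by apply: ler_pM.
  have E0 : 0 < expR 1 ^+ 2 :> R by rewrite exprn_gt0// expR_gt0.
  rewrite ler_pdivrMr ?mulr_gt0 ?exprn_gt0// [leRHS]mulrAC ler_pdivlMr ?mulr_gt0 ?exprn_gt0//.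
  have q5 : 0 <= y ^+ 5 by rewrite exprn_ge0// ltW.
  have q9 : p ^+ 3 * y ^+ 9 <= y ^+ 5.
    rewrite (_ : y ^+ 9 = y ^+ 4 * y ^+ 5); last by ring.
    rewrite mulrA ler_piMl// mulr_ile1 ?exprn_ge0 ?exprn_ile1 ?(ltW p0) ?(ltW y0)//.
  have DD : 0 < (d%:R : R) ^+ 2 * ln d%:R by rewrite mulr_gt0 ?exprn_gt0.
  (* The constants compare through [128 <= 48 * 4 * 3], with [4 <= e ^+ 2] and [3 <= d]. *)
  have h1 : 128 * ((d%:R : R) ^+ 2 * ln d%:R) <= 48 * expR 1 ^+ 2 * d%:R * (d%:R ^+ 2 * ln d%:R).
    apply: ler_wpM2r; first exact: ltW.
    apply: (@le_trans _ _ ((48 * 4) * 3)); first by lra.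
    by apply: ler_pM => //; apply: ler_wpM2l.
  have := ler_pM (mulr_ge0 (exprn_ge0 3 (ltW p0)) (exprn_ge0 9 (ltW y0))) (mulr_ge0 (ler0n _ 128) (ltW DD)) q9 h1.
  by move=> h; congr (_ <= _): h; ring.
have b0 : (0 < d.-1)%N by lia.
have B0 : 0 < (d.-1%:R : R) by rewrite ltr0n.
have D0 : 0 < (d%:R : R) by rewrite ltr0n; lia.
have ln0 := @lnd0 R d d3.
pose K : R := 128 * d%:R ^+ 2 * ln d%:R.
have K0 : 0 < K by rewrite !mulr_gt0 ?exprn_gt0.
(* The factor [b ^+ 10], with [b = d - 1], is the fifth power of the [b ^+ 2] in [survival_ge]; the
   ninth power of [p - 1 / b] is below the fifth because this difference is at most 1. *)
exists ((d.-1%:R ^+ 10 * K)^-1); split; first by rewrite invr_gt0 mulr_gt0// exprn_gt0.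
exists 1; split => // p /andP[pb _] p1 mu mu0 eta0.
have p0 : 0 < p by apply: lt_trans pb; rewrite invr_gt0.
set b : R := d.-1%:R in B0 pb *.
set L := (b * p - 1) / b ^+ 2.
have bp1 : 1 < b * p by rewrite -ltr_pdivrMl// mulr1.
have L0 : 0 < L by rewrite divr_gt0 ?subr_gt0// exprn_gt0.
have Lle n : L <= survival p d.-1 n by apply: survival_ge => //; rewrite pb.
have y0 : 0 < p * L by rewrite mulr_gt0.
have y1 : p * L <= 1 by rewrite mulr_ile1 ?(ltW p0) ?(ltW L0)//; exact: (Lle 0%N).
apply: (@speed_at_least_le _ _ _ _ _ ((p * L) ^+ 5 / K)); last first.
  apply: speed_core => //; [by rewrite (ltW p0)|by rewrite y0|].
  by move=> n; rewrite ler_pM2l.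
have x0 : 0 < p - b^-1 by rewrite subr_gt0.
have x1 : p - b^-1 <= 1 by rewrite lerBlDr (le_trans p1)// lerDl invr_ge0 ltW.
have hy : (p - b^-1) / b ^+ 2 <= p * L.
  rewrite (_ : p * L = (p * b) * ((p - b^-1) / b ^+ 2)); last by rewrite /L; field; rewrite gt_eqF.
  rewrite ler_peMl; last by rewrite mulrC ltW.
    by [].
  by apply: divr_ge0; [exact: ltW|apply: exprn_ge0; exact: ltW].
have h5 : ((p - b^-1) / b ^+ 2) ^+ 5 <= (p * L) ^+ 5.
  by apply: lerXn2r => //; rewrite nnegrE ?divr_ge0 ?exprn_ge0 ?(ltW x0) ?(ltW B0) ?(ltW y0).
have h9 : (p - b^-1) ^+ 9 <= (p - b^-1) ^+ 5 by apply: ler_wiXn2l => //; exact: ltW.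
rewrite invfM -mulrA mulrCA mulrC; apply: ler_wpM2r; first by rewrite invr_ge0 ltW.
apply: le_trans h5; rewrite exprMn exprVn -exprM mulrC; apply: ler_wpM2r h9.
by rewrite invr_ge0 exprn_ge0// ltW.
Qed.
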